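(* Let $Y$ be the complex unit disk $\mathbb{D}$ equipped with the hyperbolic metric $d$ given by the length element $|dz|/(1-|z|^2)$ (so that the circle centered at $0$ of hyperbolic radius $R$ has hyperbolic length $\tfrac{\pi}{2}(e^{2R}-e^{-2R})$), and let $\varepsilon>2$. Use $0$ as the base point for all uniformizations. Then: (a) $Y_\varepsilon$ is not a uniform domain. (b) There is $\varepsilon_1>0$ such that, with $Z$ the unit disk $\mathbb{D}$ equipped with the scaled hyperbolic metric $d_Z(z,w)=\tfrac{\varepsilon_1}{\varepsilon}d(z,w)$, the identity map $Y\to Z$ is an $(\tfrac{\varepsilon_1}{\varepsilon},0)$-rough similarity and $Z_\varepsilon$ is a uniform domain. Consequently, there exist Gromov hyperbolic spaces $X$ and $Y$, a number $\varepsilon>0$, constants $L>0$, $C\ge0$ and an $(L,C)$-rough similarity $\Phi:Y\to X$ such that $X_\varepsilon$ is a uniform domain but $Y_\varepsilon$ is not a uniform domain.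
   Context: Gromov hyperbolic: a complete, unbounded, locally compact, geodesic metric space $(Z,d)$ is Gromov hyperbolic if there is $\delta\ge 0$ such that for all $x,y,z\in Z$ and all geodesic paths $[x,y],[y,z],[z,x]$ joining them, every point of $[x,y]$ lies within distance $\le\delta$ of some point of $[y,z]\cup[z,x]$. Rough similarity: a map $\Phi:Y\to X$ between metric spaces is an $(L,C)$-rough similarity, where $L>0$ and $C\ge0$, if $L\,d_Y(x,y)-C\le d_X(\Phi(x),\Phi(y))\le L\,d_Y(x,y)+C$ for all $x,y\in Y$ and the Hausdorff distance between $\Phi(Y)$ and $X$ is at most $C$. Uniformization: for a Gromov hyperbolic space $(Z,d)$, base point $z_0\in Z$ and $\varepsilon>0$, let $\rho_\varepsilon^Z(z)=e^{-\varepsilon d(z,z_0)}$ and $d_\varepsilon(z_1,z_2)=\inf_\gamma\int_\gamma\rho_\varepsilon^Z\,ds$, the infimum over all rectifiable paths $\gamma$ in $Z$ with end points $z_1,z_2$, and $ds$ being arc-length measure with respect to $d$. The metric space $(Z,d_\varepsilon)$ is denoted $Z_\varepsilon$. Uniform domain: let $(Z,d)$ be a locally complete (every point has a complete neighborhood), non-complete metric space, and $\partial Z:=\overline Z\setminus Z$, where $\overline Z$ is the metric completion. $Z$ is a uniform domain if there is $\lambda\ge1$ such that each pair $x,y\in Z$ can be joined by a rectifiable curve $\gamma$ in $Z$ such that (1) $\ell(\gamma)\le\lambda d(x,y)$, and (2) for each $z\in\gamma$, $\operatorname{dist}(z,\partial Z)\ge\lambda^{-1}\min\{\ell(\gamma(x,z)),\ell(\gamma(z,y))\}$,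 where $\gamma(x,z)$ and $\gamma(z,y)$ denote subcurves of $\gamma$ with the indicated end points. Here $\ell$ denotes length with respect to the metric of the space considered. *)

(* Defs.v *)
From HB Require Import structures.
From mathcomp Require Import all_boot all_order all_algebra generic_quotient.
From mathcomp Require Import all_classical all_reals all_analysis.
From mathcomp Require Import complex lra.

Set Implicit Arguments.
Unset Strict Implicit.
Unset Printing Implicit Defensive.

Import Order.TTheory GRing.Theory Num.Theory.
Import numFieldNormedType.Exports.

Local Open Scope quotient_scope.
Local Open Scope classical_set_scope.
Local Open Scope ring_scope.

Definition is_metric (R : realType) (T : Type) (d : T -> T -> R) : Prop :=
  [/\ forall x, d x x = 0,
      forall x y, d x y = 0 -> x = y,
      forall x y, d x y = d y x &
      forall y x z, d x z <= d x y + d y z].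

(* The set [T] with the topology and uniformity of [d], whatever structures [T]
   may already carry. *)
Definition metrized (R : realType) (T : Type) (d : T -> T -> R)
  (dP : is_metric d) : Type := T.

Section metrized.
Context {R : realType} {T : Type} {d : T -> T -> R} (dP : is_metric d).

Let dxx : forall x, d x x = 0. Proof. by case: dP. Qed.
Let dpos : forall x y, d x y = 0 -> x = y. Proof. by case: dP. Qed.
Let dsym : forall x y, d x y = d y x. Proof. by case: dP. Qed.
Let dtri : forall y x z, d x z <= d x y + d y z. Proof. by case: dP. Qed.

HB.instance Definition _ := gen_eqMixin (metrized dP).
HB.instance Definition _ := gen_choiceMixin (metrized dP).
HB.instance Definition _ :=
  isMetric.Build R (metrized dP) dxx dpos dsym dtri.

End metrized.

Definition complete_set (R : realType) (M : metricType R) (A : set M) : Prop :=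
  forall F : set_system M, ProperFilter F -> F A -> cauchy F ->
  exists2 x, A x & F --> x.

Definition complete_space (R : realType) (M : metricType R) : Prop :=
  complete_set [set: M].

Definition locally_complete (R : realType) (M : metricType R) : Prop :=
  forall x : M, exists2 U : set M, nbhs x U & complete_set U.

Definition unbounded_space (R : realType) (M : metricType R) : Prop :=
  forall C : R, exists x y : M, C < mdist x y.

Record cauchy_sequence (R : realType) (M : metricType R) := CauchySequence {
  cseq :> nat -> M ;
  cseqP : cauchy (cseq @ \oo) }.

HB.instance Definition _ (R : realType) (M : metricType R) :=
  gen_eqMixin (cauchy_sequence M).
HB.instance Definition _ (R : realType) (M : metricType R) :=
  gen_choiceMixin (cauchy_sequence M).

Section completion.
Context {R : realType} {M : metricType R}.
Implicit Types x y z : cauchy_sequence M.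

Definition cdist x y : R := lim (mdist (x n) (y n) @[n --> \oo]).

Lemma cseq_near x (e : R) : 0 < e ->
  exists N, forall m n, (N <= m)%N -> (N <= n)%N -> mdist (x m) (x n) < e.
Proof.
move=> e0.
have /cauchy_ballP/(_ e e0) := @cseqP _ _ x.
rewrite near_map2 => -[[A B] /= [[a _ aA] [b _ bB]] AB].
exists (maxn a b) => m n mab nab.
have am : (a <= m)%N := leq_trans (leq_maxl a b) mab.
have bn : (b <= n)%N := leq_trans (leq_maxr a b) nab.
have /= := AB (m, n) (conj (aA m am) (bB n bn)).
by rewrite ballEmdist.
Qed.

Lemma is_cvg_cdist x y : cvgn (fun n => mdist (x n) (y n)).
Proof.
apply/cauchy_cvgP/cauchy_exP => e e0.
have e2 : 0 < e / 2 by rewrite divr_gt0.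
have [a xa] := cseq_near x e2; have [b yb] := cseq_near y e2.
pose N := maxn a b; exists (mdist (x N) (y N)), N => //= n Nn.
have xN := xa _ _ (leq_maxl a b) (leq_trans (leq_maxl a b) Nn).
have yN := yb _ _ (leq_maxr a b) (leq_trans (leq_maxr a b) Nn).
have := metric_triangle (x N) (x n) (y N).
have := metric_triangle (x n) (y n) (y N).
have := metric_triangle (x n) (x N) (y n).
have := metric_triangle (x N) (y N) (y n).
rewrite (metric_sym (x n) (x N)) (metric_sym (y n) (y N)) -/N in xN yN *.
rewrite /ball/= ltr_norml; set u := mdist _ _ in xN *.
by move=> *; apply/andP; split; lra.
Qed.

Lemma cdistxx x : cdist x x = 0.
Proof.
rewrite /cdist; under eq_fun do rewrite mdistxx.
by apply: cvg_lim => //; exact: cvg_cst.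
Qed.

Lemma cdistC x y : cdist x y = cdist y x.
Proof. by rewrite /cdist; under eq_fun do rewrite metric_sym. Qed.

Lemma cdist_triangle y x z : cdist x z <= cdist x y + cdist y z.
Proof.
rewrite /cdist -limD; [|exact: is_cvg_cdist..].
apply: ler_lim; [exact: is_cvg_cdist| |].
  by apply: is_cvgD; exact: is_cvg_cdist.
by apply: nearW => n; exact: metric_triangle.
Qed.

Lemma cdist_ge0 x y : 0 <= cdist x y.
Proof.
apply: limr_ge; first exact: is_cvg_cdist.
by apply: nearW => n; exact: mdist_ge0.
Qed.

Definition cequiv x y := cdist x y == 0.

Lemma cequiv_refl : reflexive cequiv.
Proof. by move=> x; rewrite /cequiv cdistxx. Qed.

Lemma cequiv_sym : ssrbool.symmetric cequiv.
Proof. by move=> x y; rewrite /cequiv cdistC. Qed.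

Lemma cequiv_trans : ssrbool.transitive cequiv.
Proof.
move=> y x z /eqP xy /eqP yz; rewrite /cequiv eq_le cdist_ge0 andbT.
by rewrite (le_trans (cdist_triangle y x z))// xy yz addr0.
Qed.

Canonical cequiv_equiv : equiv_rel (cauchy_sequence M) :=
  EquivRel cequiv cequiv_refl cequiv_sym cequiv_trans.

End completion.

(* Cauchy sequences modulo distance zero; [to_completion_isometry],
   [dense_to_completion] and [complete_completion] below show that this is the
   metric completion. *)
Definition completion (R : realType) (M : metricType R) : Type :=
  {eq_quot (@cequiv_equiv R M)}.

Section completion_metric.
Context {R : realType} {M : metricType R}.
Local Notation Mbar := {eq_quot (@cequiv_equiv R M)}.

HB.instance Definition _ := Choice.copy (completion M) Mbar.

Definition completion_dist (x y : completion M) : R :=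
  cdist (repr (x : Mbar)) (repr (y : Mbar)).

Lemma completion_distxx x : completion_dist x x = 0.
Proof. exact: cdistxx. Qed.

Lemma completion_dist_eq0 x y : completion_dist x y = 0 -> x = y.
Proof.
move=> /eqP xy; rewrite -[x](@reprK _ Mbar) -[y](@reprK _ Mbar).
exact/eqquotP.
Qed.

Lemma completion_distC x y : completion_dist x y = completion_dist y x.
Proof. exact: cdistC. Qed.

Lemma completion_dist_triangle y x z :
  completion_dist x z <= completion_dist x y + completion_dist y z.
Proof. exact: cdist_triangle. Qed.

HB.instance Definition _ := isMetric.Build R (completion M)
  completion_distxx completion_dist_eq0 completion_distC
  completion_dist_triangle.

Lemma cauchy_cst (x : M) : cauchy ((fun _ : nat => x) @ \oo).
Proof.
move=> A entA; exists ([set x], [set x]); first by split; exists 0%N.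
by move=> [_ _] /= [-> ->]; exact: entourage_refl.
Qed.

Definition to_completion (x : M) : completion M :=
  \pi_Mbar (CauchySequence (cauchy_cst x)).

Lemma completion_distE (x y : cauchy_sequence M) :
  mdist (\pi_Mbar x : completion M) (\pi_Mbar y : completion M) = cdist x y.
Proof.
have repi (z : cauchy_sequence M) : cdist (repr (\pi_Mbar z)) z = 0.
  have /eqquotP/eqP // : repr (\pi_Mbar z) = z %[mod Mbar] by rewrite reprK.
rewrite [LHS]/(completion_dist _ _) /completion_dist.
move: (repi x) (repi y); move: (repr _) (repr _) => y' x' xx' yy'.
have := cdist_triangle x x' y'; have := cdist_triangle y x y'.
have := cdist_triangle x' x y; have := cdist_triangle y' x' y.
rewrite (cdistC x x') (cdistC y y') xx' yy' => *.
by apply: le_anti; apply/andP; split; lra.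
Qed.

Lemma to_completion_isometry (x y : M) :
  mdist (to_completion x) (to_completion y) = mdist x y.
Proof.
rewrite completion_distE /cdist /=.
by apply: cvg_lim => //; exact: cvg_cst.
Qed.

Lemma cvg_to_completion (x : cauchy_sequence M) :
  to_completion (x n) @[n --> \oo] --> (\pi_Mbar x : completion M).
Proof.
apply/metricType_numDomainType.cvgrPdist_le => e e0.
have [N xN] := cseq_near x e0; exists N => // n /= Nn.
rewrite completion_distE /cdist /=.
apply: limr_le.
  exact: (@is_cvg_cdist _ _ x (CauchySequence (cauchy_cst (x n)))).
by exists N => // m /= Nm; rewrite ltW// xN.
Qed.

Lemma dense_to_completion : dense (range to_completion).
Proof.
move=> U [p Up] oU.
have := @cvg_to_completion (repr (p : Mbar)).
rewrite reprK => /(_ U) []; first exact: open_nbhs_nbhs.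
move=> N _ /(_ N (leqnn N)) UN; eexists; split; first exact: UN.
by eexists.
Qed.

Lemma complete_completion : complete_space (completion M).
Proof.
move=> F FF _ /cauchyP Fc.
have /choice[p Fp] k : exists q : M, F (ball (to_completion q) k.+1%:R^-1).
  have k2 : 0 < k.+1%:R^-1 / 2 :> R by rewrite divr_gt0// invr_gt0.
  have [c Fcb] := Fc _ k2.
  have cc : (ball c (k.+1%:R^-1 / 2))^° !=set0.
    by exists c; exact: nbhsx_ballx.
  have [c' [cq [q _ qE]]] := dense_to_completion cc (open_interior _).
  rewrite -qE in cq.
  exists q; apply: filterS Fcb => z cz.
  rewrite (splitr k.+1%:R^-1); apply: ball_triangle cz.
  exact/ball_sym/(interior_subset cq).
have pE k l : mdist (p k) (p l) < k.+1%:R^-1 + l.+1%:R^-1.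
  have [z [kz lz]] := filter_ex (filterI (Fp k) (Fp l)).
  have := ball_triangle kz (ball_sym lz).
  by rewrite ballEmdist /= to_completion_isometry.
have invle (k N : nat) : (N <= k)%N -> k.+1%:R^-1 <= N.+1%:R^-1 :> R.
  by move=> Nk; rewrite lef_pV2 ?posrE ?ltr0n// ler_nat.
have small (e : R) : 0 < e -> exists N : nat, N.+1%:R^-1 < e.
  move=> e0; have [N _ /(_ N (leqnn N))] := near_infty_natSinv_lt (PosNum e0).
  by exists N.
have pc : cauchy (p @ \oo).
  apply: cauchy_exP => e e0; have [N Ne] := small _ (divr_gt0 e0 (ltr0n _ 2)).
  exists (p N); exists N => // k /= Nk; rewrite ballEmdist /=.
  apply: (lt_le_trans (pE _ _)); have := invle _ _ Nk.
  by move: Ne; move: (N.+1%:R^-1) (k.+1%:R^-1) => u v; lra.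
exists (\pi_Mbar (CauchySequence pc)) => //.
apply/metricType_numDomainType.fcvgrPdist_lt => e e0.
have [N Ne] := small _ (divr_gt0 e0 (ltr0n _ 2)).
have := @cvg_to_completion (CauchySequence pc).
move=> /(_ _ (nbhsx_ballx _ _ (divr_gt0 e0 (ltr0n _ 2))))[K _ pK].
pose m := maxn N K.
have := pK m (leq_maxr _ _); have := invle m N (leq_maxl _ _).
move=> mN mK; apply: filterS (Fp m) => z mz.
have := metric_triangle (\pi_Mbar (CauchySequence pc) : completion M)
  (to_completion (p m)) z.
rewrite !ballEmdist /= in mK mz.
move: mN mK mz Ne => /=; move: (m.+1%:R^-1) (N.+1%:R^-1) => u v; lra.
Qed.

End completion_metric.

(* [\partial M], as a subset of the completion of [M] *)
Definition boundary (R : realType) (M : metricType R) : set (completion M) :=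
  ~` range to_completion.

Section curves.
Context {R : realType} {M : metricType R}.
Implicit Types (a b : R) (gamma : R -> M).

Definition curve a b gamma : Prop :=
  a <= b /\ {within `[a, b], continuous gamma}.

(* [a :: s] is the increasing list of subdivision points, as in the library's
   [variation] for real functions. *)
Definition mvariation a b gamma (s : seq R) : R :=
  let F := gamma \o nth b (a :: s) in
  \sum_(0 <= n < size s) mdist (F n) (F n.+1).

Definition curve_length a b gamma : \bar R :=
  ereal_sup [set (mvariation a b gamma s)%:E | s in itv_partition a b].

Definition rectifiable a b gamma : Prop :=
  curve a b gamma /\ (curve_length a b gamma < +oo)%E.

(* The arc-length parametrization: the point reached after length [u]. The
   choice of [t] is immaterial, since a curve is constant on a parameter
   interval on which its length does not increase. *)
Definition arc_param a b gamma (u : R) : M :=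
  gamma (get [set t | a <= t <= b /\ curve_length a t gamma = u%:E]).

(* [\int_gamma rho ds]; meaningful for rectifiable curves. *)
Definition path_integral (rho : M -> R) a b gamma : \bar R :=
  (\int[lebesgue_measure]_(u in `[0%R, fine (curve_length a b gamma)])
    (rho (arc_param a b gamma u))%:E)%E.

(* The length distance with length element [rho ds]. Its value is junk (0) for
   points not joined by a rectifiable curve. *)
Definition path_dist (rho : M -> R) (x y : M) : R :=
  fine (ereal_inf [set l | exists a b gamma,
    [/\ rectifiable a b gamma, gamma a = x, gamma b = y &
        l = path_integral rho a b gamma]]).

Definition uniformized_dist (eps : R) (z0 : M) : M -> M -> R :=
  path_dist (fun z => expR (- (eps * mdist z z0))).

Definition geodesic_path (x y : M) gamma : Prop :=
  [/\ gamma 0 = x, gamma (mdist x y) = y &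
      {in `[0, mdist x y] &, forall s t, mdist (gamma s) (gamma t) = `|s - t|}].

Definition closed_simple_curve a b gamma : Prop :=
  [/\ a < b, curve a b gamma, gamma a = gamma b &
      {in `[a, b[ &, injective gamma}].

End curves.

Definition gromov_hyperbolic (R : realType) (M : metricType R) : Prop :=
  [/\ complete_space M,
      unbounded_space M,
      locally_compact [set: M],
      forall x y : M, exists gamma, geodesic_path x y gamma &
      exists2 delta : R, 0 <= delta &
        forall (x y z : M) (gxy gyz gzx : R -> M),
          geodesic_path x y gxy -> geodesic_path y z gyz ->
          geodesic_path z x gzx ->
          forall p, (gxy @` `[0, mdist x y]) p ->
          exists2 q, ((gyz @` `[0, mdist y z]) `|` (gzx @` `[0, mdist z x])) q &
            mdist p q <= delta].

Definition uniform_domain (R : realType) (M : metricType R) : Prop :=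
  [/\ locally_complete M,
      ~ complete_space M &
      exists2 lambda : R, 1 <= lambda &
        forall x y : M, exists a b gamma,
          [/\ rectifiable a b gamma, gamma a = x, gamma b = y,
              (curve_length a b gamma <= (lambda * mdist x y)%:E)%E &
              forall t, a <= t <= b ->
                (lambda^-1%:E *
                   mine (curve_length a t gamma) (curve_length t b gamma)
                 <= edist_inf (@boundary R M) (to_completion (gamma t)))%E]].

Definition hausdorff_dist (R : realType) (M : metricType R) (A B : set M) :
    \bar R :=
  maxe (ereal_sup [set edist_inf B x | x in A])
       (ereal_sup [set edist_inf A x | x in B]).

Definition rough_similarity (R : realType) (Y X : metricType R) (L C : R)
    (Phi : Y -> X) : Prop :=
  [/\ 0 < L, 0 <= C,
      forall x y, L * mdist x y - C <= mdist (Phi x) (Phi y) <= L * mdist x y + C &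
      (hausdorff_dist (range Phi) [set: X] <= C%:E)%E].

(* The structures on [disk R] itself are the Euclidean ones. *)
Definition disk (R : realType) : Type := {z : R[i] | Normc.normc z < 1}.

Section disk.
Context {R : realType}.
Local Notation D := (disk R).

HB.instance Definition _ := Choice.copy D {z : R[i] | Normc.normc z < 1}.

Definition disk_dist (z w : D) : R := Normc.normc (val z - val w).

Lemma disk_distxx z : disk_dist z z = 0.
Proof. by rewrite /disk_dist subrr Normc.normc0. Qed.

Lemma disk_dist_eq0 z w : disk_dist z w = 0 -> z = w.
Proof. by move=> /Normc.eq0_normc/eqP; rewrite subr_eq0 => /eqP/val_inj. Qed.

Lemma disk_distC z w : disk_dist z w = disk_dist w z.
Proof. by rewrite /disk_dist -normcN opprB. Qed.

Lemma disk_dist_triangle w z v : disk_dist z v <= disk_dist z w + disk_dist w v.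
Proof.
rewrite /disk_dist -[val z - val v](subrKA (val w)).
exact: le_normcD.
Qed.

HB.instance Definition _ := isMetric.Build R D
  disk_distxx disk_dist_eq0 disk_distC disk_dist_triangle.

Lemma normc0_lt1 : Normc.normc (0 : R[i]) < 1.
Proof. by rewrite Normc.normc0 ltr01. Qed.

Definition disk0 : D := exist _ 0 normc0_lt1.

Definition hyperbolic_dist : D -> D -> R :=
  path_dist (fun z : D => (1 - Normc.normc (val z) ^+ 2)^-1).

End disk.

(* Main.v *)
Require Import Defs.
From mathcomp Require Import all_boot all_order all_algebra generic_quotient.
From mathcomp Require Import all_classical all_reals all_analysis.
From mathcomp Require Import complex ring lra.

Set Implicit Arguments.
Unset Strict Implicit.
Unset Printing Implicit Defensive.

Import Order.TTheory GRing.Theory Num.Theory.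
Import numFieldNormedType.Exports.

Local Open Scope classical_set_scope.
Local Open Scope ring_scope.

(**
With [d] the hyperbolic distance from [0], the density of the uniformization with
parameter [eps] is [expR (- eps d) / (1 - |z|^2)] with respect to [|dz|], that is,
comparable to [(1 - |z|)^(eps / 2 - 1)].  For [eps = 2] this is [1 / (1 + |z|)^2],
so the uniformized space is bilipschitz to the Euclidean disk, which is a uniform
domain; scaling the metric by [2 / eps] reduces any [eps] to that case.  For
[eps > 2] the density vanishes on the unit circle, which collapses to one boundary
point at distance at most [expR (- eps r) / eps] from the points with [d = r].
Antipodal points with [d = r] are then at distance at most
[2 expR (- eps r) / eps].  A uniform curve between them stays in [d <= r + K], hence
its length is at least a multiple of [expR (- (eps - 2) r)], which is absurd for
large [r].

The hyperbolic distance is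
[ln ((|1 - z w^*| + |z - w|) / sqrt ((1 - |z|^2) (1 - |w|^2)))].
Since [|1 - z w^*|] is a quasi-metric, this formula gives the four-point condition,
and with it Gromov hyperbolicity.

Length integrals are handled without changes of variables: a curve [g] with a
function [Phi] such that [rho (g x) d(g s, g t) <= Phi t - Phi s + e (t - s)] near
every [x] bounds the distance with density [rho] by the increment of [Phi], and
locally Lipschitz functions with constant [rho] bound it from below.  Both are local
conditions, and [cousin] makes them global.
*)

(** * Length of curves *)

(** The bound [d <= r + K] comes from the uniformity condition itself. A point of the curve with
    [d = h > r + 1] is at uniformized distance at least [expR (- eps (r + 1))] from both end points,
    so both subcurves are at least that long, while its distance to the boundary is at most
    [expR (- eps h) / eps]; hence [h <= r + 1 + ln lambda]. The antipodal points keep Euclidean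
    distance at least 1, and comparing the two bounds for the length leaves [expR (2 r) <= C] with
    [C] independent of [r]. The threshold 2 is the exponential growth rate of hyperbolic circles.

    Boundary points are classes of Cauchy sequences. They become tractable because closed balls of
    the original space stay complete for the uniformized distance, so a sequence representing a
    boundary point leaves every ball. Lower bounds for the distance to the boundary therefore only
    need estimates for far away points, and upper bounds only need the end of one geodesic ray. *)

Lemma norm_minB_le (R : realDomainType) (a b a' b' c : R) :
  `|a - a'| <= c -> `|b - b'| <= c -> `|Num.min a b - Num.min a' b'| <= c.
Proof.
rewrite !ler_norml => /andP[? ?] /andP[? ?].
by case: (leP a b) => ?; case: (leP a' b') => ?; apply/andP; split; lra.
Qed.

Lemma norm_maxB_le (R : realDomainType) (a b a' b' c : R) :
  `|a - a'| <= c -> `|b - b'| <= c -> `|Num.max a b - Num.max a' b'| <= c.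
Proof.
rewrite !ler_norml => /andP[? ?] /andP[? ?].
by case: (leP a b) => ?; case: (leP a' b') => ?; apply/andP; split; lra.
Qed.

(** Let [c] be the supremum of the [t] with [P a t]: the local property at [c] joins some [t <= c]
    to points beyond [c], unless [b] is already within reach. This stands in for a finite
    subdivision subordinate to a gauge. *)
Lemma cousin (R : realType) (a b : R) (P : R -> R -> Prop) : a <= b ->
  (forall s t u, a <= s -> s <= t -> t <= u -> u <= b ->
    P s t -> P t u -> P s u) ->
  (forall x, a <= x <= b -> exists2 d, 0 < d & forall s t,
    a <= s -> s <= x -> x <= t -> t <= b -> x - d < s -> t < x + d -> P s t) ->
  P a b.
Proof.
move=> ab Ptr Ploc.
pose S := [set t | a <= t <= b /\ P a t].
have Sa : S a.
  split; first by rewrite lexx.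
  have [|d d0 dP] := Ploc a; first by rewrite lexx.
  by apply: dP => //; rewrite ?ltrBlDr ?ltrDl.
have Sb : has_ubound S by exists b => t [/andP[]].
have hS : has_sup S by split => //; exists a.
set c := sup S.
have ac : a <= c by apply: ub_le_sup.
have cb : c <= b by apply: ge_sup; [exists a|move=> t [/andP[]]].
have [|d d0 dP] := Ploc c; first by rewrite ac.
have [t [/andP[at_ tb] Pt] ct] := sup_adherent d0 hS.
rewrite -/c in ct.
have tc : t <= c by apply: ub_le_sup => //; split => //; rewrite at_.
have [bcd|cdb] := ltP b (c + d / 2).
  apply: (Ptr a t b) => //; apply: dP => //; apply: lt_le_trans bcd _.
  by rewrite lerD2l ler_pdivrMr// ler_pMr// ler1n.
have cd : c + d / 2 < c + d by rewrite ltrD2l ltr_pdivrMr// ltr_pMr// ltr1n.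
have cc : c <= c + d / 2 by rewrite lerDl ltW// divr_gt0.
have : S (c + d / 2).
  split; first by rewrite (le_trans ac cc).
  apply: (Ptr a t) => //; first exact: le_trans tc cc.
  exact: dP.
move=> /(ub_le_sup Sb); rewrite -/c leNgt => /negP; case.
by rewrite ltrDl divr_gt0.
Qed.

Lemma within_continuousP (R : realType) (M : metricType R) (a b : R) (g : R -> M) :
  {within `[a, b], continuous g} <-> forall x, a <= x <= b -> forall e, 0 < e ->
    exists2 d, 0 < d & forall y, a <= y <= b -> `|x - y| < d ->
      mdist (g x) (g y) < e.
Proof.
split=> [/subspace_continuousP cg x xab e e0|cg].
  have := cg x; rewrite /= in_itv /= => /(_ xab).
  move=> /metricType_numDomainType.cvgrPdist_lt/(_ e e0).
  rewrite near_withinE => /nbhs_ballP[d /= d0 dP]; exists d => // y yab xy.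
  by apply: dP => //=; rewrite in_itv.
apply/subspace_continuousP => x; rewrite /= in_itv /= => xab.
apply/metricType_numDomainType.cvgrPdist_lt => e e0.
have [d d0 dP] := cg x xab e e0.
rewrite near_withinE; apply/nbhs_ballP; exists d => //= y xy.
by rewrite in_itv /= => yab; exact: dP.
Qed.

Section length.
Context {R : realType} {M : metricType R}.
Implicit Types (a b c e : R) (g : R -> M).

Lemma mvariation_nil a b g : mvariation a b g [::] = 0.
Proof. by rewrite /mvariation /= big_geq. Qed.

Lemma mvariation_cons a b g x s :
  mvariation a b g (x :: s) = mdist (g a) (g x) + mvariation x b g s.
Proof. by rewrite /mvariation /= big_nat_recl. Qed.

Lemma mvariation_cat a b c g s t : itv_partition a c s ->
  mvariation a b g (s ++ t) = mvariation a c g s + mvariation c b g t.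
Proof.
elim: s a => [a /itv_partition_nil ->|x s IH a /itv_partition_cons /IH E].
  by rewrite mvariation_nil add0r.
by rewrite /= !mvariation_cons E addrA.
Qed.

(** By the triangle inequality, inserting [c] into the subdivision interval that contains it can
    only increase the variation. *)
Lemma mvariation_split a b c g s : a <= c -> itv_partition a b s -> c <= b ->
  exists s1 s2, [/\ itv_partition a c s1, itv_partition c b s2 &
    mvariation a b g s <= mvariation a c g s1 + mvariation c b g s2].
Proof.
elim: s a => [a ac /itv_partition_nil <- ca|x s IH a].
  have -> : c = a by apply/le_anti; rewrite ca.
  by exists [::], [::]; rewrite !mvariation_nil addr0; split => //; split=> /=.
rewrite le_eqVlt => /predU1P[->|ac] axs cb.
  by exists [::], (x :: s); rewrite mvariation_nil add0r; split => //; split=> /=.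
have xs := itv_partition_cons axs.
have [cx|xc|cx] := ltgtP c x; last 1 first.
- subst x; exists [:: c], s; rewrite !mvariation_cons mvariation_nil addr0.
  by split => //; exact: itv_partition1.
- exists [:: c], (x :: s); rewrite !mvariation_cons mvariation_nil addr0.
  split; first exact: itv_partition1.
    by case: axs => /= /andP[_ xsp] lb; split=> //=; rewrite cx.
  by rewrite addrA lerD2r metric_triangle.
have [s1 [s2 [p1 p2 le12]]] := IH x (ltW xc) xs cb.
exists (x :: s1), s2; split => //.
  by case: axs => /= /andP[ax _] _; case: p1 => *; split=> //=; rewrite ax.
by rewrite !mvariation_cons -addrA lerD2l.
Qed.

Lemma mvariation_le_length a b g s : itv_partition a b s ->
  ((mvariation a b g s)%:E <= curve_length a b g)%E.
Proof. by move=> abs; apply: ereal_sup_ubound; exists s. Qed.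

Lemma dist_le_length a b g : a <= b ->
  ((mdist (g a) (g b))%:E <= curve_length a b g)%E.
Proof.
rewrite le_eqVlt => /predU1P[->|ab].
  have := @mvariation_le_length b b g [::]; rewrite mvariation_nil mdistxx.
  by apply; split=> /=.
have := @mvariation_le_length a b g [:: b].
by rewrite mvariation_cons mvariation_nil addr0; apply; exact: itv_partition1.
Qed.

Lemma curve_length_ge0 a b g : a <= b -> (0 <= curve_length a b g)%E.
Proof.
by move=> ab; apply: le_trans (dist_le_length g ab); rewrite lee_fin mdist_ge0.
Qed.

Lemma curve_length_le a b g (F : R -> R) : a <= b ->
  (forall s t, a <= s -> s <= t -> t <= b -> mdist (g s) (g t) <= F t - F s) ->
  (curve_length a b g <= (F b - F a)%:E)%E.
Proof.
move=> ab gF; apply: ge_ereal_sup => _ [s abs <-]; rewrite lee_fin.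
elim: s a ab gF abs => [a _ _ /itv_partition_nil ->|x s IH a ab gF axs].
  by rewrite mvariation_nil subrr.
have xs := itv_partition_cons axs; have xb := itv_partition_le xs.
have ax : a <= x by case: axs => /= /andP[/ltW].
rewrite mvariation_cons.
have -> : F b - F a = (F x - F a) + (F b - F x) by ring.
rewrite lerD ?gF//.
by apply: IH => // u v xu; apply: gF; exact: le_trans xu.
Qed.

Lemma curve_lengthxx a g : curve_length a a g = 0%E.
Proof.
apply/le_anti; rewrite curve_length_ge0// andbT.
have := @curve_length_le a a g (fun=> 0) (lexx _); rewrite /= subrr; apply.
move=> s t as_ st ta.
have -> : s = t by apply/le_anti; rewrite st (le_trans ta as_).
by rewrite mdistxx.
Qed.

Lemma curve_lengthD c a b g : a <= c -> c <= b ->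
  (curve_length a b g = curve_length a c g + curve_length c b g)%E.
Proof.
move=> ac cb; apply/le_anti/andP; split.
  apply: ge_ereal_sup => _ [s abs <-].
  have [s1 [s2 [p1 p2 le12]]] := mvariation_split g ac abs cb.
  apply: (@le_trans _ _ (mvariation a c g s1 + mvariation c b g s2)%:E).
    by rewrite lee_fin.
  by rewrite EFinD leeD// mvariation_le_length.
have := curve_length_ge0 g (le_trans ac cb).
have := @mvariation_le_length a b g.
case: (curve_length a b g) => [L| |] // ub _; last by rewrite leey.
have ub2 s1 s2 : itv_partition a c s1 -> itv_partition c b s2 ->
    mvariation a c g s1 + mvariation c b g s2 <= L.
  move=> p1 p2; have := ub _ (itv_partition_cat p1 p2).
  by rewrite (mvariation_cat _ _ _ p1) lee_fin.
have ex1 : exists s1, itv_partition a c s1.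
  move: ac; rewrite le_eqVlt => /predU1P[->|ac]; first by exists [::]; split=> /=.
  by exists [:: c]; exact: itv_partition1.
have [s1 p1] := ex1.
(* The joint bound [ub2] is turned into a sum of suprema one variable at a time: first over [s1]
   with [s2] fixed, then over [s2]. *)
have ub1 s2 : itv_partition c b s2 ->
    (curve_length a c g <= (L - mvariation c b g s2)%:E)%E.
  move=> p2; apply: ge_ereal_sup => _ [s1' p1' <-].
  by rewrite lee_fin lerBrDr ub2.
have ex2 : exists s2, itv_partition c b s2.
  move: cb; rewrite le_eqVlt => /predU1P[->|cb]; first by exists [::]; split=> /=.
  by exists [:: b]; exact: itv_partition1.
have [s2 p2] := ex2.
have fc : curve_length a c g \is a fin_num.
  rewrite ge0_fin_numE ?curve_length_ge0//.
  by apply: le_lt_trans (ub1 s2 p2) _; rewrite ltry.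
rewrite -(fineK fc) addeC.
apply: (@le_trans _ _ ((L - fine (curve_length a c g))%:E +
  (fine (curve_length a c g))%:E)%E); last by rewrite -EFinD subrK.
rewrite leeD2r//; apply: ge_ereal_sup => _ [s2' p2' <-].
have := ub1 s2' p2'; rewrite -{1}(fineK fc) !lee_fin; lra.
Qed.

Lemma curve_length_mono a b c d g : a <= b -> b <= c -> c <= d ->
  (curve_length b c g <= curve_length a d g)%E.
Proof.
move=> ab bc cd.
rewrite (@curve_lengthD b a d)//; last exact: le_trans cd.
rewrite (@curve_lengthD c b d)//.
apply: (@le_trans _ _ (curve_length b c g + curve_length c d g)%E).
  by rewrite leeDl// curve_length_ge0.
by rewrite leeDr// curve_length_ge0.
Qed.

(** In a subdivision whose variation is within [e] of the length, the defect of each single piece is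
    at most [e]. The point [p] starts the last piece, so the curve is almost geodesic just before
    [b]. *)
Lemma length_near_left a b g e : a < b -> 0 < e -> (curve_length a b g < +oo)%E ->
  exists2 p, a <= p < b & (curve_length p b g <= (mdist (g p) (g b) + e)%:E)%E.
Proof.
move=> ab e0 fab.
have fn : curve_length a b g \is a fin_num.
  by rewrite ge0_fin_numE// curve_length_ge0// ltW.
have [_ [s abs <-] ls] := ub_ereal_sup_adherent e0 fn.
rewrite -[ereal_sup _]/(curve_length a b g) in ls.
elim: s a ab abs fab fn ls => [a ab|x s IH a ab axs fab fn ls].
  by move=> /itv_partition_nil abE; rewrite abE ltxx in ab.
have xs := itv_partition_cons axs; have xb := itv_partition_le xs.
have ax : a < x by case: axs => /= /andP[].
move: xb; rewrite le_eqVlt => /predU1P[xb|xb].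
  subst x; have ? := itv_partitionxx xs; subst s.
  exists a; first by rewrite lexx ax.
  move: ls; rewrite mvariation_cons mvariation_nil addr0 -(fineK fn).
  by rewrite -EFinB lte_fin lee_fin; lra.
have fx : (curve_length x b g < +oo)%E.
  by apply: le_lt_trans fab; apply: curve_length_mono => //; exact: ltW.
have fnx : curve_length x b g \is a fin_num.
  by rewrite ge0_fin_numE// curve_length_ge0// ltW.
have [|p /andP[xp pb] pP] := IH x xb xs fx fnx.
- move: ls; rewrite mvariation_cons (curve_lengthD g (ltW ax) (ltW xb)).
  have fax : curve_length a x g \is a fin_num.
    rewrite ge0_fin_numE ?curve_length_ge0// ?ltW//.
    by apply: le_lt_trans fab; apply: curve_length_mono => //; exact: ltW.
  have := dist_le_length g (ltW ax).
  rewrite -(fineK fax) -(fineK fnx) -EFinD -!EFinB !lte_fin lee_fin; lra.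
by exists p => //; rewrite pb (le_trans (ltW ax)).
Qed.

Lemma length_near_right a b g e : a < b -> 0 < e -> (curve_length a b g < +oo)%E ->
  exists2 q, a < q <= b & (curve_length a q g <= (mdist (g a) (g q) + e)%:E)%E.
Proof.
move=> ab e0 fab.
have fn : curve_length a b g \is a fin_num.
  by rewrite ge0_fin_numE// curve_length_ge0// ltW.
have [_ [[|x s] abs <-] ls] := ub_ereal_sup_adherent e0 fn.
  by move: abs => /itv_partition_nil abE; rewrite abE ltxx in ab.
rewrite -[ereal_sup _]/(curve_length a b g) in ls.
have xs := itv_partition_cons abs; have xb := itv_partition_le xs.
have ax : a < x by case: abs => /= /andP[].
exists x; first by rewrite ax.
have fx : curve_length x b g \is a fin_num.
  rewrite ge0_fin_numE ?curve_length_ge0//.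
  by apply: le_lt_trans fab; apply: curve_length_mono => //; exact: ltW.
have fax : curve_length a x g \is a fin_num.
  rewrite ge0_fin_numE ?curve_length_ge0// ?ltW//.
  by apply: le_lt_trans fab; apply: curve_length_mono => //; exact: ltW.
have := mvariation_le_length g xs.
move: ls; rewrite mvariation_cons (curve_lengthD g (ltW ax) xb).
rewrite -(fineK fax) -(fineK fx) -EFinD -?EFinB lte_fin !lee_fin; lra.
Qed.

(** The length function has no jumps. On a piece [[p, x]] with length at most
    [mdist (g p) (g x) + e / 4], subtracting the length of [[p, s]] leaves at most
    [mdist (g s) (g x) + e / 4], and continuity of [g] makes this small; the right side is
    symmetric. *)
Lemma length_near a b g : rectifiable a b g -> forall x, a <= x <= b ->
  forall e, 0 < e -> exists2 d, 0 < d & forall s t, a <= s -> s <= x -> x <= t ->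
    t <= b -> x - d < s -> t < x + d -> (curve_length s t g <= e%:E)%E.
Proof.
move=> [[ab cg] fab] x /andP[ax xb] e e0.
have e4 : 0 < e / 4 by rewrite divr_gt0.
have [d1 d10 d1P] : exists2 d, 0 < d & forall s, a <= s -> s <= x ->
    x - d < s -> (curve_length s x g <= (e / 2)%:E)%E.
  move: ax; rewrite le_eqVlt => /predU1P[<-|ax].
    exists 1 => // s as_ sa _; have -> : s = a by apply/le_anti; rewrite sa.
    by rewrite curve_lengthxx lee_fin; lra.
  have [p /andP[ap px] pP] := length_near_left ax e4
    (le_lt_trans (curve_length_mono g (lexx a) (ltW ax) xb) fab).
  have [|d d0 dP] := (within_continuousP _ _ _).1 cg x _ _ e4.
    by rewrite (ltW ax).
  exists (Num.min d (x - p)); first by rewrite lt_min d0 subr_gt0.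
  move=> s as_ sx; rewrite ltrBlDr -ltrBlDl lt_min => /andP[sd sp].
  have ps : p <= s by lra.
  have := dP s; rewrite as_ (le_trans sx xb) => /(_ isT).
  rewrite ger0_norm ?subr_ge0// => /(_ sd) gs.
  have fp : (curve_length p x g < +oo)%E by apply: le_lt_trans pP _; rewrite ltry.
  move: pP (fp); rewrite (curve_lengthD g ps sx) => pP.
  have := dist_le_length g ps; have := metric_triangle (g p) (g s) (g x).
  have := curve_length_ge0 g ps; have := curve_length_ge0 g sx.
  move: pP; rewrite (metric_sym (g s)).
  case: (curve_length p s g) => [u| |]; case: (curve_length s x g) => [v| |] //=.
  rewrite -EFinD !lee_fin; lra.
have [d2 d20 d2P] : exists2 d, 0 < d & forall t, x <= t -> t <= b ->
    t < x + d -> (curve_length x t g <= (e / 2)%:E)%E.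
  move: xb; rewrite le_eqVlt => /predU1P[->|xb].
    exists 1 => // s as_ sa _; have -> : s = b by apply/le_anti; rewrite sa.
    by rewrite curve_lengthxx lee_fin; lra.
  have [q /andP[xq qb] qP] := length_near_right xb e4
    (le_lt_trans (curve_length_mono g ax (ltW xb) (lexx b)) fab).
  have [|d d0 dP] := (within_continuousP _ _ _).1 cg x _ _ e4.
    by rewrite (ltW xb) ax.
  exists (Num.min d (q - x)); first by rewrite lt_min d0 subr_gt0.
  move=> t xt tb; rewrite -ltrBlDl lt_min => /andP[td tq'].
  have tq : t <= q by lra.
  have := dP t; rewrite tb (le_trans ax xt) => /(_ isT).
  rewrite ler0_norm ?subr_le0// opprB => /(_ td) gt.
  move: qP; rewrite (curve_lengthD g xt tq) => qP.
  have := dist_le_length g tq; have := metric_triangle (g x) (g t) (g q).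
  have := curve_length_ge0 g xt; have := curve_length_ge0 g tq.
  move: qP.
  case: (curve_length x t g) => [u| |]; case: (curve_length t q g) => [v| |] //=.
  rewrite -EFinD !lee_fin; lra.
exists (Num.min d1 d2); first by rewrite lt_min d10.
move=> s t as_ sx xt tb.
rewrite ltrBlDr -ltrBlDl lt_min => /andP[s1 _].
rewrite -ltrBlDl lt_min => /andP[_ t2].
rewrite (curve_lengthD g sx xt) (splitr e) EFinD leeD//.
  by apply: d1P => //; lra.
by apply: d2P => //; lra.
Qed.

End length.

(** * Arc-length parametrization *)

Section arc.
Context {R : realType} {M : metricType R}.
Variables (a b : R) (g : R -> M).
Hypothesis rg : rectifiable a b g.

Local Notation len t := (curve_length a t g).
Local Notation L := (fine (curve_length a b g)).

Let ab : a <= b. Proof. by case: rg => -[]. Qed.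

Lemma curve_length_fin s t : a <= s -> s <= t -> t <= b ->
  curve_length s t g \is a fin_num.
Proof.
move=> as_ st tb; rewrite ge0_fin_numE ?curve_length_ge0//.
by case: rg => _; apply: le_lt_trans; exact: curve_length_mono.
Qed.

Lemma fine_lengthB s t : a <= s -> s <= t -> t <= b ->
  fine (len t) - fine (len s) = fine (curve_length s t g).
Proof.
move=> as_ st tb; rewrite (curve_lengthD g as_ st) fineD.
- by rewrite addrAC subrr add0r.
- by rewrite curve_length_fin// (le_trans st).
- by rewrite curve_length_fin.
Qed.

Lemma dist_le_fine_length s t : a <= s -> s <= t -> t <= b ->
  mdist (g s) (g t) <= fine (len t) - fine (len s).
Proof.
move=> as_ st tb; rewrite fine_lengthB// -lee_fin fineK ?curve_length_fin//.
exact: dist_le_length.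
Qed.

Lemma fine_length_mono s t : a <= s -> s <= t -> t <= b ->
  fine (len s) <= fine (len t).
Proof.
move=> as_ st tb; rewrite -subr_ge0.
by apply: le_trans (dist_le_fine_length as_ st tb); exact: mdist_ge0.
Qed.

(** Intermediate value theorem for the length function, whose continuity is [length_near]; it
    ensures that the choice in [arc_param] never falls on an empty set. *)
Lemma fine_length_surj u : 0 <= u <= L ->
  exists t, a <= t <= b /\ curve_length a t g = u%:E.
Proof.
move=> /andP[u0 uL].
have cl : {within `[a, b], continuous (fun t => fine (len t) : R^o)}.
  apply/within_continuousP => x xab e e0.
  have e2 : 0 < e / 2 by rewrite divr_gt0.
  have [d d0 dP] := length_near rg xab e2.
  exists d => // y /andP[ay yb]; rewrite ltr_norml => /andP[xy1 xy2].
  rewrite /mdist/=; apply: (@le_lt_trans _ _ (e / 2)); last by lra.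
  case/andP: xab => ax xb.
  have [xy|yx] := leP x y.
    rewrite ger0_norm ?subr_ge0 ?fine_length_mono// fine_lengthB//.
    by rewrite -lee_fin fineK ?curve_length_fin//; apply: dP => //; lra.
  rewrite distrC ger0_norm ?subr_ge0 ?fine_length_mono//; last exact: ltW.
  rewrite fine_lengthB//; last exact: ltW.
  rewrite -lee_fin fineK ?curve_length_fin//; last exact: ltW.
  by apply: dP => //; lra.
have l0 : fine (len a) = 0 by rewrite curve_lengthxx.
have := @IVT R (fun t => fine (len t)) a b u ab cl.
rewrite l0 /Order.min /Order.max.
have -> : (if 0 < L then 0 else L) <= u <= (if 0 < L then L else 0).
  by case: ltP => /= h; rewrite ?u0 ?uL//; lra.
move=> /(_ isT)[t]; rewrite in_itv/= => tab <-; exists t; split=> //.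
by case/andP: tab => *; rewrite fineK// curve_length_fin.
Qed.

Lemma arc_paramP u : 0 <= u <= L -> exists t, [/\ a <= t <= b,
  curve_length a t g = u%:E & arc_param a b g u = g t].
Proof. by move=> /fine_length_surj/(@getPex R)[*]; eexists; split=> //. Qed.

Lemma arc_param_length t : a <= t <= b -> arc_param a b g (fine (len t)) = g t.
Proof.
move=> /andP[at_ tb].
have [|t' [/andP[at' t'b] lt' ->]] := @arc_paramP (fine (len t)).
  by rewrite fine_length_mono// fine_ge0// curve_length_ge0.
have E : fine (len t') = fine (len t) by rewrite lt'.
apply: mdist_positivity; apply/le_anti; rewrite mdist_ge0 andbT.
have [tt'|/ltW tt'] := leP t t'.
  rewrite metric_sym; apply: le_trans (dist_le_fine_length _ tt' _) _ => //.
  by rewrite E subrr.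
by apply: le_trans (dist_le_fine_length _ tt' _) _ => //; rewrite E subrr.
Qed.

Lemma arc_param_lip u v : 0 <= u <= L -> 0 <= v <= L ->
  mdist (arc_param a b g u) (arc_param a b g v) <= `|u - v|.
Proof.
move=> /arc_paramP[t [/andP[at_ tb] tu ->]] /arc_paramP[s [/andP[as_ sb] sv ->]].
have [ts|/ltW st] := leP t s.
  apply: le_trans (dist_le_fine_length _ ts _) _ => //.
  by rewrite tu sv /= -normrN opprB ler_norm.
rewrite metric_sym; apply: le_trans (dist_le_fine_length _ st _) _ => //.
by rewrite tu sv /= ler_norm.
Qed.

End arc.

(** * The integral of a continuous function over an initial segment *)

Section running_integral.
Context {R : realType}.
Variable f : R -> R.
Hypothesis cf : continuous f.

Definition running_integral t := \int[lebesgue_measure]_(u in `[0, t]) f u.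
Local Notation J := running_integral.

Lemma running_integral0 : J 0 = 0.
Proof. by rewrite /J set_itv1 Rintegral_set1. Qed.

Lemma integrable_segment s t :
  lebesgue_measure.-integrable `[s, t] (EFin \o f).
Proof.
apply: continuous_compact_integrable; first exact: segment_compact.
exact: continuous_subspaceT.
Qed.

Lemma running_integral_bounds m K s t : 0 <= s -> s <= t ->
  (forall u, s <= u <= t -> m <= f u <= K) ->
  m * (t - s) <= J t - J s <= K * (t - s).
Proof.
move=> s0 st mfK; rewrite /J (Rintegral_itvB (integrable_segment 0 t)) ?bnd_simp//.
have ist : lebesgue_measure.-integrable `]s, t] (EFin \o f).
  apply: integrableS (integrable_segment s t) => //.
  by apply: subset_itvr; rewrite bnd_simp.
have E k : \int[lebesgue_measure]_(u in `]s, t]) cst k u = k * (t - s).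
  rewrite Rintegral_cst//= lebesgue_measure_itv /= lte_fin.
  by case: ltP => //= ts; rewrite (_ : t - s = 0) //; lra.
have ik k : lebesgue_measure.-integrable `]s, t] (EFin \o cst k).
  apply: integrableS (_ : lebesgue_measure.-integrable `[s, t] _) => //.
    by apply: subset_itvr; rewrite bnd_simp.
  apply: continuous_compact_integrable; first exact: segment_compact.
  by apply: continuous_subspaceT => x; exact: cvg_cst.
rewrite -!E; apply/andP; split; apply: le_Rintegral => // u;
  rewrite /= in_itv/= => /andP[su ut];
  by have := mfK u; rewrite ut (ltW su) => /(_ isT)/andP[].
Qed.

(** The fundamental theorem of calculus in the form that [cousin] consumes: a two-sided bound on all
    short intervals near [x]. *)
Lemma running_integral_near x e : 0 < e ->
  exists2 d, 0 < d & forall s t, 0 <= s -> s <= t -> x - d < s -> t < x + d ->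
    (f x - e) * (t - s) <= J t - J s <= (f x + e) * (t - s).
Proof.
move=> e0; have /cvgrPdist_lt/(_ e e0) := @cf x.
move=> /nbhs_ballP[d /= d0 dP]; exists d => // s t s0 st xs tx.
apply: running_integral_bounds => // u /andP[su ut].
have : `|f x - f u| < e by apply: dP; rewrite /ball /= ltr_norml; lra.
by rewrite ltr_norml; lra.
Qed.

Lemma running_integral_lip T : 0 <= T ->
  exists K, forall s t, 0 <= s -> s <= t -> t <= T -> J t - J s <= K * (t - s).
Proof.
move=> T0.
have [c _ cP] := EVT_max T0 (continuous_subspaceT cf).
have [c' _ cP'] := EVT_min T0 (continuous_subspaceT cf).
exists (f c) => s t s0 st tT.
have := @running_integral_bounds (f c') (f c) s t s0 st => /(_ _)/andP[|//].
by move=> u /andP[su ut]; rewrite cP ?cP' ?in_itv//=; lra.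
Qed.

End running_integral.

(** * Distances with a length element *)

Section path_metric.
Context {R : realType} {M : metricType R}.
Implicit Types (a b e d s t u v T K : R).
Variable rho : M -> R.
Hypothesis crho : forall z e, 0 < e -> exists2 d, 0 < d &
  forall w, mdist z w < d -> `|rho z - rho w| < e.
Hypothesis rho_gt0 : forall z, 0 < rho z.

Lemma rectifiable_arc a b g : rectifiable a b g ->
  exists (L : R) (sg : R -> M), [/\ 0 <= L,
    forall u v, mdist (sg u) (sg v) <= `|u - v|, sg 0 = g a, sg L = g b &
    [/\ continuous (rho \o sg), L = fine (curve_length a b g),
      forall t, a <= t <= b -> sg (fine (curve_length a t g)) = g t &
      path_integral rho a b g = (running_integral (rho \o sg) L)%:E]].
Proof.
move=> rg; have ab : a <= b by case: rg => -[].
pose L := fine (curve_length a b g).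
have L0 : 0 <= L by rewrite fine_ge0// curve_length_ge0.
(* Clamping to [[0, L]] extends the arc-length parametrization to a 1-Lipschitz map on the whole
   line, so that [rho \o sg] is continuous everywhere, as the lemmas on [running_integral]
   demand. *)
pose cl u := Num.max 0 (Num.min u L).
have cl01 u : 0 <= cl u <= L by rewrite /cl le_max lexx/= ge_max L0 ge_min lexx orbT.
have clE u : 0 <= u <= L -> cl u = u.
  by move=> /andP[u0 uL]; rewrite /cl min_l// max_r.
have cllip u v : `|cl u - cl v| <= `|u - v|.
  by apply: norm_maxB_le; [|apply: norm_minB_le]; rewrite ?subrr ?normr0.
pose sg u := arc_param a b g (cl u).
have slip u v : mdist (sg u) (sg v) <= `|u - v|.
  by apply: le_trans (cllip u v); apply: (arc_param_lip rg).
have st t : a <= t <= b -> sg (fine (curve_length a t g)) = g t.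
  move=> tab; rewrite /sg clE ?(arc_param_length rg)//.
  case/andP: tab => at_ tb.
  by rewrite fine_ge0 ?curve_length_ge0//= (fine_length_mono rg).
have crs : continuous (rho \o sg).
  move=> x; apply/cvgrPdist_lt => e e0.
  have [d d0 dP] := crho (sg x) e0.
  apply/nbhs_ballP; exists d => // y /= xy; apply: dP.
  exact: le_lt_trans (slip _ _) xy.
exists L, sg; split => //.
- by rewrite -(st a) ?curve_lengthxx ?lexx.
- by rewrite -(st b) ?lexx ?ab.
split => //.
rewrite /path_integral -/L /running_integral.
rewrite /Rintegral fineK; last first.
  exact: integrable_fin_num (integrable_segment crs 0 L).
by apply: eq_integral => u; rewrite inE /= in_itv/= => u0L; rewrite /sg clE.
Qed.

Lemma path_integral_ge0 a b g : (0 <= path_integral rho a b g)%E.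
Proof. by apply: integral_ge0 => u _; rewrite lee_fin ltW. Qed.

Lemma path_dist_ge0 x y : 0 <= path_dist rho x y.
Proof.
apply/fine_ge0/le_ereal_inf_tmp => _ [a [b [g [_ _ _ ->]]]].
exact: path_integral_ge0.
Qed.

Lemma path_dist_le a b g : rectifiable a b g ->
  path_dist rho (g a) (g b) <= fine (path_integral rho a b g).
Proof.
move=> rg; have [L [sg [_ _ _ _ [_ _ _ E]]]] := rectifiable_arc rg.
rewrite /path_dist; set S := [set l | _].
have SE : S (path_integral rho a b g) by exists a, b, g.
have h : (ereal_inf S <= path_integral rho a b g)%E by exact: ereal_inf_lbound.
have h0 : (0 <= ereal_inf S)%E.
  by apply: le_ereal_inf_tmp => _ [? [? [? [_ _ _ ->]]]]; exact: path_integral_ge0.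
have fS : ereal_inf S \is a fin_num.
  by rewrite ge0_fin_numE// (le_lt_trans h)// E ltry.
by rewrite -lee_fin fineK// fineK// E.
Qed.

Hypothesis rconn : forall x y : M, exists a b g,
  [/\ rectifiable a b g, g a = x & g b = y].

(** By [rconn] the infimum runs over a set with a finite element; otherwise [fine] would return the
    default 0 and no curve could approximate it. *)
Lemma path_dist_approx x y e : 0 < e -> exists a b g,
  [/\ rectifiable a b g, g a = x, g b = y &
      fine (path_integral rho a b g) < path_dist rho x y + e].
Proof.
move=> e0; rewrite /path_dist; set S := [set l | _].
have h0 : (0 <= ereal_inf S)%E.
  by apply: le_ereal_inf_tmp => _ [? [? [? [_ _ _ ->]]]]; exact: path_integral_ge0.
have [a0 [b0 [g0 [r0 x0 y0]]]] := rconn x y.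
have [L [sg [_ _ _ _ [_ _ _ E]]]] := rectifiable_arc r0.
have fS : ereal_inf S \is a fin_num.
  rewrite ge0_fin_numE//; apply: (@le_lt_trans _ _ (path_integral rho a0 b0 g0)).
    by apply: ereal_inf_lbound; exists a0, b0, g0.
  by rewrite E ltry.
have [_ [a [b [g [rg ga gb ->]]]] lt] := lb_ereal_inf_adherent e0 fS.
exists a, b, g; split => //.
have [L' [sg' [_ _ _ _ [_ _ _ E']]]] := rectifiable_arc rg.
rewrite -/S in lt *; move: lt.
by rewrite E' -{1}(fineK fS) -EFinD lte_fin.
Qed.

Lemma le_path_dist x y (c : R) :
  (forall a b g, rectifiable a b g -> g a = x -> g b = y ->
    c <= fine (path_integral rho a b g)) -> c <= path_dist rho x y.
Proof.
move=> H; apply/ler_addgt0Pr => e e0.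
have [a [b [g [rg ga gb lt]]]] := path_dist_approx x y e0.
exact: le_trans (H _ _ _ rg ga gb) (ltW lt).
Qed.

(* [Phi] dominates the [rho]-length of [g]; its linear growth bound makes [g]
   locally Lipschitz, hence rectifiable. *)
Definition cost_path (T : R) (g : R -> M) (Phi : R -> R) : Prop :=
  [/\ 0 <= T,
      exists K, forall s t, 0 <= s -> s <= t -> t <= T ->
        Phi t - Phi s <= K * (t - s) &
      forall x, 0 <= x <= T -> forall e, 0 < e -> exists2 d, 0 < d &
        forall s t, 0 <= s -> s <= t -> t <= T -> x - d < s -> t < x + d ->
          rho (g x) * mdist (g s) (g t) <= Phi t - Phi s + e * (t - s)].

Lemma cost_path_lip T g Phi : cost_path T g Phi -> forall x, 0 <= x <= T ->
  exists K d, [/\ 0 <= K, 0 < d & forall s t, 0 <= s -> s <= t -> t <= T ->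
    x - d < s -> t < x + d -> mdist (g s) (g t) <= K * (t - s)].
Proof.
move=> [T0 [K KP] loc] x xT.
have [d d0 dP] := loc x xT _ ltr01.
exists ((`|K| + 1) / rho (g x)), d; split => //.
  by rewrite divr_ge0// ?addr_ge0// ltW.
move=> s t s0 st tT xs tx.
rewrite mulrAC ler_pdivlMr// mulrC; apply: le_trans (dP _ _ s0 st tT xs tx) _.
rewrite mulrDl lerD2r; apply: le_trans (KP _ _ s0 st tT) _.
by rewrite ler_wpM2r ?subr_ge0// ler_norm.
Qed.

Lemma cost_path_rectifiable T g Phi : cost_path T g Phi -> rectifiable 0 T g.
Proof.
move=> cp; have T0 : 0 <= T by case: cp.
have lip := cost_path_lip cp.
split.
  split => //; apply/within_continuousP => x xT e e0.
  have [K [d [K0 d0 dP]]] := lip x xT.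
  have [x0 xT'] := andP xT.
  exists (Num.min d (e / (K + 1))).
    by rewrite lt_min d0 divr_gt0// ltr_wpDl.
  move=> y /andP[y0 yT]; rewrite lt_min => /andP[xy].
  rewrite ltr_pdivlMr ?ltr_wpDl// => ye.
  have h : K * `|x - y| <= `|x - y| * (K + 1).
    by rewrite mulrDr mulr1 mulrC lerDl.
  apply: le_lt_trans ye; apply: le_trans h.
  move: xy; rewrite ltr_norml => /andP[xy1 xy2].
  have [yx|/ltW yx] := leP x y.
    by rewrite distrC ger0_norm ?subr_ge0//; apply: dP => //; lra.
  by rewrite ger0_norm ?subr_ge0// metric_sym; apply: dP => //; lra.
apply: (@cousin R 0 T (fun s t => (curve_length s t g < +oo)%E)) => //.
  by move=> s t u s0 st tu uT; rewrite (curve_lengthD g st tu); exact: lte_add_pinfty.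
move=> x xT; have [K [d [K0 d0 dP]]] := lip x xT.
exists d => // s t s0 sx xt tT xs tx.
apply: le_lt_trans (@curve_length_le _ _ s t g (fun u => K * u) _ _) _.
- exact: le_trans xt.
- move=> u v su uv vt; rewrite -mulrBr; apply: dP => //.
  + exact: le_trans su.
  + exact: le_trans tT.
  + exact: lt_le_trans su.
  + exact: le_lt_trans tx.
- by rewrite ltry.
Qed.

(** Near [x] the integral grows by at most [(1 + e) * rho (g x)] times the length, and [rho (g x)]
    times the length grows by at most the increment of [Phi] plus [e * (t - s)]. Both bounds are
    additive, so [cousin] makes them global, and then [e] tends to 0. *)
Lemma path_integral_cost T g Phi : cost_path T g Phi ->
  fine (path_integral rho 0 T g) <= Phi T - Phi 0.
Proof.
move=> cp; have rg := cost_path_rectifiable cp.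
have [T0 [K KP] loc] := cp.
have [L [sg [L0 slip s0 sL [cf LE st ->]]]] := rectifiable_arc rg.
rewrite [fine _]/=.
set J := running_integral _.
pose l t := fine (curve_length 0 t g).
have lB s t : 0 <= s -> s <= t -> t <= T -> l t - l s = fine (curve_length s t g).
  by move=> *; rewrite /l (fine_lengthB rg).
have main e : 0 < e -> J L <= (1 + e) * (Phi T - Phi 0 + e * T).
  move=> e0.
  have -> : J L = J (l T) - J (l 0).
    by rewrite /l -LE curve_lengthxx /= /J running_integral0 subr0.
  pose P s t := J (l t) - J (l s) <= (1 + e) * (Phi t - Phi s + e * (t - s)).
  have : P 0 T; last by rewrite /P subr0.
  apply: (@cousin R 0 T P) => //.
    move=> s t u ? ? ? ? h1 h2; have := lerD h1 h2; rewrite -mulrDr /P.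
    rewrite (_ : J (l t) - J (l s) + _ = J (l u) - J (l s)); last by ring.
    by rewrite (_ : Phi t - Phi s + _ + _ = Phi u - Phi s + e * (u - s)); last by ring.
  move=> x xT; have [x0 xT'] := andP xT.
  (* The error is taken relative to the density, so that it becomes the factor [1 + e], the same at
     every [x]. *)
  have er : 0 < e * rho (g x) by rewrite mulr_gt0.
  have [d1 d10 d1P] := running_integral_near cf (l x) er.
  have d12 : 0 < d1 / 2 by rewrite divr_gt0.
  have [d2 d20 d2P] := length_near rg xT d12.
  have [d3 d30 d3P] := loc x xT e e0.
  exists (Num.min d2 d3); first by rewrite lt_min d20.
  move=> s t s0' sx xt tT xs tx.
  have xs2 : x - d2 < s.
    by apply: le_lt_trans xs; rewrite lerD2l lerN2 ge_min lexx.
  have xs3 : x - d3 < s.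
    by apply: le_lt_trans xs; rewrite lerD2l lerN2 ge_min lexx orbT.
  have tx2 : t < x + d2.
    by apply: lt_le_trans tx _; rewrite lerD2l ge_min lexx.
  have tx3 : t < x + d3.
    by apply: lt_le_trans tx _; rewrite lerD2l ge_min lexx orbT.
  have st' := le_trans sx xt.
  have lst : l t - l s <= d1 / 2.
    by rewrite lB// -lee_fin fineK ?(curve_length_fin rg)//; apply: d2P.
  have lsx : l s <= l x by rewrite /l (fine_length_mono rg).
  have lxt : l x <= l t by rewrite /l (fine_length_mono rg).
  have ls0 : 0 <= l s by rewrite /l fine_ge0// curve_length_ge0.
  have /andP[_] := d1P (l s) (l t) ls0 (le_trans lsx lxt) ltac:(lra) ltac:(lra).
  rewrite -/J /= /l st// -/(l s) -/(l t) -/(l x) => h1.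
  have h2 : rho (g x) * (l t - l s) <= Phi t - Phi s + e * (t - s).
    rewrite lB// mulrC -ler_pdivlMr// -lee_fin fineK ?(curve_length_fin rg)//.
    apply: le_trans (@curve_length_le _ _ s t g
      (fun u => (Phi u + e * u) / rho (g x)) st' _) _.
      move=> u v su uv vt; rewrite -mulrBl ler_pdivlMr// mulrC.
      apply: le_trans (d3P u v _ uv _ _ _) _.
      - exact: le_trans su.
      - exact: le_trans tT.
      - exact: lt_le_trans su.
      - exact: le_lt_trans tx3.
      - by lra.
    by rewrite lee_fin -mulrBl ler_wpM2r ?invr_ge0 ?(ltW (rho_gt0 _))//; lra.
  rewrite /P; apply: le_trans h1 _.
  have -> : (rho (g x) + e * rho (g x)) * (l t - l s) =
    (1 + e) * (rho (g x) * (l t - l s)) by ring.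
  by rewrite ler_wpM2l//; lra.
apply/ler_addgt0Pr => e' e'0.
set A := Phi T - Phi 0 in main *.
(* For [e <= 1] the excess [e * A + e * T + e ^+ 2 * T] is at most [e * (|A| + 2 * T)]. *)
pose e := Num.min 1 (e' / (`|A| + 2 * T + 1)).
have B0 : 0 < `|A| + 2 * T + 1 by have := normr_ge0 A; lra.
have e0 : 0 < e by rewrite lt_min ltr01 divr_gt0.
apply: le_trans (main e e0) _.
have e1 : e <= 1 by rewrite ge_min lexx.
have ee : e * (`|A| + 2 * T + 1) <= e' by rewrite -ler_pdivlMr// ge_min lexx orbT.
have eA : e * A <= e * `|A| by rewrite ler_wpM2l ?ler_norm// ltW.
have eT : 0 <= (1 - e) * (e * T).
  by rewrite mulr_ge0 ?subr_ge0// mulr_ge0// ltW.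
nra.
Qed.

Lemma path_dist_cost T g Phi : cost_path T g Phi ->
  path_dist rho (g 0) (g T) <= Phi T - Phi 0.
Proof.
move=> cp; apply: le_trans (path_dist_le (cost_path_rectifiable cp)) _.
exact: path_integral_cost.
Qed.

(** Converse of [path_dist_cost]: an almost optimal curve in arc-length parametrization is a cost
    path whose [Phi] is its running integral. From here on no integral has to be handled to reverse
    or join curves. *)
Lemma path_dist_cost_approx x y e : 0 < e -> exists T g Phi,
  [/\ cost_path T g Phi, g 0 = x, g T = y &
      Phi T - Phi 0 < path_dist rho x y + e].
Proof.
move=> /(path_dist_approx x y)[a [b [g [rg ga gb lt]]]].
have [L [sg [L0 slip s0 sL [cf LE st E]]]] := rectifiable_arc rg.
exists L, sg, (running_integral (rho \o sg)); split; last 3 first.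
- by rewrite s0.
- by rewrite sL.
- by move: lt; rewrite E /= running_integral0 subr0.
split => //; first exact: running_integral_lip.
move=> x' x'L e' e'0; have [d d0 dP] := running_integral_near cf x' e'0.
exists d => // s t s0' st' tL xs tx.
have /andP[+ _] := dP s t s0' st' xs tx.
rewrite /= => h; have := slip s t.
rewrite distrC ger0_norm ?subr_ge0// => h2.
have h3 : rho (sg x') * mdist (sg s) (sg t) <= rho (sg x') * (t - s).
  by rewrite ler_wpM2l// ltW.
apply: le_trans h3 _; rewrite -lerBlDr; apply: le_trans h.
by rewrite mulrBl.
Qed.

Lemma cost_path_rev T g Phi : cost_path T g Phi ->
  cost_path T (fun t => g (T - t)) (fun t => - Phi (T - t)).
Proof.
move=> [T0 [K KP] loc]; split => //.
  exists K => s t s0 st tT.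
  have := KP (T - t) (T - s) ltac:(lra) ltac:(lra) ltac:(lra).
  by rewrite opprK addrC (_ : T - s - (T - t) = t - s)//; ring.
move=> x /andP[x0 xT] e e0.
have [|d d0 dP] := loc (T - x) _ e e0; first by apply/andP; split; lra.
exists d => // s t s0 st tT xs tx.
have := dP (T - t) (T - s) ltac:(lra) ltac:(lra) ltac:(lra) ltac:(lra) ltac:(lra).
rewrite metric_sym; lra.
Qed.

(** Both cost functions are shifted to vanish at the junction [T1]. An interval straddling [T1] is
    cut there, and the two local estimates are added through the triangle inequality. *)
Lemma cost_path_cat T1 g1 Phi1 T2 g2 Phi2 : g1 T1 = g2 0 ->
  cost_path T1 g1 Phi1 -> cost_path T2 g2 Phi2 ->
  cost_path (T1 + T2) (fun t => if t <= T1 then g1 t else g2 (t - T1))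
    (fun t => if t <= T1 then Phi1 t - Phi1 T1 else Phi2 (t - T1) - Phi2 0).
Proof.
move=> g12 [T10 [K1 K1P] loc1] [T20 [K2 K2P] loc2]; split.
- exact: addr_ge0.
- exists (Num.max K1 K2) => s t s0 st tT.
  have k1 : K1 <= Num.max K1 K2 by rewrite le_max lexx.
  have k2 : K2 <= Num.max K1 K2 by rewrite le_max lexx orbT.
  set K := Num.max K1 K2 in k1 k2 *.
  have [t1|t1] := leP t T1; have [s1|s1] := leP s T1; last 1 first.
  + have := K2P (s - T1) (t - T1) ltac:(lra) ltac:(lra) ltac:(lra).
    have : K2 * (t - s) <= K * (t - s) by rewrite ler_wpM2r ?subr_ge0.
    lra.
  + have := K1P s t s0 st t1.
    have : K1 * (t - s) <= K * (t - s) by rewrite ler_wpM2r ?subr_ge0.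
    lra.
  + lra.
  + have := K1P s T1 s0 s1 (lexx _).
    have := K2P 0 (t - T1) ltac:(lra) ltac:(lra) ltac:(lra).
    have : K1 * (T1 - s) <= K * (T1 - s) by rewrite ler_wpM2r ?subr_ge0.
    have : K2 * (t - T1) <= K * (t - T1) by rewrite ler_wpM2r ?subr_ge0// ltW.
    lra.
move=> x /andP[x0 xT] e e0.
have [xT1|xT1|xT1] := ltgtP x T1.
- have [|d d0 dP] := loc1 x _ e e0; first by rewrite x0 ltW.
  exists (Num.min d (T1 - x)); first by rewrite lt_min d0 subr_gt0.
  move=> s t s0 st tT; rewrite ltrBlDr -ltrBlDl lt_min => /andP[xs _].
  rewrite -ltrBlDl lt_min => /andP[tx1 tx2].
  have tT1 : t <= T1 by lra.
  rewrite tT1 (le_trans st tT1); have := dP s t s0 st tT1; lra.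
- have [|d d0 dP] := loc2 (x - T1) _ e e0; first by apply/andP; split; lra.
  exists (Num.min d (x - T1)); first by rewrite lt_min d0 subr_gt0.
  move=> s t s0 st tT; rewrite ltrBlDr -ltrBlDl lt_min => /andP[xs1 xs2].
  rewrite -ltrBlDl lt_min => /andP[tx1 _].
  have sT1 : T1 < s by lra.
  rewrite !leNgt sT1 (lt_le_trans sT1 st) /=.
  by have := dP (s - T1) (t - T1) ltac:(lra) ltac:(lra) ltac:(lra); lra.
- subst x.
  have [|d1 d10 d1P] := loc1 T1 _ e e0; first by rewrite lexx T10.
  have [|d2 d20 d2P] := loc2 0 _ e e0; first by rewrite lexx T20.
  exists (Num.min d1 d2); first by rewrite lt_min d10.
  move=> s t s0 st tT; rewrite ltrBlDr -ltrBlDl lt_min => /andP[xs1 xs2].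
  rewrite -ltrBlDl lt_min => /andP[tx1 tx2].
  have [t1|t1] := leP t T1; have [s1|s1] := leP s T1; last 1 first.
  + have := d2P (s - T1) (t - T1) ltac:(lra) ltac:(lra) ltac:(lra) ltac:(lra) ltac:(lra).
    rewrite g12; lra.
  + have := d1P s t ltac:(lra) ltac:(lra) ltac:(lra) ltac:(lra) ltac:(lra).
    lra.
  + lra.
  + have := d2P 0 (t - T1) ltac:(lra) ltac:(lra) ltac:(lra) ltac:(lra) ltac:(lra).
    have := d1P s T1 ltac:(lra) ltac:(lra) ltac:(lra) ltac:(lra) ltac:(lra).
    have : rho (g1 T1) * mdist (g1 s) (g2 (t - T1)) <=
      rho (g1 T1) * mdist (g1 s) (g1 T1) + rho (g1 T1) * mdist (g1 T1) (g2 (t - T1)).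
      by rewrite -mulrDr ler_wpM2l ?metric_triangle// ltW.
    rewrite -g12; lra.
Qed.

Lemma path_distxx x : path_dist rho x x = 0.
Proof.
apply/le_anti; rewrite path_dist_ge0 andbT.
have := @path_dist_cost 0 (fun=> x) (fun=> 0); rewrite subrr; apply; split => //.
  by exists 0 => *; lra.
by move=> x' _ e e0; exists 1 => // s t s0 st _ _ _; rewrite mdistxx; nra.
Qed.

Lemma path_dist_sym x y : path_dist rho x y = path_dist rho y x.
Proof.
suff h x' y' : path_dist rho x' y' <= path_dist rho y' x' by apply/le_anti; rewrite !h.
apply/ler_addgt0Pr => e e0.
have [T [g [Phi [cp gx gy lt]]]] := path_dist_cost_approx y' x' e0.
have := path_dist_cost (cost_path_rev cp).
rewrite subr0 subrr gx gy; lra.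
Qed.

Lemma path_dist_triangle y x z :
  path_dist rho x z <= path_dist rho x y + path_dist rho y z.
Proof.
apply/ler_addgt0Pr => e e0; have e2 : 0 < e / 2 by rewrite divr_gt0.
have [T1 [g1 [Phi1 [cp1 gx1 gy1 lt1]]]] := path_dist_cost_approx x y e2.
have [T2 [g2 [Phi2 [cp2 gx2 gy2 lt2]]]] := path_dist_cost_approx y z e2.
have g12 : g1 T1 = g2 0 by rewrite gy1.
have := path_dist_cost (cost_path_cat g12 cp1 cp2).
have T10 : 0 <= T1 by case: cp1.
have T20 : 0 <= T2 by case: cp2.
rewrite T10 gx1 addrAC subrr add0r gy2.
(* The end point [T1 + T2] falls into the first branch exactly when [T2 = 0]; then the second path
   is a single point and [y = z]. *)
case: ifP => [h|_].
  have T2E : T2 = 0 by lra.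
  move: gy2 gx2 lt2 cp2; rewrite T2E addr0 gy1 subrr => -> -> *; lra.
lra.
Qed.

(* Only the local behaviour of [phi] matters, so [phi] may be far from Lipschitz. *)
Lemma path_dist_ge (phi : M -> R) x y :
  (forall z e, 0 < e -> exists2 d, 0 < d & forall w, mdist z w < d ->
    `|phi z - phi w| <= (rho z + e) * mdist z w) ->
  phi y - phi x <= path_dist rho x y.
Proof.
move=> loc; apply: le_path_dist => a b g rg <- <-.
have [L [sg [L0 slip s0 sL [cf LE st ->]]]] := rectifiable_arc rg.
rewrite [fine _]/= -s0 -sL; set J := running_integral _.
have J0 : J 0 = 0 by exact: running_integral0.
apply/ler_addgt0Pr => e e0.
pose e1 := e / (2 * (L + 1)).
have e10 : 0 < e1 by rewrite divr_gt0// mulr_gt0// ltr_wpDl.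
have e1L : 2 * e1 * L <= e.
  have : e1 * (2 * (L + 1)) = e.
    by rewrite divfK// gt_eqF// mulr_gt0// ltr_wpDl.
  lra.
suff : phi (sg L) - phi (sg 0) <= J L - J 0 + 2 * e1 * (L - 0) by rewrite J0; lra.
pose P s t := phi (sg t) - phi (sg s) <= J t - J s + 2 * e1 * (t - s).
apply: (@cousin R 0 L P) => //; first by rewrite /P => *; lra.
move=> z zL; have [d1 d10 d1P] := running_integral_near cf z e10.
have [d2 d20 d2P] := loc (sg z) _ e10.
exists (Num.min d1 d2); first by rewrite lt_min d10.
move=> s t s0' sz zt tL; rewrite ltrBlDr -ltrBlDl lt_min => /andP[zs1 zs2].
rewrite -ltrBlDl lt_min => /andP[tz1 tz2].
have /andP[h _] := d1P s t s0' (le_trans sz zt) ltac:(lra) ltac:(lra).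
have hw w d : `|z - w| <= d -> d < d2 -> `|phi (sg z) - phi (sg w)| <=
    (rho (sg z) + e1) * d.
  move=> zw dd2; have zd := le_trans (slip z w) zw.
  apply: le_trans (d2P _ (le_lt_trans zd dd2)) _.
  by rewrite ler_wpM2l// addr_ge0// ltW.
have := hw s (z - s); rewrite ger0_norm ?subr_ge0// => /(_ (lexx _) zs2).
have := hw t (t - z); rewrite distrC ger0_norm ?subr_ge0// => /(_ (lexx _) tz2).
rewrite !ler_norml => /andP[h1 h1'] /andP[h2 h2'].
rewrite /P; rewrite -/J /= in h; nra.
Qed.

(** Apply [path_dist_ge] to the distance from [x] truncated at [r] and multiplied by [c]: it is
    locally constant outside the ball, so a lower bound for [rho] inside the ball suffices. *)
Lemma path_dist_ge_ball x y c r : 0 <= c -> 0 < r ->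
  (forall z, mdist x z <= r -> c <= rho z) ->
  c * Num.min r (mdist x y) <= path_dist rho x y.
Proof.
move=> c0 r0 cr.
have := @path_dist_ge (fun z => c * Num.min r (mdist x z)) x y.
rewrite mdistxx (min_r (ltW r0)) mulr0 subr0; apply => z e e0.
have [xz|xz] := leP (mdist x z) r.
  exists 1 => // w _; rewrite -mulrBr normrM (ger0_norm c0).
  apply: ler_pM => //; first by have := cr z xz; lra.
  have := metric_triangle x z w; have := metric_triangle x w z.
  rewrite (metric_sym w z) => h1 h2; rewrite ler_norml.
  by case: (leP r (mdist x w)) => ?; apply/andP; split; lra.
exists (mdist x z - r); first by rewrite subr_gt0.
move=> w zw; rewrite min_l ?subrr ?normr0.
  by rewrite mulr_ge0 ?mdist_ge0// addr_ge0// ltW.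
by have := metric_triangle x w z; rewrite (metric_sym w z); lra.
Qed.

Lemma path_dist_metric : is_metric (path_dist rho).
Proof.
split; [exact: path_distxx| |exact: path_dist_sym|exact: path_dist_triangle].
move=> x y xy; have r2 : 0 < rho x / 2 by rewrite divr_gt0.
have [d d0 dP] := crho x r2.
have d2 : 0 < d / 2 by rewrite divr_gt0.
have := @path_dist_ge_ball x y (rho x / 2) (d / 2) (ltW r2) d2.
rewrite xy => /(_ _)/wrap[].
  move=> z xz; have := dP z ltac:(lra); rewrite ltr_norml; lra.
rewrite pmulr_rle0// ge_min leNgt d2 /= => h.
by apply: mdist_positivity; apply/le_anti; rewrite h mdist_ge0.
Qed.

End path_metric.

(** * The hyperbolic distance formula *)

Section complex_norm.
Context {R : realType}.
Implicit Types x y z w : R[i].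
Local Notation normc := Normc.normc.
Local Open Scope complex_scope.

Lemma normc_ge0 z : 0 <= normc z.
Proof. by case: z => a b; exact: sqrtr_ge0. Qed.

Lemma sqr_normcE (a b : R) : normc (a +i* b) ^+ 2 = a ^+ 2 + b ^+ 2.
Proof. by rewrite /= sqr_sqrtr// addr_ge0// sqr_ge0. Qed.

Lemma normc_conj z : normc (conjc z) = normc z.
Proof. by case: z => a b /=; rewrite sqrrN. Qed.

Lemma normcB z w : normc (z - w) = normc (w - z).
Proof. by rewrite -normcN opprB. Qed.

Lemma normc_real (a : R) : normc a%:C = `|a|.
Proof. by rewrite /= expr0n /= addr0 sqrtr_sqr. Qed.

Lemma mulcJ z : z * conjc z = (normc z ^+ 2)%:C.
Proof.
case: z => a b; rewrite sqr_normcE; apply/eqP; rewrite eq_complex /=.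
by apply/andP; split; apply/eqP; ring.
Qed.

Lemma ler_dist_normc z w : `|normc z - normc w| <= normc (z - w).
Proof.
have h1 := le_normcD (z - w) w; have h2 := le_normcD (w - z) z.
rewrite subrK in h1; rewrite subrK in h2; rewrite normcB in h2.
by rewrite ler_norml; apply/andP; split; lra.
Qed.

(* The defect of [|1 - z w^*|^2] against [|z - w|^2] factorizes, which is why the
   hyperbolic distance is well defined and Moebius invariant. *)
Lemma sqr_normc_defect z w : normc (1 - z * conjc w) ^+ 2 - normc (z - w) ^+ 2 =
  (1 - normc z ^+ 2) * (1 - normc w ^+ 2).
Proof.
case: z => a b; case: w => c d.
have -> : 1 - (a +i* b) * conjc (c +i* d) =
    (1 - (a * c + b * d)) +i* (a * d - b * c).
  by apply/eqP; rewrite eq_complex /=; apply/andP; split; apply/eqP; ring.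
by rewrite !sqr_normcE; ring.
Qed.

End complex_norm.

Section hdist.
Context {R : realType}.
Local Notation normc := Normc.normc.
Local Open Scope complex_scope.
Local Notation D := (disk R).
Implicit Types x y z w : D.

(** With [gmean] below, [chordA / gmean] and [chordB / gmean] are the hyperbolic cosine and sine of
    the hyperbolic distance; the identity [chordAB] is then [cosh ^ 2 - sinh ^ 2 = 1]. *)
Definition defect z : R := 1 - normc (val z) ^+ 2.
Definition chordA z w : R := normc (1 - val z * conjc (val w)).
Definition chordB z w : R := normc (val z - val w).
Local Notation q := defect.
Local Notation A := chordA.
Local Notation B := chordB.

Lemma disk_normc_lt1 z : normc (val z) < 1. Proof. by case: z. Qed.

Lemma defect_gt0 z : 0 < q z.
Proof.
rewrite subr_gt0 expr_lt1 ?normc_ge0// ?disk_normc_lt1//.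
Qed.

Lemma defect_le1 z : q z <= 1.
Proof. by rewrite /defect gerBl sqr_ge0. Qed.

Lemma defect_lip z w : `|q z - q w| <= 2 * B z w.
Proof.
have := ler_dist_normc (val z) (val w).
have := disk_normc_lt1 z; have := disk_normc_lt1 w.
have := normc_ge0 (val z); have := normc_ge0 (val w).
rewrite -/(B z w) /defect; set a := normc _; set b := normc _ => a0 b0 a1 b1 ab.
have -> : 1 - b ^+ 2 - (1 - a ^+ 2) = (a - b) * (a + b) by ring.
rewrite normrM mulrC distrC; apply: ler_pM => //.
by rewrite ger0_norm ?addr_ge0//; lra.
Qed.

Lemma chordB_ge0 z w : 0 <= B z w. Proof. exact: normc_ge0. Qed.

Lemma chordBC z w : B z w = B w z. Proof. exact: normcB. Qed.

Lemma chordB_eq0 z w : B z w = 0 -> z = w.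
Proof. by move=> /Normc.eq0_normc/eqP; rewrite subr_eq0 => /eqP/val_inj. Qed.

Lemma chordAC z w : A z w = A w z.
Proof. by rewrite /A -normc_conj rmorphB rmorphM rmorph1 /= conjcK mulrC. Qed.

Lemma chordAB z w : A z w ^+ 2 - B z w ^+ 2 = q z * q w.
Proof. exact: sqr_normc_defect. Qed.

Lemma chordA_ge0 z w : 0 <= A z w. Proof. exact: normc_ge0. Qed.

Lemma chordB_ltA z w : B z w < A z w.
Proof.
rewrite -(@ltr_pXn2r _ 2)// ?nnegrE ?chordA_ge0 ?chordB_ge0//.
by rewrite -subr_gt0 chordAB mulr_gt0 ?defect_gt0.
Qed.

(** Norms in the exact identity [(1 - |y|^2) (1 - x z') = (1 - x y') (1 - y z') + (x - y) (y' -
    z')], primes denoting conjugates. After normalization it is the addition formula for the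
    hyperbolic cosine; [chordB_triangle] is the one for the sine. *)
Lemma chordA_triangle y x z : q y * A x z <= A x y * A y z + B x y * B y z.
Proof.
have -> : q y = normc (1 - val y * conjc (val y)).
  rewrite mulcJ -[1]/((1 : R)%:C) -rmorphB normc_real ger0_norm//.
  exact/ltW/defect_gt0.
rewrite /A /B -(normc_conj (val y - val z)) -!Normc.normcM rmorphB.
apply: le_trans (le_normcD _ _); rewrite le_eqVlt; apply/orP; left; apply/eqP.
by congr normc; ring.
Qed.

Lemma chordB_triangle y x z : q y * B x z <= A x y * B y z + B x y * A y z.
Proof.
have -> : q y = normc (1 - val y * conjc (val y)).
  rewrite mulcJ -[1]/((1 : R)%:C) -rmorphB normc_real ger0_norm//.
  exact/ltW/defect_gt0.
rewrite (chordAC y z) /A /B -!Normc.normcM.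
apply: le_trans (le_normcD _ _); rewrite le_eqVlt; apply/orP; left; apply/eqP.
by congr normc; ring.
Qed.

(** Write [1 - x z'] as [(1 - x y') + x (y' - z')], primes denoting conjugates, and use [|x| < 1]
    and [chordB < chordA]. *)
Lemma chordA_quasi y x z : A x z <= A x y + A y z.
Proof.
have h : A x z <= A x y + normc (val x) * B y z.
  rewrite /A /B -(normc_conj (val y - val z)) -Normc.normcM rmorphB.
  apply: le_trans (le_normcD _ _); rewrite le_eqVlt; apply/orP; left; apply/eqP.
  by congr normc; ring.
apply: le_trans h _; rewrite lerD2l; apply: le_trans (ltW (chordB_ltA _ _)).
by rewrite ler_piMl ?chordB_ge0// ltW// disk_normc_lt1.
Qed.

Definition gmean z w : R := Num.sqrt (q z * q w).
Local Notation G := gmean.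

Lemma gmean_gt0 z w : 0 < G z w.
Proof. by rewrite sqrtr_gt0 mulr_gt0 ?defect_gt0. Qed.

Lemma gmeanC z w : G z w = G w z. Proof. by rewrite /G mulrC. Qed.

Lemma sqr_gmean z w : G z w ^+ 2 = q z * q w.
Proof. by rewrite sqr_sqrtr// mulr_ge0// ltW ?defect_gt0. Qed.

Lemma gmean_ge m z w : 0 <= m -> m <= q z -> m <= q w -> m <= G z w.
Proof.
move=> m0 mz mw; rewrite -(@ler_pXn2r _ 2)// ?nnegrE ?(ltW (gmean_gt0 _ _))//.
by rewrite sqr_gmean expr2 ler_pM.
Qed.

Lemma gmean_le m z w : q z <= m -> q w <= m -> G z w <= m.
Proof.
move=> mz mw; have m0 : 0 <= m by apply: le_trans mz; exact/ltW/defect_gt0.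
rewrite -(@ler_pXn2r _ 2)// ?nnegrE ?(ltW (gmean_gt0 _ _))//.
by rewrite sqr_gmean expr2 ler_pM// ltW ?defect_gt0.
Qed.

Lemma gmean_mul y x z : G x y * G y z = q y * G x z.
Proof.
rewrite /G -sqrtrM; last by rewrite mulr_ge0// ltW ?defect_gt0.
rewrite (_ : q x * q y * (q y * q z) = q y ^+ 2 * (q x * q z)); last by ring.
by rewrite sqrtrM ?sqr_ge0// sqrtr_sqr ger0_norm// ltW ?defect_gt0.
Qed.

(* [artanh (|z - w| / |1 - z w^*|)] *)
Definition hdist z w : R := ln ((A z w + B z w) / G z w).
Local Notation d := hdist.

Lemma chordAB_gt0 z w : 0 < A z w + B z w.
Proof.
by rewrite ltr_pwDl ?chordB_ge0//; apply: le_lt_trans (chordB_ltA z w); exact: chordB_ge0.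
Qed.

Lemma expR_hdist z w : expR (d z w) = (A z w + B z w) / G z w.
Proof. by rewrite lnK// posrE divr_gt0 ?gmean_gt0// chordAB_gt0. Qed.

Lemma expR_hdistN z w : expR (- d z w) = (A z w - B z w) / G z w.
Proof.
rewrite expRN expR_hdist invf_div; apply/eqP.
rewrite eqr_div ?lt0r_neq0 ?gmean_gt0 ?chordAB_gt0// -expr2 sqr_gmean -chordAB.
by apply/eqP; ring.
Qed.

Lemma sinh_hdist z w : expR (d z w) - expR (- d z w) = 2 * B z w / G z w.
Proof. by rewrite expR_hdist expR_hdistN -mulrBl; congr (_ / _); ring. Qed.

Lemma hdistxx z : d z z = 0.
Proof.
have AE : A z z = G z z.
  rewrite /A mulcJ -[1]/((1 : R)%:C) -rmorphB normc_real /G -expr2 sqrtr_sqr.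
  by [].
by rewrite /d /B subrr Normc.normc0 addr0 AE divff ?ln1// gt_eqF ?gmean_gt0.
Qed.

Lemma hdistC z w : d z w = d w z.
Proof. by rewrite /d chordAC chordBC gmeanC. Qed.

Lemma hdist_ge0 z w : 0 <= d z w.
Proof.
rewrite ln_ge0// ler_pdivlMr ?gmean_gt0// mul1r.
rewrite -(@ler_pXn2r _ 2)// ?nnegrE ?(ltW (gmean_gt0 _ _)) ?(ltW (chordAB_gt0 _ _))//.
rewrite sqr_gmean -chordAB; have := chordA_ge0 z w; have := chordB_ge0 z w; nra.
Qed.

Lemma hdist_eq0 z w : d z w = 0 -> z = w.
Proof.
move=> dzw; have := sinh_hdist z w; rewrite dzw oppr0 subrr => /esym/eqP.
rewrite mulf_eq0 invr_eq0 (gt_eqF (gmean_gt0 _ _)) orbF mulf_eq0 pnatr_eq0 /=.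
by move=> /eqP/chordB_eq0.
Qed.

Lemma hdist_triangle y x z : d x z <= d x y + d y z.
Proof.
rewrite -ler_expR expRD !expR_hdist ler_pdivrMr ?gmean_gt0//.
(* The sum of the two addition inequalities bounds [q y * (A x z + B x z)] by the product
   [(A x y + B x y) * (A y z + B y z)]; by [gmean_mul] the normalizing factors match. *)
have hA := chordA_triangle y x z; have hB := chordB_triangle y x z.
rewrite -(ler_pM2l (defect_gt0 y)).
have -> : q y * ((A x y + B x y) / G x y * ((A y z + B y z) / G y z) * G x z) =
    (A x y + B x y) * (A y z + B y z) * ((q y * G x z) / (G x y * G y z)).
  by field; rewrite !gt_eqF ?gmean_gt0.
rewrite -gmean_mul divff ?mulr1; last by rewrite mulf_neq0// gt_eqF ?gmean_gt0.
lra.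
Qed.

Lemma hdist_metric : is_metric hdist.
Proof.
by split; [exact: hdistxx|exact: hdist_eq0|exact: hdistC|exact: hdist_triangle].
Qed.

End hdist.

(* Iterating [sinh (2 y) >= 2 sinh y] removes the error of the crude bound
   [sinh y >= y (1 - y)]. *)
Lemma sinh_ge (R : realType) (x : R) : 0 <= x -> 2 * x <= expR x - expR (- x).
Proof.
have crude (y : R) : 0 <= y -> 2 * y * (1 - y) <= expR y - expR (- y).
  move=> y0; have -> : expR y - expR (- y) = expR (- y) * (expR (2 * y) - 1).
    by rewrite mulrBr -expRD mulr1; congr (expR _ - _); ring.
  have := expR_ge1Dx (- y); have := expR_ge1Dx (2 * y); have := expR_gt0 (- y).
  set E := expR _; set F := expR _ => E0 F1 E1.
  apply: (@le_trans _ _ (2 * y * E)); first by rewrite ler_wpM2l ?mulr_ge0.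
  by rewrite mulrC ler_wpM2l ?(ltW E0)//; lra.
have step n : forall y : R, 0 <= y ->
    2 * y * (1 - y / 2 ^+ n) <= expR y - expR (- y).
  elim: n => [y y0|n IH y y0]; first by rewrite expr0 divr1 crude.
  have y2 : 0 <= y / 2 by rewrite divr_ge0.
  have := IH _ y2; set h := y / 2 in y2 *.
  have -> : y = h + h by rewrite /h; field.
  rewrite opprD !expRD.
  have := expR_ge1Dx h; have := expR_gt0 (- h).
  have := expRxMexpNx_1 h; have : expR (- h) <= 1 by rewrite expR_le1 oppr_le0.
  set E := expR h; set F := expR (- h) => F1 EF F0 E1 hh.
  have EF2 : 2 <= E + F by have := sqr_ge0 (E - 1); nra.
  have -> : (h + h) / 2 ^+ n.+1 = h / 2 ^+ n.
    by rewrite exprS; field; rewrite expf_neq0.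
  have -> : E * E - F * F = (E - F) * (E + F) by ring.
  have : (E - F) * 2 <= (E - F) * (E + F) by rewrite ler_wpM2l//; lra.
  lra.
move=> x0; apply/ler_addgt0Pr => e e0.
pose n := (Num.truncn (2 * x ^+ 2 / e)).+1.
have n2 : 2 * x ^+ 2 / e < 2 ^+ n.
  apply: lt_le_trans (truncnS_gt _) _; rewrite -natrX ler_nat.
  exact/ltnW/ltn_expl.
have := step n x x0.
have : 2 * x * (x / 2 ^+ n) <= e; last by lra.
rewrite mulrA ler_pdivrMr ?exprn_gt0//.
move: n2; rewrite ltr_pdivrMr//; lra.
Qed.

(** * Density, four-point condition and Moebius maps *)

Section density.
Context {R : realType}.
Local Notation D := (disk R).
Implicit Types x y z w : D.
Local Notation q := defect.
Local Notation A := chordA.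
Local Notation B := chordB.
Local Notation G := gmean.
Local Notation d := hdist.

Lemma expR_le_inv (x : R) : x < 1 -> expR x <= (1 - x)^-1.
Proof.
move=> x1; rewrite -[x]opprK expRN opprK lef_pV2 ?posrE ?expR_gt0//; last by lra.
by have := expR_ge1Dx (- x).
Qed.

Lemma mdist_disk z w : mdist z w = B z w. Proof. by []. Qed.

Lemma hdist_le z w : d z w <= B z w / G z w.
Proof.
have := sinh_ge (hdist_ge0 z w); rewrite sinh_hdist -mulrA ler_pM2l//.
Qed.

Lemma chordB_le z w : B z w <= G z w * (d z w * expR (d z w)).
Proof.
have := sinh_hdist z w; set t := d z w => E.
have h : expR t - expR (- t) <= 2 * t * expR t.
  have -> : expR t - expR (- t) = expR t * (1 - expR (- (2 * t))).
    by rewrite mulrBr -expRD mulr1; congr (_ - expR _); ring.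
  rewrite mulrC ler_wpM2r ?expR_ge0//.
  by have := expR_ge1Dx (- (2 * t)); lra.
have -> : B z w = G z w * (2 * B z w / G z w) / 2.
  by field; rewrite lt0r_neq0// gmean_gt0.
by rewrite -E; have := gmean_gt0 z w; nra.
Qed.

Lemma gmean_le1 z w : G z w <= 1.
Proof. by apply: gmean_le; exact: defect_le1. Qed.

Lemma chordB_le2 z w : d z w <= 1 / 2 -> B z w <= 2 * d z w.
Proof.
move=> dh; apply: le_trans (chordB_le z w) _.
have d0 := hdist_ge0 z w.
have e2 : expR (d z w) <= 2.
  apply: le_trans (expR_le_inv _) _; first by lra.
  by rewrite -[leRHS]invrK lef_pV2 ?posrE//; lra.
rewrite mulrC; apply: le_trans (_ : d z w * expR (d z w) * 1 <= _).
  rewrite ler_wpM2l ?gmean_le1// mulr_ge0// expR_ge0.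
by rewrite mulr1 mulrC ler_wpM2r.
Qed.

Lemma chordB_near e : 0 < e -> exists2 r : R, 0 < r & forall z w, d z w < r -> B z w < e.
Proof.
move=> e0; exists (Num.min (1 / 2) (e / 2)); first by rewrite lt_min !divr_gt0.
move=> z w; rewrite lt_min => /andP[h1 h2].
by apply: le_lt_trans (chordB_le2 (ltW h1)) _; lra.
Qed.

(** Since [defect] is 2-Lipschitz for the Euclidean distance, it stays at least [m] at both points,
    and hence so does their [gmean]. *)
Lemma hdist_near_le z (m : R) w w' : 0 < m -> B z w <= (q z - m) / 2 ->
  B z w' <= (q z - m) / 2 -> d w w' <= B w w' / m.
Proof.
move=> m0 zw zw'; apply: le_trans (hdist_le w w') _.
rewrite ler_wpM2l ?chordB_ge0// lef_pV2 ?posrE ?gmean_gt0//.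
have := defect_lip z w; have := defect_lip z w'; rewrite !ler_norml => h h'.
by apply: gmean_ge; lra.
Qed.

Lemma hdist_density z (e : R) : 0 < e -> exists2 r, 0 < r & forall w w',
  B z w < r -> B z w' < r -> d w w' <= ((q z)^-1 + e) * B w w'.
Proof.
move=> e0; have q0 := defect_gt0 z.
have k0 : 0 < (q z)^-1 + e by rewrite addr_gt0// invr_gt0.
(* The lower bound [m] for the defect is the inverse of the target constant; it lies strictly below
   [q z], which leaves a positive radius. *)
have m0 : 0 < ((q z)^-1 + e)^-1 by rewrite invr_gt0.
have mq : ((q z)^-1 + e)^-1 < q z.
  by rewrite invf_plt ?posrE// ltrDl.
exists ((q z - ((q z)^-1 + e)^-1) / 2); first by lra.
move=> w w' zw zw'.
have := hdist_near_le m0 (ltW zw) (ltW zw'); rewrite invrK; lra.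
Qed.

Lemma chordB_density z (e : R) : 0 < e -> exists2 r, 0 < r & forall w w',
  B z w < r -> B z w' < r -> B w w' <= (q z + e) * d w w'.
Proof.
move=> e0; have q0 := defect_gt0 z; have q1 := defect_le1 z.
have m0 : 0 < q z / 2 by lra.
(* The bound [q z / 4] keeps the defect above [q z / 2], so the hyperbolic distance [t] satisfies
   [t * q z < 4 * r]; [e / 4] gives [G w w' <= q z + e / 2]; the last bound gives
   [t * (q z + e) <= e / 2], which absorbs the factor [expR t <= 1 / (1 - t)]. *)
pose r := Num.min (Num.min (q z / 4) (e / 4)) (q z * e / (8 * (1 + e))).
have r0 : 0 < r by rewrite !lt_min !divr_gt0// mulr_gt0//; lra.
have r1 : r <= q z / 4 by rewrite !ge_min lexx.
have r2 : r <= e / 4 by rewrite !ge_min lexx orbT.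
have r3 : r * (8 * (1 + e)) <= q z * e.
  by rewrite -ler_pdivlMr ?mulr_gt0//; [rewrite !ge_min lexx !orbT|lra].
exists r => // w w' zw zw'.
have dB : d w w' <= B w w' / (q z / 2) by apply: (@hdist_near_le z); lra.
have Bww : B w w' < 2 * r.
  have := @metric_triangle R D w z w'; rewrite !mdist_disk (chordBC w z); lra.
set t := d w w' in dB *.
have t0 : 0 <= t := hdist_ge0 w w'.
have tq : t * q z < 4 * r.
  by move: dB; rewrite ler_pdivlMr//; lra.
have te : t * (q z + e) <= e / 2.
  have : t * q z * (8 * (1 + e)) <= 4 * (q z * e) by nra.
  have : t * (q z + e) * q z <= e / 2 * q z by nra.
  by rewrite ler_pM2r.
have t1 : t < 1 by nra.
apply: le_trans (chordB_le w w') _; rewrite -/t.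
have := defect_lip z w; have := defect_lip z w'; rewrite !ler_norml => h h'.
have Gq : G w w' <= q z + e / 2 by apply: gmean_le; lra.
have := expR_le_inv t1; rewrite -[(1 - t)^-1]mul1r ler_pdivlMr; last by lra.
have := expR_gt0 t; set E := expR t => E0 Et.
have G0 := gmean_gt0 w w'.
have : (q z + e / 2) * E <= q z + e.
  have : (q z + e / 2) * E <= (q z + e) * (1 - t) * E by rewrite ler_wpM2r//; lra.
  have : (q z + e) * (E * (1 - t)) <= (q z + e) * 1 by rewrite ler_wpM2l//; lra.
  lra.
have : G w w' * E <= (q z + e / 2) * E by rewrite ler_wpM2r// ltW.
nra.
Qed.

(* [chordA] is a quasi-metric comparable to [expR hdist] times [gmean], and the
   factors [gmean] cancel in the four-point condition. *)
Lemma hdist_four_points x y z w :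
  d x z + d y w <= Num.max (d x y + d z w) (d x w + d y z) + ln 16.
Proof.
have lowB (u v : D) : A u v / G u v <= expR (d u v).
  by rewrite expR_hdist ler_pM2r ?invr_gt0 ?gmean_gt0// lerDl chordB_ge0.
have upB (u v : D) : expR (d u v) <= 2 * (A u v / G u v).
  rewrite expR_hdist mulrA ler_pM2r ?invr_gt0 ?gmean_gt0//.
  by have := chordB_ltA u v; lra.
have GG (u v s t : D) : G u v * G s t = Num.sqrt ((q u * q v) * (q s * q t)).
  by rewrite /G -sqrtrM// mulr_ge0// ltW ?defect_gt0.
pose N := Num.sqrt ((q x * q y) * (q z * q w)).
have N0 : 0 < N by rewrite sqrtr_gt0 !mulr_gt0 ?defect_gt0.
have G1 : G x z * G y w = N by rewrite GG; congr Num.sqrt; ring.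
have G2 : G x y * G z w = N by rewrite GG.
have G3 : G x w * G y z = N by rewrite GG; congr Num.sqrt; ring.
have key : A x z * A y w <= 4 * Num.max (A x y * A z w) (A x w * A y z).
  have h1 := chordA_quasi y x z; have h2 := chordA_quasi w x z.
  have h3 := chordA_quasi x y w; have h4 := chordA_quasi z y w.
  rewrite (chordAC w z) in h2; rewrite (chordAC y x) in h3.
  have X0 := chordA_ge0 x z; have Y0 := chordA_ge0 y w.
  have a0 := chordA_ge0 x y; have b0 := chordA_ge0 y z.
  have c0 := chordA_ge0 z w; have e0 := chordA_ge0 x w.
  set X := A x z in h1 h2 X0 *; set Y := A y w in h3 h4 Y0 *.
  set a := A x y in h1 h3 a0 *; set b := A y z in h1 h4 b0 *.
  set c := A z w in h2 h4 c0 *; set e := A x w in h2 h3 e0 *.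
  have mul u v : X <= 2 * u -> Y <= 2 * v -> X * Y <= 4 * (u * v).
    move=> Xu Yv; have -> : 4 * (u * v) = (2 * u) * (2 * v) by ring.
    exact: ler_pM.
  have L : X * Y <= 4 * (a * c) -> X * Y <= 4 * Num.max (a * c) (e * b).
    by move=> /le_trans; apply; rewrite ler_wpM2l// le_max lexx.
  have L' : X * Y <= 4 * (e * b) -> X * Y <= 4 * Num.max (a * c) (e * b).
    by move=> /le_trans; apply; rewrite ler_wpM2l// le_max lexx orbT.
  have [ab|ba] := leP a b; have [ce|ec] := leP c e.
  - have [ac|ca] := leP a c.
      by apply: L'; rewrite [e * b]mulrC; apply: mul; lra.
    by apply: L'; apply: mul; lra.
  - have [ae|ea] := leP a e.
      by apply: L'; rewrite [e * b]mulrC; apply: mul; lra.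
    by apply: L; rewrite [a * c]mulrC; apply: mul; lra.
  - have [bc|cb] := leP b c.
      by apply: L; apply: mul; lra.
    by apply: L'; apply: mul; lra.
  - have [be|eb] := leP b e.
      by apply: L; apply: mul; lra.
    by apply: L; rewrite [a * c]mulrC; apply: mul; lra.
rewrite -ler_expR !expRD lnK ?posrE//.
have -> : expR (Num.max (d x y + d z w) (d x w + d y z)) =
    Num.max (expR (d x y) * expR (d z w)) (expR (d x w) * expR (d y z)).
  rewrite -!expRD; case: (leP (d x y + d z w) (d x w + d y z)) => h.
    by rewrite max_r ?ler_expR.
  by rewrite max_l ?ler_expR ?(ltW h).
have up : expR (d x z) * expR (d y w) <= 4 * (A x z * A y w / N).
  have h := ler_pM (expR_ge0 _) (expR_ge0 _) (upB x z) (upB y w).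
  apply: le_trans h _; rewrite -G1.
  by rewrite le_eqVlt; apply/orP; left; apply/eqP; field; rewrite !lt0r_neq0 ?gmean_gt0.
apply: le_trans up _.
set m := Num.max (A x y * A z w) _ in key.
apply: (@le_trans _ _ (16 * (m / N))).
  have : A x z * A y w / N <= 4 * m / N by rewrite ler_pM2r ?invr_gt0.
  lra.
rewrite mulrC ler_wpM2r//.
have low (u v s t : D) : G u v * G s t = N -> A u v * A s t / N <= expR (d u v) * expR (d s t).
  have AG0 (u' v' : D) : 0 <= A u' v' / G u' v'.
    by rewrite divr_ge0 ?chordA_ge0// ltW ?gmean_gt0.
  have h := ler_pM (AG0 u v) (AG0 s t) (lowB u v) (lowB s t).
  move=> <-; apply: le_trans h.
  by rewrite invfM; rewrite le_eqVlt; apply/orP; left; apply/eqP; ring.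
rewrite /m; case: (leP (A x y * A z w) (A x w * A y z)) => _; rewrite le_max.
  by rewrite (low _ _ _ _ G3) orbT.
by rewrite (low _ _ _ _ G2).
Qed.
End density.

Section mobius.
Context {R : realType}.
Local Notation normc := Normc.normc.
Local Notation D := (disk R).
Local Notation q := defect.
Local Notation A := chordA.
Local Notation B := chordB.
Local Notation G := gmean.
Local Notation d := hdist.
Local Open Scope complex_scope.

(** The automorphism of the disk that takes 0 to [a]; its inverse is the one for [- a]. *)
Definition mobc (a z : R[i]) : R[i] := (z + a) / (1 + conjc a * z).

Lemma mobc_den_neq0 (a z : D) : 1 + conjc (val a) * val z != 0.
Proof.
apply/eqP => h; have : normc (conjc (val a) * val z) = 1.
  have -> : conjc (val a) * val z = - 1 by apply/eqP; rewrite -subr_eq0 opprK addrC h.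
  by rewrite normcN Normc.normc1.
rewrite Normc.normcM normc_conj => E.
have := disk_normc_lt1 a; have := disk_normc_lt1 z.
have := normc_ge0 (val a); have := normc_ge0 (val z); nra.
Qed.

Lemma conj_mobc (a z : R[i]) :
  conjc (mobc a z) = (conjc z + conjc a) / (1 + a * conjc z).
Proof. by rewrite /mobc rmorphM fmorphV !rmorphD rmorphM rmorph1 /= conjcK. Qed.

Lemma conj_den (a z : R[i]) : 1 + a * conjc z = conjc (1 + conjc a * z).
Proof. by rewrite rmorphD rmorphM rmorph1 /= conjcK. Qed.

Definition mob_den (a z : D) : R := normc (1 + conjc (val a) * val z).

Lemma mob_den_gt0 a z : 0 < mob_den a z.
Proof.
rewrite lt_neqAle normc_ge0 andbT eq_sym; apply/eqP => /Normc.eq0_normc h.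
by have := mobc_den_neq0 a z; rewrite h eqxx.
Qed.

Lemma normc_defect (z : D) : normc (1 - val z * conjc (val z)) = q z.
Proof.
rewrite mulcJ -[1]/((1 : R)%:C) -rmorphB normc_real ger0_norm//.
exact/ltW/defect_gt0.
Qed.

Lemma mobc_sub (a z w : D) : normc (mobc (val a) (val z) - mobc (val a) (val w)) =
  q a * B z w / (mob_den a z * mob_den a w).
Proof.
rewrite -normc_defect /B /mob_den -!Normc.normcM -Normc.normcV -Normc.normcM.
congr normc; rewrite /mobc.
by field; rewrite !mobc_den_neq0.
Qed.

Lemma mobc_A (a z w : D) :
  1 - mobc (val a) (val z) * conjc (mobc (val a) (val w)) =
  (1 - val a * conjc (val a)) * (1 - val z * conjc (val w)) /
  ((1 + conjc (val a) * val z) * (1 + val a * conjc (val w))).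
Proof.
rewrite conj_mobc /mobc; have h1 := mobc_den_neq0 a z.
have h2 : 1 + val a * conjc (val w) != 0.
  by rewrite conj_den conjc_eq0 mobc_den_neq0.
by field; rewrite h1 h2.
Qed.

Lemma normc_mobc_A (a z w : D) :
  normc (1 - mobc (val a) (val z) * conjc (mobc (val a) (val w))) =
  q a * A z w / (mob_den a z * mob_den a w).
Proof.
rewrite mobc_A conj_den !Normc.normcM Normc.normcV !Normc.normcM normc_conj.
by rewrite normc_defect.
Qed.

Lemma mobc_defect (a z : D) : 1 - normc (mobc (val a) (val z)) ^+ 2 =
  q a * q z / mob_den a z ^+ 2.
Proof.
apply: complexI; have := mobc_A a z z.
rewrite mulcJ conj_den mulcJ -[1]/((1 : R)%:C) !mulcJ -!rmorphB -rmorphM => ->.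
by rewrite -rmorphV ?unitfE ?sqrf_eq0 ?gt_eqF ?mob_den_gt0// -rmorphM.
Qed.

Lemma mobc_lt1 (a z : D) : normc (mobc (val a) (val z)) < 1.
Proof.
rewrite -(@expr_lt1 _ 2) ?normc_ge0// -subr_gt0 mobc_defect.
by rewrite divr_gt0 ?exprn_gt0 ?mob_den_gt0// mulr_gt0 ?defect_gt0.
Qed.

Definition mobius (a z : D) : D := exist _ (mobc (val a) (val z)) (mobc_lt1 a z).

(** [chordA], [chordB] and [gmean] are all multiplied by the same factor
    [q a / (mob_den a z * mob_den a w)], which cancels in the quotient. *)
Lemma hdist_mobius (a z w : D) : d (mobius a z) (mobius a w) = d z w.
Proof.
have n0 z' := mob_den_gt0 a z'; have qa := defect_gt0 a.
have GE : G (mobius a z) (mobius a w) = q a * G z w / (mob_den a z * mob_den a w).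
  have dE z' : q (mobius a z') = q a * q z' / mob_den a z' ^+ 2.
    exact: mobc_defect.
  rewrite /G !dE.
  rewrite (_ : _ / _ * _ = (q a / (mob_den a z * mob_den a w)) ^+ 2 * (q z * q w)).
    rewrite sqrtrM ?sqr_ge0// sqrtr_sqr ger0_norm; first by ring.
    by rewrite divr_ge0 ?mulr_ge0// ltW.
  by field; rewrite !lt0r_neq0.
have AE : A (mobius a z) (mobius a w) = _ := normc_mobc_A a z w.
have BE : B (mobius a z) (mobius a w) = _ := mobc_sub a z w.
rewrite /d GE AE BE; congr ln.
by field; rewrite !lt0r_neq0 ?gmean_gt0.
Qed.

Lemma disk_opp_lt1 (z : D) : normc (- val z) < 1.
Proof. by rewrite normcN disk_normc_lt1. Qed.

Definition disk_opp (z : D) : D := exist _ (- val z) (disk_opp_lt1 z).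

Lemma mobiusK (a z : D) : mobius a (mobius (disk_opp a) z) = z.
Proof.
apply: val_inj; rewrite /= /mobc rmorphN /=.
have h1 := mobc_den_neq0 (disk_opp a) z; rewrite /= rmorphN /= in h1.
have h2 : 1 - conjc (val a) * val a != 0.
  apply/eqP => h; have := normc_defect a; rewrite mulrC h Normc.normc0 => E.
  by have := defect_gt0 a; rewrite -E ltxx.
field; apply/andP; split; first exact: h1.
move: h2; congr (_ != _); rewrite /=; ring.
Qed.
End mobius.

(** * Geodesics and Gromov hyperbolicity *)

Section radial.
Context {R : realType}.
Local Notation normc := Normc.normc.
Local Notation D := (disk R).
Local Open Scope complex_scope.
Implicit Types s t r : R.

(** Twice the hyperbolic cosine; [th] is the hyperbolic tangent, that is, the Euclidean radius of
    the circle of hyperbolic radius [t] about 0. *)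
Definition ch t : R := expR t + expR (- t).
Definition th t : R := (expR t - expR (- t)) / ch t.

Lemma ch_gt0 t : 0 < ch t. Proof. by rewrite addr_gt0 ?expR_gt0. Qed.

Lemma th_sub s t : th s - th t =
  2 * (expR (s - t) - expR (- (s - t))) / (ch s * ch t).
Proof.
rewrite /th /ch opprB !expRD !expRN; have := expR_gt0 s; have := expR_gt0 t.
set a := expR s; set b := expR t => b0 a0.
by field; rewrite !lt0r_neq0// addr_gt0 ?mulr_gt0.
Qed.

Lemma one_sub_th s t : 1 - th s * th t =
  2 * (expR (s - t) + expR (- (s - t))) / (ch s * ch t).
Proof.
rewrite /th /ch opprB !expRD !expRN; have := expR_gt0 s; have := expR_gt0 t.
set a := expR s; set b := expR t => b0 a0.
by field; rewrite !lt0r_neq0// addr_gt0 ?mulr_gt0.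
Qed.

Lemma sqr_th t : 1 - th t ^+ 2 = 4 / ch t ^+ 2.
Proof.
rewrite [th t ^+ 2]expr2 one_sub_th subrr oppr0 expR0.
by field; rewrite lt0r_neq0// ch_gt0.
Qed.

Lemma th0 : th 0 = 0.
Proof. by rewrite /th oppr0 subrr mul0r. Qed.

Lemma th_lt1 t : `|th t| < 1.
Proof.
rewrite -(@expr_lt1 _ 2)// -subr_gt0 -normrX ger0_norm ?sqr_ge0// sqr_th.
by rewrite divr_gt0// exprn_gt0// ch_gt0.
Qed.

Lemma th_ge0 t : 0 <= t -> 0 <= th t.
Proof.
move=> t0; have := th_sub t 0; rewrite th0 !subr0 => ->.
rewrite divr_ge0 ?mulr_ge0 ?(ltW (ch_gt0 _))//.
by have := sinh_ge t0; lra.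
Qed.

Lemma normc_radial (u : R[i]) t : normc u = 1 -> normc ((th t)%:C * u) < 1.
Proof. by move=> u1; rewrite Normc.normcM u1 mulr1 normc_real th_lt1. Qed.

Definition radial (u : R[i]) (u1 : normc u = 1) t : D :=
  exist _ ((th t)%:C * u) (normc_radial t u1).

Variables (u : R[i]) (u1 : normc u = 1).

Lemma normc_radialE t : normc (val (radial u1 t)) = `|th t|.
Proof. by rewrite /= Normc.normcM u1 mulr1 normc_real. Qed.

Lemma defect_radial t : defect (radial u1 t) = 4 / ch t ^+ 2.
Proof. by rewrite /defect normc_radialE -normrX ger0_norm ?sqr_ge0// sqr_th. Qed.

Lemma gmean_radial s t (v : R[i]) (v1 : normc v = 1) : defect (radial v1 t) = 4 / ch t ^+ 2 ->
  gmean (radial u1 s) (radial v1 t) = 4 / (ch s * ch t).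
Proof.
move=> E; rewrite /gmean E defect_radial.
rewrite (_ : _ / _ * _ = (4 / (ch s * ch t)) ^+ 2).
  by rewrite sqrtr_sqr ger0_norm// divr_ge0// mulr_ge0// ltW// ch_gt0.
by field; rewrite !lt0r_neq0 ?ch_gt0.
Qed.

Lemma hdist_radial s t : hdist (radial u1 s) (radial u1 t) = `|s - t|.
Proof.
wlog ts : s t / t <= s.
  by move=> H; have [/H//|/ltW/H] := leP t s; rewrite hdistC distrC.
apply: expR_inj; rewrite expR_hdist gmean_radial ?defect_radial//.
have -> : chordA (radial u1 s) (radial u1 t) = `|1 - th s * th t|.
  rewrite /chordA /= [conjc (_ * u)]rmorphM /= ?oppr0 -[th t +i* 0]/((th t)%:C).
  have -> : (th s)%:C * u * ((th t)%:C * conjc u) = (th s * th t)%:C * (u * conjc u).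
    by rewrite (rmorphM _ (th s) (th t)); ring.
  by rewrite mulcJ u1 expr1n mulr1 -[1]/((1 : R)%:C) -rmorphB normc_real.
have -> : chordB (radial u1 s) (radial u1 t) = `|th s - th t|.
  by rewrite /chordB /= -mulrBl -rmorphB Normc.normcM u1 mulr1 normc_real.
rewrite one_sub_th th_sub (ger0_norm (_ : 0 <= s - t)) ?subr_ge0//.
have st0 : 0 <= s - t by rewrite subr_ge0.
have c0 : 0 <= (ch s * ch t)^-1 by rewrite invr_ge0 mulr_ge0// ltW// ch_gt0.
rewrite !ger0_norm.
- by field; rewrite !lt0r_neq0 ?ch_gt0.
- by rewrite !mulr_ge0//; have := sinh_ge st0; lra.
- by rewrite !mulr_ge0// addr_ge0// expR_ge0.
Qed.

Lemma radial0 : radial u1 0 = disk0.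
Proof. by apply: val_inj; rewrite /= th0 mul0r. Qed.

Lemma hdist0_radial t : hdist disk0 (radial u1 t) = `|t|.
Proof. by rewrite -radial0 hdist_radial sub0r normrN. Qed.

End radial.

Section geodesics.
Context {R : realType}.
Local Notation normc := Normc.normc.
Local Notation D := (disk R).
Local Open Scope complex_scope.

(** Against the origin [chordA] is 1 and [chordB] is the modulus, so the modulus is sine over cosine
    of the distance. *)
Lemma normc_th (z : D) : normc (val z) = th (hdist disk0 z).
Proof.
have E : chordA disk0 z = 1 by rewrite /chordA /= mul0r subr0 Normc.normc1.
have F : chordB disk0 z = normc (val z) by rewrite /chordB /= sub0r normcN.
rewrite /th /ch expR_hdist expR_hdistN E F; have := gmean_gt0 disk0 z.
set G := gmean _ _ => G0; field.
by rewrite lt0r_neq0//= lt0r_neq0// (_ : _ + _ = 2)//; ring.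
Qed.

Lemma defect_hdist (z : D) : defect z = 4 / ch (hdist disk0 z) ^+ 2.
Proof. by rewrite /defect normc_th sqr_th. Qed.

Lemma polarP (z : D) : exists (u : R[i]) (u1 : normc u = 1),
  z = radial u1 (hdist disk0 z).
Proof.
have [z0|z0] := eqVneq (normc (val z)) 0.
  exists 1, (Normc.normc1 R); apply: val_inj.
  by rewrite /= -normc_th z0 mul0r; exact: Normc.eq0_normc.
have u1 : normc (val z / (normc (val z))%:C) = 1.
  rewrite Normc.normcM Normc.normcV normc_real ger0_norm ?normc_ge0//.
  by rewrite divff.
exists (val z / (normc (val z))%:C), u1; apply: val_inj; rewrite /= -normc_th.
rewrite mulrCA mulrV ?mulr1// unitfE.
by apply: contra z0 => /eqP/complexI ->.
Qed.

Lemma mobius0 (a : D) : mobius a disk0 = a.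
Proof. by apply: val_inj; rewrite /= /mobc mulr0 addr0 add0r divr1. Qed.

(** A diameter is a geodesic by [hdist_radial]; the Moebius map taking 0 to [x] carries a suitable
    one onto a line through [x] and [y]. *)
Lemma geodesic_line (x y : D) : exists g : R -> D,
  [/\ g 0 = x, g (hdist x y) = y &
      forall s t, hdist (g s) (g t) = `|s - t|].
Proof.
pose y' := mobius (disk_opp x) y.
have [u [u1 yE]] := polarP y'.
have xyE : hdist disk0 y' = hdist x y.
  by rewrite -(hdist_mobius x disk0) mobius0 mobiusK.
exists (fun t => mobius x (radial u1 t)); split.
- by rewrite radial0 mobius0.
- by rewrite -xyE -yE mobiusK.
- by move=> s t; rewrite hdist_mobius hdist_radial.
Qed.

End geodesics.

(** * The length distance agrees with the closed formula *)

Section hyperbolic.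
Context {R : realType}.
Local Notation D := (disk R).
Local Notation rho := (fun z : D => (1 - Normc.normc (val z) ^+ 2)^-1).

Lemma invf_continuous_near (q : R) (e : R) : 0 < q -> 0 < e ->
  exists2 r, 0 < r & forall p, `|q - p| < r -> `|q^-1 - p^-1| < e.
Proof.
move=> q0 e0; have : (fun x : R => x^-1) x @[x --> q] --> q^-1.
  by apply: cvgV; [exact: lt0r_neq0|exact: cvg_id].
move=> /cvgrPdist_lt/(_ e e0)/nbhs_ballP[r /= r0 rP].
by exists r => // p qp; exact: rP.
Qed.

Lemma hyperbolic_density_continuous (z : D) (e : R) : 0 < e ->
  exists2 d, 0 < d & forall w : D, mdist z w < d -> `|rho z - rho w| < e.
Proof.
move=> e0; have [r r0 rP] := invf_continuous_near (defect_gt0 z) e0.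
exists (r / 2); first by rewrite divr_gt0.
move=> w zw; apply: rP; apply: le_lt_trans (defect_lip z w) _.
by rewrite mdist_disk in zw; lra.
Qed.

Lemma hyperbolic_density_gt0 (z : D) : 0 < rho z.
Proof. by rewrite invr_gt0; exact: defect_gt0. Qed.

(** With [Phi = id] the cost of a unit speed geodesic is its parameter. The tolerance handed to
    [chordB_density] is [e * q], because the density then divides by [q]. *)
Lemma geodesic_cost_path (x y : D) : exists g : R -> D,
  [/\ g 0 = x, g (hdist x y) = y & cost_path rho (hdist x y) g id].
Proof.
have [g [gx gy gd]] := geodesic_line x y; exists g; split => //.
split; first exact: hdist_ge0.
  by exists 1 => s t; rewrite mul1r.
move=> z zT e e0; have q0 := defect_gt0 (g z).
have [r r0 rP] := chordB_density (g z) (mulr_gt0 e0 q0).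
have [d d0 dP] := @chordB_near R r r0.
exists d => // s t s0 st tT zs tz.
have zsB : chordB (g z) (g s) < r.
  by apply: dP; rewrite gd ltr_norml; apply/andP; split; lra.
have ztB : chordB (g z) (g t) < r.
  by apply: dP; rewrite gd ltr_norml; apply/andP; split; lra.
have := rP _ _ zsB ztB; rewrite gd distrC ger0_norm ?subr_ge0// => h.
rewrite mdist_disk -[rho (g z)]/((defect (g z))^-1) mulrC ler_pdivrMr//.
by apply: le_trans h _; rewrite le_eqVlt; apply/orP; left; apply/eqP; ring.
Qed.

Lemma disk_rconn (x y : D) : exists a b g,
  [/\ rectifiable a b g, g a = x & g b = y].
Proof.
have [g [gx gy cp]] := geodesic_cost_path x y.
exists 0, (hdist x y), g; split => //.
exact: (cost_path_rectifiable hyperbolic_density_gt0 cp).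
Qed.

(** Upper bound: a geodesic costs [hdist x y]. Lower bound: by the triangle inequality and
    [hdist_density], [hdist x] is locally Lipschitz with constant the density, as [path_dist_ge]
    requires. *)
Lemma hyperbolic_distE : @hyperbolic_dist R = @hdist R.
Proof.
apply/funext => x; apply/funext => y; apply/le_anti/andP; split.
  have [g [gx gy cp]] := geodesic_cost_path x y.
  have := path_dist_cost hyperbolic_density_continuous hyperbolic_density_gt0 cp.
  by rewrite gx gy subr0.
have := @path_dist_ge R D rho hyperbolic_density_continuous
  hyperbolic_density_gt0 disk_rconn (hdist x) x y.
rewrite hdistxx subr0; apply => z e e0.
have [r r0 rP] := hdist_density z e0; exists r => // w zw.
apply: le_trans (rP z w _ zw); last by rewrite /chordB subrr Normc.normc0.
have := hdist_triangle z x w; have := hdist_triangle w x z.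
by rewrite (hdistC w z) ler_norml => ? ?; apply/andP; split; lra.
Qed.

End hyperbolic.

(** * Proper spaces, and thin triangles from the four-point condition *)

Section hyperbolicity.
Context {R : realType} {M : metricType R}.

Lemma compact_complete_set (K : set M) : compact K -> complete_set K.
Proof.
move=> cK F PF FK Fc; have [p [Kp clp]] := cK F PF FK.
exists p => //; apply/metricType_numDomainType.fcvgrPdist_lt => e e0.
have e2 : 0 < e / 2 by rewrite divr_gt0.
have /cauchyP/(_ _ e2)[c Fc2] := Fc.
have e4 : 0 < e / 4 by rewrite divr_gt0.
have /cauchyP/(_ _ e4)[c' Fc4] := Fc.
have [z [cz pz]] := clp _ _ Fc4 (nbhsx_ballx p _ e4).
apply: filterS Fc4 => w; rewrite !ballEmdist /= in cz pz * => cw.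
have := metric_triangle p z w; have := metric_triangle z c' w.
rewrite (metric_sym z c'); lra.
Qed.

Hypothesis proper : forall (z : M) K, compact [set w | mdist z w <= K].

Lemma proper_complete : complete_space M.
Proof.
move=> F PF _ Fc; have /cauchyP/(_ _ (@ltr01 R))[c Fc1] := Fc.
have [|x _ Fx] := @compact_complete_set _ (@proper c 1) F PF _ Fc; last by exists x.
by apply: filterS Fc1 => w; rewrite ballEmdist => /ltW.
Qed.

Lemma proper_locally_compact : locally_compact [set: M].
Proof.
move=> x _; rewrite withinET; exists [set w | mdist x w <= 1].
  by apply/nbhs_ballP; exists 1 => //= w; rewrite ballEmdist => /ltW.
split; first exact: proper.
by apply: compact_closed; [exact: metric_hausdorff|exact: proper].
Qed.

Variable k : R.
Hypothesis four_points : forall x y z w : M,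
  mdist x z + mdist y w <=
    Num.max (mdist x y + mdist z w) (mdist x w + mdist y z) + k.

Lemma geodesic_pathP (x y : M) g t : geodesic_path x y g -> 0 <= t <= mdist x y ->
  mdist x (g t) = t /\ mdist (g t) y = mdist x y - t.
Proof.
move=> [g0 g1 gd] tT; have [t0 t1] := andP tT; split.
  rewrite -g0 gd ?in_itv/= ?lexx ?mdist_ge0//.
  by rewrite sub0r normrN ger0_norm.
rewrite -{1}g1 gd ?in_itv/= ?lexx ?mdist_ge0//.
by rewrite distrC ger0_norm ?subr_ge0.
Qed.

(** Up to the Gromov product of [y] and [z] at [x], two geodesics from [x] stay close. The
    four-point condition for [y, z, r, x] gives [mdist y r <= mdist x y - t + k]; for [p, y, r, x]
    it then gives the claim, each use costing one [k]. *)
Lemma fellow_travel (x y z p r : M) t : 0 <= t ->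
  2 * t <= mdist x y + mdist x z - mdist y z ->
  mdist x p = t -> mdist p y = mdist x y - t ->
  mdist x r = t -> mdist r z = mdist x z - t -> mdist p r <= 2 * k.
Proof.
move=> t0 tg xp py xr rz.
(* The degenerate quadruple shows that [k] is nonnegative. *)
have := four_points x x x x; rewrite mdistxx add0r maxxx add0r => k0.
have := four_points p y r x; have := four_points y z r x.
rewrite (metric_sym z r) rz (metric_sym z x) (metric_sym r x) xr py.
rewrite (metric_sym p x) xp (metric_sym y x).
case: (leP (mdist y z + t) (mdist x y + (mdist x z - t))) => ? h;
  case: (leP (mdist x y - t + t) (t + mdist y r)) => ?; lra.
Qed.

(** The side [[x, y]] is cut at the Gromov product of [y] and [z] at [x]: points before the cut are
    compared with [[z, x]] as seen from [x], points after it with [[y, z]] as seen from [y]. *)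
Lemma four_points_thin x y z gxy gyz gzx :
  geodesic_path x y gxy -> geodesic_path y z gyz -> geodesic_path z x gzx ->
  forall p : M, (gxy @` `[0, mdist x y]) p ->
  exists2 r, ((gyz @` `[0, mdist y z]) `|` (gzx @` `[0, mdist z x])) r &
    mdist p r <= 2 * k.
Proof.
move=> hxy hyz hzx _ [t /= + <-]; rewrite in_itv /= => txy.
have [t0 tT] := andP txy.
have [xp py] := geodesic_pathP hxy txy.
have t1 := metric_triangle x y z; have t2 := metric_triangle y x z.
have t3 := metric_triangle x z y.
rewrite (metric_sym y x) in t2; rewrite (metric_sym z y) in t3.
have [ht|ht] := leP (2 * t) (mdist x y + mdist x z - mdist y z).
  have tzx : 0 <= mdist z x - t <= mdist z x.
    by rewrite (metric_sym z x); apply/andP; split; lra.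
  have [zr rx] := geodesic_pathP hzx tzx.
  exists (gzx (mdist z x - t)); first by right; exists (mdist z x - t); rewrite /= ?in_itv.
  apply: (@fellow_travel x y z _ _ t) => //.
  - by rewrite metric_sym rx; lra.
  - by rewrite metric_sym zr (metric_sym z x).
have tyz : 0 <= mdist x y - t <= mdist y z by apply/andP; split; lra.
have [yr rz] := geodesic_pathP hyz tyz.
exists (gyz (mdist x y - t)); first by left; exists (mdist x y - t); rewrite /= ?in_itv.
apply: (@fellow_travel y x z _ _ (mdist x y - t)) => //.
- by lra.
- by rewrite (metric_sym y x); lra.
- by rewrite metric_sym.
- by rewrite metric_sym xp (metric_sym y x); lra.
Qed.

End hyperbolicity.

(** * Uniformization of a geodesic space *)

Section uniformization.
Local Open Scope quotient_scope.
Context {R : realType} {M : metricType R}.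
Variables (eps : R) (z0 : M).
Hypothesis eps_gt0 : 0 < eps.
Hypothesis geodesicM : forall x y : M, exists gamma, geodesic_path x y gamma.

Definition expo (z : M) : R := expR (- (eps * mdist z z0)).
Local Notation rho := expo.
Local Notation de := (uniformized_dist eps z0).

Lemma expRN_sub_le (a b : R) : 0 <= a -> a <= b ->
  expR (- a) - expR (- b) <= b - a.
Proof.
move=> a0 ab.
have -> : expR (- b) = expR (- a) * expR (- (b - a)).
  by rewrite -expRD; congr expR; ring.
have : expR (- a) <= 1 by rewrite expR_le1 oppr_le0.
have := expR_ge0 (- a); have := expR_ge1Dx (- (b - a)).
have : expR (- (b - a)) <= 1 by rewrite expR_le1 oppr_le0 subr_ge0.
set E := expR (- a); set F := expR (- (b - a)) => F1 F2 E0 E1; nra.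
Qed.

Lemma expo_lip z w : `|rho z - rho w| <= eps * mdist z w.
Proof.
wlog zw : z w / mdist z z0 <= mdist w z0.
  move=> H; have [/H//|/ltW/H] := leP (mdist z z0) (mdist w z0).
  by rewrite distrC metric_sym.
have e1 : eps * mdist z z0 <= eps * mdist w z0 by rewrite ler_pM2l.
rewrite ger0_norm; last first.
  by rewrite subr_ge0 ler_expR lerN2.
apply: le_trans (expRN_sub_le _ e1) _.
  by rewrite mulr_ge0 ?mdist_ge0// ltW.
rewrite -mulrBr ler_pM2l//.
by have := metric_triangle w z z0; rewrite (metric_sym w z); lra.
Qed.

Lemma expo_continuous z (e : R) : 0 < e -> exists2 d, 0 < d &
  forall w : M, mdist z w < d -> `|rho z - rho w| < e.
Proof.
move=> e0; exists (e / eps); first by rewrite divr_gt0.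
move=> w; rewrite ltr_pdivlMr// => h.
by apply: le_lt_trans (expo_lip z w) _; rewrite mulrC.
Qed.

Lemma expo_gt0 z : 0 < rho z. Proof. exact: expR_gt0. Qed.

Lemma expo_le1 z : rho z <= 1.
Proof. by rewrite expR_le1 oppr_le0 mulr_ge0 ?mdist_ge0// ltW. Qed.

Lemma geodesic_cost x y : exists g, [/\ g 0 = x, g (mdist x y) = y &
  cost_path rho (mdist x y) g id].
Proof.
have [g [gx gy gd]] := geodesicM x y; exists g; split => //.
split; first exact: mdist_ge0.
  by exists 1 => *; rewrite mul1r.
move=> z _ e e0; exists 1 => // s t s0 st tT _ _.
rewrite gd ?in_itv/= ?s0 ?(le_trans s0 st) ?tT ?(le_trans st tT)//.
rewrite distrC ger0_norm ?subr_ge0//.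
apply: (@le_trans _ _ (t - s)).
  by rewrite ler_piMl ?subr_ge0// expo_le1.
by rewrite lerDl mulr_ge0 ?subr_ge0// ltW.
Qed.

Lemma geodesic_rconn (x y : M) : exists a b g,
  [/\ rectifiable a b g, g a = x & g b = y].
Proof.
have [g [gx gy cp]] := geodesic_cost x y.
by exists 0, (mdist x y), g; split => //; exact: (cost_path_rectifiable expo_gt0 cp).
Qed.

Lemma uniformized_metric : is_metric de.
Proof. exact: (path_dist_metric expo_continuous expo_gt0 geodesic_rconn). Qed.

Lemma uniformized_le x y : de x y <= mdist x y.
Proof.
have [g [gx gy cp]] := geodesic_cost x y.
by have := path_dist_cost expo_continuous expo_gt0 cp; rewrite gx gy subr0.
Qed.

(** On the unit ball about [x] the weight is at least its value one unit farther from the base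
    point. *)
Lemma uniformized_ge x y :
  expR (- (eps * (mdist x z0 + 1))) * Num.min 1 (mdist x y) <= de x y.
Proof.
apply: (path_dist_ge_ball expo_continuous expo_gt0 geodesic_rconn) => //.
move=> z xz; rewrite ler_expR lerN2 ler_pM2l//.
by have := metric_triangle z x z0; rewrite (metric_sym z x); lra.
Qed.

Lemma uniformized_cost T g Phi : cost_path rho T g Phi ->
  de (g 0) (g T) <= Phi T - Phi 0.
Proof. exact: (path_dist_cost expo_continuous expo_gt0). Qed.

Lemma uniformized_ge_fun (phi : M -> R) x y :
  (forall z e, 0 < e -> exists2 d, 0 < d & forall w, mdist z w < d ->
    `|phi z - phi w| <= (rho z + e) * mdist z w) -> phi y - phi x <= de x y.
Proof. exact: (path_dist_ge expo_continuous expo_gt0 geodesic_rconn). Qed.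

(** * Completeness and boundary of the uniformized space *)

Variable hMe : is_metric de.
Let Me : metricType R := metrized hMe.

Lemma mdist_uniformized (x y : Me) : mdist x y = de x y. Proof. by []. Qed.

Hypothesis completeM : complete_space M.

(** On a ball of [M], [uniformized_ge] makes every filter that is Cauchy for the uniformized
    distance Cauchy for the original one; the limit in [M] is also a limit for the smaller
    uniformized distance. *)
Lemma complete_uniformized_ball K : complete_set [set z : Me | mdist (z : M) z0 <= K].
Proof.
move=> F PF FK Fc.
pose c := expR (- (eps * (K + 1))).
have c0 : 0 < c by exact: expR_gt0.
have FcM : @cauchy M F.
  apply: cauchy_exP => e e0.
  pose n := c * Num.min 1 e / 2.
  have n0 : 0 < n by rewrite divr_gt0// mulr_gt0// lt_min ltr01.
  have /cauchyP/(_ n n0)[x Fx] := Fc.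
  have [y [xy yK]] := filter_ex (filterI Fx FK).
  exists y; apply: filterS Fx => w; rewrite !ballEmdist /= in xy * => xw.
  have yw : de y w < c * Num.min 1 e.
    have := metric_triangle (y : Me) x w; rewrite (metric_sym (y : Me) x).
    rewrite !mdist_uniformized in xy xw *.
    by move: xy xw; rewrite /n; lra.
  have := uniformized_ge y w.
  have : c <= expR (- (eps * (mdist (y : M) z0 + 1))).
    by rewrite ler_expR lerN2 ler_pM2l// lerD2r.
  set c' := expR _ => cc' h.
  rewrite ltNge; apply/negP => ew.
  have : c * Num.min 1 e <= c' * Num.min 1 (mdist (y : M) w).
    apply: ler_pM => //; first exact: ltW.
      by rewrite le_min ler01 ltW.
    by rewrite le_min !ge_min lexx ew orbT.
  by move: yw h; lra.
have [p _ Fp] := completeM PF filterT FcM.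
have pK : mdist p z0 <= K.
  apply/ler_addgt0Pr => e e0.
  have Fe : F (ball p e) := Fp _ (nbhsx_ballx p e e0).
  have [w [/= pw wK]] := filter_ex (filterI Fe FK).
  rewrite ballEmdist /= in pw.
  have := metric_triangle p w z0; lra.
exists p => //; apply/(@metricType_numDomainType.fcvgrPdist_lt R Me) => e e0.
have Fe : F (ball p e) := Fp _ (nbhsx_ballx p e e0).
apply: filterS Fe => w; rewrite ballEmdist /=; apply: le_lt_trans.
exact: uniformized_le.
Qed.

Lemma uniformized_near (x : M) (e : R) : 0 < e -> exists2 d, 0 < d &
  forall y, de x y < d -> mdist x y < e.
Proof.
move=> e0; set c := expR (- (eps * (mdist x z0 + 1))).
have c0 : 0 < c by exact: expR_gt0.
exists (c * Num.min 1 e); first by rewrite mulr_gt0// lt_min ltr01.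
move=> y xy; have := le_lt_trans (uniformized_ge x y) xy.
rewrite -/c ltr_pM2l//; case: (leP 1 (mdist x y)) => h.
  by rewrite lt_min ltxx.
by rewrite lt_min => /andP[].
Qed.

Lemma locally_complete_uniformized : locally_complete Me.
Proof.
move=> x; exists [set z : Me | mdist (z : M) z0 <= mdist (x : M) z0 + 1].
  have [d d0 dP] := uniformized_near (x : M) (@ltr01 R).
  apply/nbhs_ballP; exists d => //= w; rewrite ballEmdist /= => /dP xw.
  have := metric_triangle (w : M) x z0; rewrite (metric_sym (w : M) x); lra.
exact: complete_uniformized_ball.
Qed.

(** Leaving a unit ball centred in the ball of radius [K] costs at least [c]. Once the tail
    oscillates by less than [c], a single return to radius [K] confines it to radius [K + 1], where
    completeness holds. *)
Lemma cauchy_bounded_cvg (x : cauchy_sequence Me) K :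
  (forall N, exists2 n, (N <= n)%N & mdist (x n : M) z0 <= K) ->
  exists p : M, x n @[n --> \oo] --> (p : Me).
Proof.
move=> freq.
pose c := expR (- (eps * (K + 1))).
have c0 : 0 < c by exact: expR_gt0.
have [N xN] := cseq_near x c0.
have [n Nn nK] := freq N.
have bd m : (N <= m)%N -> mdist (x m : M) z0 <= K + 1.
  move=> Nm; have := xN n m Nn Nm; rewrite mdist_uniformized => h.
  have := le_lt_trans (uniformized_ge (x n) (x m)) h.
  have : c <= expR (- (eps * (mdist (x n : M) z0 + 1))).
    by rewrite ler_expR lerN2 ler_pM2l// lerD2r.
  set c' := expR _ => cc'; case: (leP 1 (mdist (x n : M) (x m))) => h1.
    by rewrite mulr1; lra.
  have := metric_triangle (x m : M) (x n) z0.
  by rewrite (@metric_sym R M (x m) (x n)); lra.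
have [|p _ xp] := @complete_uniformized_ball (K + 1) (x @ \oo) _ _ (cseqP x).
  by exists N.
by exists p.
Qed.

(** Otherwise the sequence returns infinitely often to some ball, hence converges in [M], and its
    class is the image of the limit rather than a boundary point. *)
Lemma boundary_unbounded (x : cauchy_sequence Me) :
  boundary (\pi_{eq_quot (@cequiv_equiv R Me)} x : completion Me) ->
  forall K, exists N, forall n, (N <= n)%N -> K < mdist (x n : M) z0.
Proof.
move=> bx K; apply: contrapT => /forallNP h.
have [|p xp] := @cauchy_bounded_cvg x K.
  move=> N; have /existsNP[n /not_implyP[Nn /negP]] := h N.
  by rewrite -leNgt => ?; exists n.
move: bx; apply; exists (p : Me) => //.
apply: mdist_positivity; rewrite completion_distE /cdist /=.
apply: cvg_lim => //; apply/cvgrPdist_lt => e e0.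
have := xp _ (nbhsx_ballx (p : Me) e e0); rewrite /= nearE.
apply: (@filterS _ \oo _ (fun n => ball (p : Me) e (x n))) => n.
by rewrite ballEmdist /= sub0r normrN ger0_norm ?mdist_ge0.
Qed.

Lemma le_edist (c : R) (x y : completion Me) : c <= mdist x y ->
  (c%:E <= edist (x, y))%E.
Proof.
move=> cxy; apply: le_ereal_inf_tmp => _ [r [r0 /=]] + <-.
by rewrite ballEmdist /= => xy; rewrite lee_fin; exact: le_trans cxy (ltW xy).
Qed.

Lemma edist_le (c : R) (x y : completion Me) : mdist x y <= c ->
  (edist (x, y) <= c%:E)%E.
Proof.
move=> xyc; apply/lee_addgt0Pr => e e0; rewrite -EFinD; apply: edist_fin => /=.
  by have := mdist_ge0 x y; lra.
by rewrite ballEmdist /=; lra.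
Qed.

(** A representative of a boundary point eventually has distance more than [K] from the base point,
    so a bound for far away points passes to the limit. *)
Lemma boundary_dist_ge (z : M) (c : R) :
  (forall e, 0 < e -> exists K, forall w : M, K < mdist w z0 -> c - e <= de z w) ->
  (c%:E <= edist_inf (@boundary R Me) (to_completion (z : Me)))%E.
Proof.
move=> H; apply: le_ereal_inf_tmp => _ [p bp <-]; apply: le_edist.
rewrite -[p](@reprK _ {eq_quot (@cequiv_equiv R Me)}) in bp *.
set x := repr _ in bp *.
apply/ler_addgt0Pr => e e0; rewrite -lerBlDr.
have [K KP] := H e e0; have [N xN] := boundary_unbounded bp K.
rewrite completion_distE /cdist /=; apply: limr_ge.
  exact: (@is_cvg_cdist _ _ (CauchySequence (cauchy_cst (z : Me))) x).
by exists N => // n /= Nn; apply: KP; exact: xN.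
Qed.

Variable ray : R -> M.
Hypothesis ray0 : forall t, 0 <= t -> mdist (ray t) z0 = t.
Hypothesis rayP : forall s t, 0 <= s -> s <= t -> mdist (ray s) (ray t) <= t - s.

Lemma ray_cost s t : 0 <= s -> s <= t ->
  de (ray s) (ray t) <= expR (- (eps * s)) / eps.
Proof.
move=> s0 st.
(* A primitive of the weight [expR (- (eps * (s + u)))] along the ray; the final bound is the
   integral of the weight to infinity. *)
pose Phi u := - expR (- (eps * (s + u))) / eps.
have PhiB u v : Phi v - Phi u = (expR (- (eps * (s + u))) - expR (- (eps * (s + v)))) / eps.
  by rewrite /Phi -mulrBl; congr (_ / _); ring.
have cp : cost_path rho (t - s) (fun u => ray (s + u)) Phi.
  split; first by rewrite subr_ge0.
    exists 1 => u v u0 uv vT; rewrite PhiB ler_pdivrMr// mul1r.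
    apply: le_trans (expRN_sub_le _ _) _.
    - by rewrite mulr_ge0 ?addr_ge0// ltW.
    - by rewrite ler_pM2l// lerD2l.
    - by lra.
  move=> x /andP[x0 xT] e e0; exists (e / eps); first by rewrite divr_gt0.
  move=> u v u0 uv vT xu vx.
  rewrite /expo ray0 ?addr_ge0// PhiB.
  have v0 := le_trans u0 uv.
  have h1 : expR (- (eps * (s + v))) * (v - u) <=
      (expR (- (eps * (s + u))) - expR (- (eps * (s + v)))) / eps.
    rewrite ler_pdivlMr//.
    have -> : expR (- (eps * (s + u))) =
        expR (- (eps * (s + v))) * expR (eps * (v - u)).
      by rewrite -expRD; congr expR; ring.
    have := expR_ge1Dx (eps * (v - u)); have := expR_ge0 (- (eps * (s + v))).
    set E := expR _; set F := expR _ => E0 F1; nra.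
  (* By monotonicity the increment of [Phi] controls the weight at the far end [v], whereas
     [cost_path] asks for the weight at [x]; for [v - x < e / eps] the two differ by at most [e]. *)
  have h2 : expR (- (eps * (s + x))) <= expR (- (eps * (s + v))) + e.
    have [xv|vx'] := leP v x.
      rewrite ler_wpDr ?(ltW e0)// ler_expR lerN2 ler_pM2l//; lra.
    have := @expRN_sub_le (eps * (s + x)) (eps * (s + v)).
    rewrite mulr_ge0 ?addr_ge0 ?(ltW eps_gt0)// ler_pM2l// lerD2l ltW//.
    move=> /(_ isT isT); rewrite -mulrBr.
    have : eps * (v - x) <= e by rewrite mulrC -ler_pdivlMr//; lra.
    lra.
  have h3 := rayP (addr_ge0 s0 u0) (_ : s + u <= s + v).
  have {}h3 : mdist (ray (s + u)) (ray (s + v)) <= v - u.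
    by apply: le_trans (h3 _) _; rewrite ?lerD2l//; lra.
  apply: le_trans (_ : (expR (- (eps * (s + v))) + e) * (v - u) <= _).
    by apply: ler_pM => //; exact: mdist_ge0.
  by rewrite mulrDl lerD2r.
have := uniformized_cost cp; rewrite addr0 subrKC PhiB addr0 subrKC => h.
apply: le_trans h _; rewrite ler_pM2r ?invr_gt0//.
by have := expR_ge0 (- (eps * t)); lra.
Qed.

Lemma expRN_small (e : R) : 0 < e -> exists N, forall n, (N <= n)%N ->
  expR (- (eps * n%:R)) / eps < e.
Proof.
move=> e0; pose N := (Num.truncn (1 / (e * eps * eps))).+1; exists N => n Nn.
have nN : 1 / (e * eps * eps) < n%:R.
  by apply: lt_le_trans (truncnS_gt _) _; rewrite ler_nat.
rewrite ltr_pdivrMr// expRN.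
have h : 1 / (e * eps) < eps * n%:R.
  move: nN; rewrite !ltr_pdivrMr ?mulr_gt0//; nra.
have h' : 1 / (e * eps) < expR (eps * n%:R).
  by apply: lt_trans h _; have := expR_ge1Dx (eps * n%:R); lra.
rewrite invf_plt ?posrE ?expR_gt0 ?mulr_gt0//.
by rewrite -div1r.
Qed.

Lemma ray_cauchy : cauchy ((fun n : nat => ray n%:R : Me) @ \oo).
Proof.
apply: cauchy_exP => e e0; have [N NP] := expRN_small e0.
exists (ray N%:R : Me); exists N => // n /= Nn; rewrite ballEmdist /=.
apply: le_lt_trans (NP N (leqnn N)); apply: ray_cost => //.
by rewrite ler_nat.
Qed.

Definition ray_end : completion Me :=
  \pi_{eq_quot (@cequiv_equiv R Me)} (CauchySequence ray_cauchy).

Lemma ray_not_cvg (p : M) : ~ ((fun n : nat => ray n%:R : Me) @ \oo --> (p : Me)).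
Proof.
move=> h; have [d d0 dP] := uniformized_near p (@ltr01 R).
have [N _ NP] := h _ (nbhsx_ballx (p : Me) d d0).
pose n := maxn N (Num.truncn (mdist p z0 + 1)).+1.
have := NP n (leq_maxl _ _); rewrite /= ballEmdist => /dP pn.
have : mdist p z0 + 1 < n%:R.
  by apply: lt_le_trans (truncnS_gt _) _; rewrite ler_nat leq_maxr.
have := metric_triangle (ray n%:R) p z0; rewrite ray0// (metric_sym _ p); lra.
Qed.

Lemma uniformized_not_complete : ~ complete_space Me.
Proof.
move=> cM; have [p _] := cM _ _ filterT ray_cauchy.
exact: ray_not_cvg.
Qed.

Lemma ray_end_boundary : boundary ray_end.
Proof.
move=> [p _ /esym pE]; apply: (@ray_not_cvg p).
have : cdist (CauchySequence ray_cauchy) (CauchySequence (cauchy_cst (p : Me))) = 0.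
  by rewrite -completion_distE -/ray_end pE mdistxx.
rewrite /cdist => E.
have := @is_cvg_cdist _ _ (CauchySequence ray_cauchy) (CauchySequence (cauchy_cst (p : Me))).
move=> /cvg_ex[l lP]; have l0 : l = 0.
  by rewrite -E; apply/esym/cvg_lim.
rewrite l0 in lP.
apply/(metricType_numDomainType.cvgrPdist_lt _ (p : Me)) => e e0.
have := lP _ (nbhsx_ballx (0 : R) e e0); rewrite /= nearE.
apply: (@filterS _ \oo _ (fun n => ball (0 : R) e (mdist (ray n%:R : Me) (p : Me)))) => n.
by rewrite /ball /= sub0r normrN ger0_norm ?mdist_ge0// metric_sym.
Qed.

(** The end of the ray is one boundary point, and the distance to it is the limit of the distances
    to points of the ray. *)
Lemma boundary_dist_le (z : M) (c : R) :
  (forall e, 0 < e -> exists N, forall n, (N <= n)%N -> de z (ray n%:R) <= c + e) ->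
  (edist_inf (@boundary R Me) (to_completion (z : Me)) <= c%:E)%E.
Proof.
move=> H; apply: (@le_trans _ _ (edist (to_completion (z : Me), ray_end))).
  by apply: ereal_inf_lbound; exists ray_end => //; exact: ray_end_boundary.
apply: edist_le; apply/ler_addgt0Pr => e e0; have [N NP] := H e e0.
rewrite completion_distE /cdist /=; apply: limr_le.
  exact: (@is_cvg_cdist _ _ (CauchySequence (cauchy_cst (z : Me))) (CauchySequence ray_cauchy)).
by exists N => // n /= Nn; exact: NP.
Qed.

End uniformization.

(** * Circles *)

Section circle.
Context {R : realType}.
Local Notation normc := Normc.normc.
Local Open Scope complex_scope.
Implicit Types a b t : R.

Lemma sin_mvt h : 0 <= h -> exists2 c : R, 0 <= c <= h & sin h = cos c * h.
Proof.
move=> h0.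
have [|c] := @MVT_segment R sin cos 0 h h0.
  by apply: continuous_subspaceT; exact: continuous_sin.
by rewrite in_itv/= sin0 !subr0 => ch E; exists c.
Qed.

Lemma norm_sin_le (x : R) : `|sin x| <= `|x|.
Proof.
wlog x0 : x / 0 <= x.
  move=> H; have [/H//|/ltW] := leP 0 x.
  by rewrite -oppr_ge0 => /H; rewrite sinN !normrN.
have [c _ ->] := sin_mvt x0.
by rewrite normrM ler_piMl// cos_max.
Qed.

Lemma sin_ge_near (e : R) : 0 < e -> exists2 d : R, 0 < d &
  forall h, 0 <= h -> h < d -> (1 - e) * h <= sin h.
Proof.
move=> e0; have := @continuous_cos R 0 => /cvgrPdist_lt/(_ e e0).
move=> /nbhs_ballP[d /= d0 dP]; exists d => // h h0 hd.
have [c /andP[c0 ch] ->] := sin_mvt h0; rewrite ler_wpM2r//.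
have : `|cos 0 - cos c| < e.
  by apply: dP; rewrite /ball /= sub0r normrN ger0_norm//; lra.
by rewrite cos0 ltr_norml; lra.
Qed.

Definition cis a : R[i] := cos a +i* sin a.

Lemma normc_cis a : normc (cis a) = 1.
Proof. by rewrite /= cos2Dsin2 sqrtr1. Qed.

Lemma cis0 : cis 0 = 1. Proof. by rewrite /cis cos0 sin0. Qed.

Lemma cis2pi : cis (2 * pi) = 1.
Proof. by rewrite mulr_natl /cis cos2pi sin2pi. Qed.

Lemma cispi : cis pi = -1.
Proof. by apply/eqP; rewrite eq_complex /= cospi sinpi oppr0 !eqxx. Qed.

Lemma normc_cisB a b : normc (cis a - cis b) = 2 * `|sin ((a - b) / 2)|.
Proof.
apply/eqP; rewrite -(@eqrXn2 _ 2)// ?normc_ge0// ?mulr_ge0//.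
rewrite exprMn -normrX (ger0_norm (sqr_ge0 _)).
have -> : cis a - cis b = (cos a - cos b) +i* (sin a - sin b).
  by apply/eqP; rewrite eq_complex /= !eqxx.
rewrite sqr_normcE; apply/eqP.
have E : cos (a - b) = 1 - 2 * sin ((a - b) / 2) ^+ 2.
  rewrite [in LHS](splitr (a - b)) cosD -!expr2.
  by have := cos2Dsin2 ((a - b) / 2); lra.
move: E; rewrite cosB.
have := cos2Dsin2 a; have := cos2Dsin2 b; rewrite -[sin _ ^+ 2]/(sin _ ^+ 2).
set x := cos a; set y := sin a; set z := cos b; set w := sin b.
nra.
Qed.

Lemma normc_cisB_le a b : normc (cis a - cis b) <= `|a - b|.
Proof.
rewrite normc_cisB; have := norm_sin_le ((a - b) / 2).
by rewrite normrM (ger0_norm (_ : 0 <= 2^-1 :> R))//; lra.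
Qed.

Lemma cisP (u : R[i]) : normc u = 1 -> exists2 t, 0 <= t <= 1 & u = cis (2 * pi * t).
Proof.
case: u => a b u1; have ab : a ^+ 2 + b ^+ 2 = 1 by rewrite -sqr_normcE u1 expr1n.
have pi0 : 0 < pi :> R := pi_gt0 R.
have a1 : -1 <= a <= 1 by apply/andP; split; nra.
have c0 := acos_ge0 a1; have cpi := acos_lepi a1.
have ca : cos (acos a) = a by rewrite acosK.
have sa : sin (acos a) = `|b|.
  rewrite sin_acos// (_ : 1 - a ^+ 2 = b ^+ 2); last by lra.
  by rewrite sqrtr_sqr.
have K0 : 2 * pi != 0 :> R by rewrite lt0r_neq0// mulr_gt0.
have [b0|b0] := leP 0 b.
  exists (acos a / (2 * pi)).
    by rewrite divr_ge0 ?mulr_ge0 ?(ltW pi0)//= ler_pdivrMr ?mulr_gt0//; lra.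
  by rewrite mulrC divfK// /cis ca sa ger0_norm.
(* Lower half circle: [acos] only sees the real part, so the angle is [2 * pi - acos a]. *)
exists (1 - acos a / (2 * pi)).
  have : acos a / (2 * pi) <= 1 by rewrite ler_pdivrMr ?mulr_gt0//; lra.
  have : 0 <= acos a / (2 * pi) by rewrite divr_ge0 ?mulr_ge0 ?(ltW pi0).
  by lra.
rewrite mulrBr mulr1 [2 * pi * _]mulrC divfK// /cis mulr_natl.
by rewrite cosB sinB cos2pi sin2pi ca sa ltr0_norm//; congr Complex; ring.
Qed.

Lemma hdist_arc a b t : hdist (radial (normc_cis a) t) (radial (normc_cis b) t) <=
  ch t ^+ 2 / 4 * (`|th t| * normc (cis a - cis b)).
Proof.
apply: le_trans (hdist_le _ _) _; rewrite gmean_radial ?defect_radial//.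
have -> : chordB (radial (normc_cis a) t) (radial (normc_cis b) t) =
    `|th t| * normc (cis a - cis b).
  by rewrite -normc_real -Normc.normcM mulrBr.
rewrite le_eqVlt; apply/orP; left; apply/eqP; field.
by rewrite lt0r_neq0 ?ch_gt0.
Qed.

(** Double angle formula for the hyperbolic sine; it produces the exponents in the length of a
    hyperbolic circle. *)
Lemma ch_th t : ch t ^+ 2 * th t = expR (2 * t) - expR (- (2 * t)).
Proof.
have -> : 2 * t = t + t by ring.
rewrite opprD !expRD /th /ch; have := expR_gt0 t; have := expR_gt0 (- t).
by move=> ? ?; field; rewrite lt0r_neq0// addr_gt0.
Qed.

(** The growth [expR (2 * t)] of arcs is what the weight [expR (- (eps * t))] has to beat, whence
    the threshold [eps = 2]. *)
Lemma hdist_arc_le a b t : 0 <= t ->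
  hdist (radial (normc_cis a) t) (radial (normc_cis b) t) <= expR (2 * t) / 4 * `|a - b|.
Proof.
move=> t0; apply: le_trans (hdist_arc a b t) _.
have th0 := th_ge0 t0; rewrite (ger0_norm th0).
have -> : ch t ^+ 2 / 4 * (th t * normc (cis a - cis b)) =
    (ch t ^+ 2 * th t) / 4 * normc (cis a - cis b) by ring.
apply: ler_pM => //.
- by rewrite divr_ge0// mulr_ge0 ?sqr_ge0.
- exact: normc_ge0.
- by rewrite ch_th ler_pM2r ?invr_gt0//; have := expR_ge0 (- (2 * t)); lra.
- exact: normc_cisB_le.
Qed.

End circle.

(** * Scaled hyperbolic disks *)

Section scaled_disk.
Context {R : realType}.
Local Notation D := (disk R).
(** The distance is abstract and tied to [hdist] only by [distE], so that one section serves the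
    hyperbolic disk ([k = 1]) and the scaled one ([k = 2 / eps]). *)
Variables (k : R) (dist : D -> D -> R) (hM : is_metric dist).
Hypothesis k_gt0 : 0 < k.
Hypothesis distE : forall z w, dist z w = k * hdist z w.
Let M : metricType R := metrized hM.

Lemma mdist_scaled (z w : M) : mdist z w = k * hdist z w.
Proof. exact: distE. Qed.

Lemma scaled_geodesic (x y : M) : exists gamma, geodesic_path x y gamma.
Proof.
have [g [gx gy gd]] := geodesic_line (x : D) y.
exists (fun t => g (t / k)); split.
- by rewrite mul0r.
- by rewrite mdist_scaled mulrC mulKf// lt0r_neq0.
move=> s t _ _; rewrite mdist_scaled gd -mulrBl normrM.
rewrite (ger0_norm (_ : 0 <= k^-1)); last by rewrite invr_ge0 ltW.
by rewrite mulrCA divff ?mulr1// lt0r_neq0.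
Qed.

Definition scaled_ray (t : R) : M := radial (Normc.normc1 R) (t / k).

Lemma scaled_ray_dist s t : mdist (scaled_ray s) (scaled_ray t) = `|s - t|.
Proof.
rewrite mdist_scaled hdist_radial -mulrBl normrM.
rewrite (ger0_norm (_ : 0 <= k^-1)); last by rewrite invr_ge0 ltW.
by rewrite mulrCA divff ?mulr1// lt0r_neq0.
Qed.

Lemma scaled_ray0 t : 0 <= t -> mdist (scaled_ray t) (disk0 : M) = t.
Proof.
move=> t0; have <- : scaled_ray 0 = disk0 by rewrite /scaled_ray mul0r radial0.
by rewrite scaled_ray_dist subr0 ger0_norm.
Qed.

Lemma scaled_rayP s t : 0 <= s -> s <= t ->
  mdist (scaled_ray s) (scaled_ray t) <= t - s.
Proof. by move=> _ st; rewrite scaled_ray_dist distrC ger0_norm ?subr_ge0. Qed.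

Lemma scaled_unbounded : unbounded_space M.
Proof.
move=> C; exists (scaled_ray (`|C| + 1)), (disk0 : M).
by rewrite scaled_ray0 ?addr_ge0//; have := ler_norm C; lra.
Qed.

(* Closed balls are closed subsets of images of rectangles in polar coordinates. *)
Lemma scaled_proper (z : M) (K : R) : compact [set w : M | mdist z w <= K].
Proof.
pose L := (`|K| + mdist z (disk0 : M)) / k.
have L0 : 0 <= L by rewrite divr_ge0 ?addr_ge0 ?mdist_ge0// ltW.
(* A Lipschitz constant of the polar map in its angle parameter for radii up to [L], from
   [hdist_arc_le]. *)
pose C : R := expR (2 * L) / 4 * (2 * pi).
have pi0 : 0 < pi :> R := pi_gt0 R.
have C0 : 0 < C by rewrite mulr_gt0 ?divr_gt0 ?mulr_gt0 ?expR_gt0.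
pose f (p : R * R) : M := radial (normc_cis (2 * pi * p.1)) p.2.
pose Q : set (R * R) := `[0, 1] `*` `[0, L].
have cQ : compact Q by apply: compact_setX; exact: segment_compact.
have cf : {within Q, continuous f}.
  apply/subspace_continuousP => -[a s] [/= _]; rewrite in_itv/= => /andP[s0 sL].
  apply/(@metricType_numDomainType.cvgrPdist_lt R M) => e e0.
  rewrite near_withinE; apply/nbhs_ballP.
  exists (e / (2 * k * (C + 1))); first by rewrite /= divr_gt0// !mulr_gt0// addr_gt0.
  move=> [b t] [/= ab st] [/= _]; rewrite in_itv/= => /andP[t0 tL].
  rewrite /ball /= in ab st.
  have K0 : 0 < 2 * k * (C + 1) by rewrite !mulr_gt0// addr_gt0.
  rewrite ltr_pdivlMr// in ab; rewrite ltr_pdivlMr// in st.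
  rewrite mdist_scaled /f /=.
  have h1 := hdist_triangle (radial (normc_cis (2 * pi * a)) t)
    (radial (normc_cis (2 * pi * a)) s) (radial (normc_cis (2 * pi * b)) t).
  rewrite hdist_radial in h1.
  have h2 := hdist_arc_le (2 * pi * a) (2 * pi * b) t0.
  have h3 : expR (2 * t) / 4 * `|2 * pi * a - 2 * pi * b| <= C * `|a - b|.
    rewrite -mulrBr normrM (ger0_norm (_ : 0 <= 2 * pi)); last by rewrite mulr_ge0// ltW.
    rewrite mulrA ler_wpM2r// ler_wpM2r ?mulr_ge0 ?(ltW pi0)// ler_pM2r ?invr_gt0//.
    by rewrite ler_expR ler_pM2l.
  have h4 : hdist (radial (normc_cis (2 * pi * a)) s)
      (radial (normc_cis (2 * pi * b)) t) <= `|s - t| + C * `|a - b| by lra.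
  apply: le_lt_trans (_ : k * (`|s - t| + C * `|a - b|) < e).
    by rewrite ler_pM2l.
  have := mulr_ge0 (ltW k_gt0) (mulr_ge0 (ltW C0) (normr_ge0 (s - t))).
  have := mulr_ge0 (ltW k_gt0) (normr_ge0 (a - b)).
  lra.
have cfQ := continuous_compact cf cQ.
apply: subclosed_compact cfQ _.
  move=> p clp; rewrite /=; apply/ler_addgt0Pr => e e0.
  have [w [/= zw pw]] := clp _ (nbhsx_ballx p e e0).
  rewrite ballEmdist /= in pw.
  by have := metric_triangle z w p; rewrite (metric_sym w p); lra.
move=> w /= zw; have [u [u1 wE]] := polarP (w : D).
have [t t01 uE] := cisP u1.
exists (t, hdist disk0 (w : D)).
  split; rewrite /= in_itv//= hdist_ge0/= ler_pdivlMr// mulrC -mdist_scaled.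
  have := metric_triangle (disk0 : M) z w; rewrite (metric_sym (disk0 : M) z).
  by have := ler_norm K; lra.
by rewrite /f /= [in RHS]wE; apply: val_inj; rewrite /= uE.
Qed.

Lemma scaled_complete : complete_space M.
Proof. exact: proper_complete scaled_proper. Qed.

Lemma scaled_four_points (x y z w : M) : mdist x z + mdist y w <=
  Num.max (mdist x y + mdist z w) (mdist x w + mdist y z) + k * ln 16.
Proof.
rewrite !mdist_scaled -!mulrDr -maxr_pMr ?(ltW k_gt0)// -mulrDr ler_pM2l//.
exact: hdist_four_points.
Qed.

Lemma scaled_gromov_hyperbolic : gromov_hyperbolic M.
Proof.
split; [exact: scaled_complete|exact: scaled_unbounded| |exact: scaled_geodesic|].
  exact: proper_locally_compact scaled_proper.
exists (2 * (k * ln 16)).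
  by rewrite !mulr_ge0 ?(ltW k_gt0)// ln_ge0// ler1n.
by move=> x y z gxy gyz gzx; exact: (four_points_thin scaled_four_points).
Qed.

Lemma scaled_uniformized_metric eps : 0 < eps ->
  is_metric (uniformized_dist eps (disk0 : M)).
Proof. by move=> eps0; exact: (uniformized_metric _ eps0 scaled_geodesic). Qed.

End scaled_disk.

(** * Non-uniformity for exponents above two *)

Section not_uniform.
Context {R : realType}.
Local Notation D := (disk R).
Variable hY : is_metric (@hyperbolic_dist R).
Let M : metricType R := metrized hY.
Variables (eps : R) (hYe : is_metric (uniformized_dist eps (disk0 : M))).
Hypothesis eps_gt2 : 2 < eps.
Let Ye : metricType R := metrized hYe.
Local Notation de := (uniformized_dist eps (disk0 : M)).
Local Notation norm0 z := (hdist disk0 (z : D)).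

Let eps_gt0 : 0 < eps. Proof. exact: lt_trans eps_gt2. Qed.

Let distE (z w : D) : hyperbolic_dist z w = 1 * hdist z w.
Proof. by rewrite mul1r hyperbolic_distE. Qed.

Let geo := scaled_geodesic (hM := hY) ltr01 distE.
Let completeM := scaled_complete (hM := hY) ltr01 distE.

Lemma mdist_hyperbolic (z w : M) : mdist z w = hdist z w.
Proof. by rewrite [LHS]distE mul1r. Qed.

Let mdist0 (z : M) : mdist z (disk0 : M) = norm0 z.
Proof. by rewrite mdist_hyperbolic hdistC. Qed.

Lemma radial_cost (u : R[i]) (u1 : Normc.normc u = 1) s t : 0 <= s -> s <= t ->
  de (radial u1 s) (radial u1 t) <= expR (- (eps * s)) / eps.
Proof.
apply: (ray_cost eps_gt0 (ray := (radial u1 : R -> M))).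
  by move=> r r0; rewrite mdist0 hdist0_radial ger0_norm.
move=> r r' r0 rr'; rewrite mdist_hyperbolic hdist_radial distrC.
by rewrite ger0_norm ?subr_ge0.
Qed.

(** An arc at hyperbolic radius [t] has hyperbolic length of order [expR (2 * t)] and constant
    weight [expR (- (eps * t))]. For [eps > 2] its cost tends to 0: the circle at infinity
    collapses. *)
Lemma arc_cost a b t : 0 <= t -> a <= b ->
  de (radial (normc_cis a) t) (radial (normc_cis b) t) <=
  expR (- ((eps - 2) * t)) / 4 * (b - a).
Proof.
move=> t0 ab; pose c := expR (- ((eps - 2) * t)) / 4.
have cE : c = expR (- (eps * t)) * (expR (2 * t) / 4).
  by rewrite /c mulrA -expRD; congr (expR _ / _); ring.
have cp : cost_path (expo eps (disk0 : M)) (b - a)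
    (fun x => radial (normc_cis (a + x)) t : M) (fun x => c * x).
  split; first by rewrite subr_ge0.
    by exists c => u v _ _ _; rewrite mulrBr.
  move=> x _ e e0; exists 1 => // u v u0 uv _ _ _.
  rewrite /expo mdist0 hdist0_radial ger0_norm// mdist_hyperbolic -mulrBr cE -mulrA.
  apply: ler_wpDr; first by rewrite mulr_ge0 ?subr_ge0// ltW.
  rewrite ler_wpM2l ?expR_ge0//.
  apply: le_trans (hdist_arc_le _ _ t0) _.
  rewrite (_ : a + u - (a + v) = - (v - u)); last by ring.
  by rewrite normrN ger0_norm ?subr_ge0.
have := uniformized_cost eps_gt0 cp.
by rewrite addr0 subrKC mulr0 subr0.
Qed.

Let Ye_triangle (y x z : M) : de x z <= de x y + de y z.
Proof. by case: hYe. Qed.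

Let Ye_sym (x y : M) : de x y = de y x.
Proof. by case: hYe. Qed.

Lemma arc_small e : 0 < e -> exists N, forall n, (N <= n)%N -> forall a, 0 <= a <= 2 * pi ->
  de (radial (normc_cis a) n%:R) (radial (normc_cis 0) n%:R) <= e.
Proof.
move=> e0; have e2 : 0 < eps - 2 by rewrite subr_gt0.
have pi0 : 0 < pi :> R := pi_gt0 R.
have e'0 : 0 < 2 * e / (pi * (eps - 2)) by rewrite divr_gt0 ?mulr_gt0.
have [N NP] := expRN_small e2 e'0; exists N => n Nn a /andP[a0 api].
rewrite Ye_sym; apply: le_trans (arc_cost (ler0n _ _) a0) _; rewrite subr0.
have := NP n Nn; rewrite ltr_pdivrMr// => h.
have : expR (- ((eps - 2) * n%:R)) < 2 * e / pi.
  have E (p c : R) : 0 < p -> 0 < c -> 2 * e / (p * c) * c = 2 * e / p.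
    by move=> p0 c0; field; rewrite !lt0r_neq0.
  by rewrite E in h.
rewrite ltr_pdivlMr//; have := expR_ge0 (- ((eps - 2) * n%:R)).
set E := expR _ => E0 h'; nra.
Qed.

(** Go radially from [z] to radius [n], then along the circle to the fixed ray: the first part costs
    at most the stated bound and the second tends to 0 with growing [n]. *)
Lemma boundary_dist_Ye (z : M) :
  (edist_inf (@boundary R Ye) (to_completion (z : Ye)) <=
    (expR (- (eps * norm0 z)) / eps)%:E)%E.
Proof.
apply: (boundary_dist_le eps_gt0 geo hYe (ray := scaled_ray 1 hY)).
- by move=> t t0; rewrite (scaled_ray0 _ ltr01 distE).
- by move=> s t s0 st; rewrite (scaled_rayP _ ltr01 distE).
move=> e e0; have [u [u1 zE]] := polarP (z : D).
have [t t01 uE] := cisP u1.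
have [N NP] := arc_small e0.
pose n0 := maxn N (Num.truncn (norm0 z)).+1.
exists n0 => n n0n.
have zn : norm0 z <= n%:R.
  apply/ltW/(lt_le_trans (truncnS_gt _)); rewrite ler_nat.
  exact: leq_trans (leq_maxr _ _) n0n.
have -> : scaled_ray 1 hY n%:R = radial (normc_cis 0) n%:R.
  by apply: val_inj; rewrite /= divr1 cis0.
have z' : z = radial (normc_cis (2 * pi * t)) (norm0 z).
  by rewrite [LHS]zE; apply: val_inj; rewrite /= uE.
apply: le_trans (Ye_triangle (radial (normc_cis (2 * pi * t)) n%:R) _ _) _.
apply: lerD.
  by rewrite [X in de X _]z'; apply: radial_cost => //; exact: hdist_ge0.
apply: NP; first exact: leq_trans (leq_maxl _ _) n0n.
case/andP: t01 => t0 t1; have pi0 := pi_ge0 R.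
by rewrite mulr_ge0 ?mulr_ge0//= ler_piMr ?mulr_ge0.
Qed.

(** Radially outwards, along half a circle of large radius at negligible cost, and radially back:
    much cheaper than crossing the disk. *)
Lemma antipodal_dist r : 0 <= r ->
  de (radial (normc_cis 0) r) (radial (normc_cis pi) r) <=
    2 * (expR (- (eps * r)) / eps).
Proof.
move=> r0; apply/ler_addgt0Pr => e e0; have [N NP] := arc_small e0.
pose n := maxn N (Num.truncn r).+1.
have rn : r <= n%:R.
  by apply/ltW/(lt_le_trans (truncnS_gt _)); rewrite ler_nat leq_maxr.
have h0 := radial_cost (normc_cis 0) r0 rn.
have hpi := radial_cost (normc_cis pi) r0 rn.
have pi0 := pi_ge0 R.
have ha := NP n (leq_maxl _ _) pi; rewrite pi0 in ha.
have {}ha := ha ltac:(lra).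
have := Ye_triangle (radial (normc_cis 0) n%:R) (radial (normc_cis 0) r)
  (radial (normc_cis pi) r).
have := Ye_triangle (radial (normc_cis pi) n%:R) (radial (normc_cis 0) n%:R)
  (radial (normc_cis pi) r).
rewrite (Ye_sym (radial (normc_cis pi) n%:R)) in ha *.
rewrite (Ye_sym (radial (normc_cis pi) n%:R)) in hpi *.
lra.
Qed.

(* Away from the boundary, [de] dominates the Euclidean distance by the density
   [rho_eps / (1 - |z|^2) ~ expR (- (eps - 2) * norm0 z)]. *)
Lemma de_ge_chordB (z w : M) h : norm0 z <= h -> de z w < expR (- (eps * (h + 1))) ->
  expR (- (eps + 3)) / 4 * expR (- ((eps - 2) * h)) * chordB z w <= de z w.
Proof.
move=> zh zw.
have lowE := uniformized_ge (disk0 : M) eps_gt0 geo z w.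
rewrite mdist0 mdist_hyperbolic in lowE.
have Ele : expR (- (eps * (h + 1))) <= expR (- (eps * (norm0 z + 1))).
  by rewrite ler_expR lerN2 ler_pM2l// lerD2r.
have d1 : hdist (z : D) w < 1.
  rewrite ltNge; apply/negP => d1; move: lowE; rewrite min_l// mulr1 => ?; lra.
rewrite min_r ?(ltW d1)// in lowE; apply: le_trans lowE.
set d := hdist (z : D) w in d1 *; have d0 : 0 <= d := hdist_ge0 _ _.
have hz0 : 0 <= norm0 z := hdist_ge0 _ _.
(* One unit of distance changes the defect by at most a constant factor, so the estimate of [chordB]
   can be expressed through [norm0 z] alone. *)
have qle (p : D) : norm0 z - 1 <= norm0 p -> defect p <= 4 * expR (2 - 2 * norm0 z).
  move=> zp; rewrite defect_hdist ler_pM2l//.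
  have c0 := ch_gt0 (norm0 p).
  have E1 : expR (norm0 z - 1) <= ch (norm0 p).
    apply: (@le_trans _ _ (expR (norm0 p))); first by rewrite ler_expR.
    by rewrite lerDl expR_ge0.
  have -> : 2 - 2 * norm0 z = - (norm0 z - 1 + (norm0 z - 1)) by ring.
  rewrite expRN expRD -expr2 lef_pV2 ?posrE ?exprn_gt0 ?expR_gt0//.
  by rewrite ler_pXn2r// nnegrE ?expR_ge0// ltW.
have wz : norm0 z - 1 <= norm0 w.
  have := hdist_triangle w disk0 z; rewrite (hdistC w z) -/d; lra.
have Gle := gmean_le (qle z ltac:(lra)) (qle w wz).
have := chordB_le (z : D) w; rewrite -/d => Bd.
have ed : expR d <= expR 1 by rewrite ler_expR ltW.
have Bd2 : chordB (z : D) w <= 4 * expR (2 - 2 * norm0 z) * (d * expR 1).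
  apply: le_trans Bd _; apply: ler_pM => //.
  - exact/ltW/gmean_gt0.
  - by rewrite mulr_ge0 ?expR_ge0.
  - by rewrite ler_wpM2l.
have -> : expR (- (eps + 3)) / 4 * expR (- ((eps - 2) * h)) * chordB (z : D) w =
  expR (- (eps + 3)) * expR (- ((eps - 2) * h)) * (chordB (z : D) w / 4) by ring.
apply: (@le_trans _ _ (expR (- (eps + 3)) * expR (- ((eps - 2) * norm0 z)) *
    (expR (2 - 2 * norm0 z) * (d * expR 1)))).
  apply: ler_pM; rewrite ?mulr_ge0 ?expR_ge0 ?divr_ge0 ?chordB_ge0//.
    rewrite ler_wpM2l ?expR_ge0// ler_expR lerN2 ler_pM2l// subr_gt0//.
  by rewrite ler_pdivrMr//; lra.
rewrite le_eqVlt; apply/orP; left; apply/eqP.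
(* The constant [eps + 3] collects [eps] from the unit ball in [uniformized_ge], 2 from the defect
   one unit nearer to 0, and 1 from [expR d <= expR 1]. *)
have -> : - (eps * (norm0 z + 1)) =
  - (eps + 3) - (eps - 2) * norm0 z + (2 - 2 * norm0 z) + 1 by ring.
by rewrite !expRD; ring.
Qed.

(** [de_ge_chordB] only compares nearby points; [cousin] adds up the local comparisons, since length
    is additive and the Euclidean distance subadditive. *)
Lemma length_ge_chordB a b (g : R -> Ye) h : rectifiable a b g ->
  (forall t, a <= t <= b -> norm0 (g t) <= h) ->
  ((expR (- (eps + 3)) / 4 * expR (- ((eps - 2) * h)) *
    chordB (g a : D) (g b))%:E <= curve_length a b g)%E.
Proof.
move=> rg gh; have [[ab cg] fg] := rg.
set c := expR (- (eps + 3)) / 4 * expR (- ((eps - 2) * h)).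
have c0 : 0 <= c by rewrite mulr_ge0 ?divr_ge0 ?expR_ge0.
apply: (@cousin R a b (fun s t => ((c * chordB (g s : D) (g t))%:E <=
  curve_length s t g)%E)) => //.
  move=> s t u as_ st tu ub h1 h2; rewrite (curve_lengthD g st tu).
  apply: le_trans (leeD h1 h2); rewrite -EFinD lee_fin -mulrDr ler_wpM2l//.
  exact: (@metric_triangle R D (g s) (g t) (g u)).
move=> x xab; pose n := expR (- (eps * (h + 1))) / 2.
have n0 : 0 < n by rewrite divr_gt0// expR_gt0.
have [d d0 dP] := (within_continuousP _ _ _).1 cg x xab n n0.
have [ax xb] := andP xab.
exists d => // s t as_ sx xt tb xs tx.
have sab : a <= s <= b by rewrite as_ (le_trans sx xb).
have tab : a <= t <= b by rewrite tb (le_trans ax xt).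
have hs : mdist (g x) (g s) < n by apply: dP => //; rewrite ger0_norm ?subr_ge0//; lra.
have ht : mdist (g x) (g t) < n.
  by apply: dP => //; rewrite distrC ger0_norm ?subr_ge0//; lra.
have st' : mdist (g s) (g t) < expR (- (eps * (h + 1))).
  have := metric_triangle (g s) (g x) (g t); rewrite (metric_sym (g s) (g x)).
  by move: hs ht; rewrite /n; lra.
apply: le_trans (dist_le_length g (le_trans sx xt)).
by rewrite lee_fin; apply: de_ge_chordB => //; exact: gh.
Qed.

Lemma not_uniform_domain_Ye : ~ uniform_domain Ye.
Proof.
move=> [_ _ [lambda l1 H]].
have eg : 2 < eps := eps_gt2.
have l0 : 0 < lambda by lra.
(* The 1 is the radius of the ball in [uniformized_ge]; [ln lambda] is the depth lost to the factor
   [lambda^-1] in the uniformity condition. *)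
pose K := 1 + ln lambda.
have K1 : 1 <= K by rewrite lerDl ln_ge0.
(* Chosen so that the final comparison reads [expR (2 * r) <= C]; this fails for [r = C + 1] because
   [expR (2 * r) >= 1 + 2 * r]. *)
pose C := 4 * lambda * expR (eps + 3) * expR ((eps - 2) * K).
pose r := C + 1.
have C0 : 0 < C by rewrite !mulr_gt0 ?expR_gt0.
have r0 : 0 <= r by rewrite /r; lra.
pose x : Ye := radial (normc_cis 0) r; pose y : Ye := radial (normc_cis pi) r.
have [a [b [g [rg gx gy Ll bd]]]] := H x y.
have [[ab cg] fg] := rg.
have xy := antipodal_dist r0; rewrite -/x -/y in xy.
have nx : norm0 x = r by rewrite hdist0_radial ger0_norm.
have ny : norm0 y = r by rewrite hdist0_radial ger0_norm.
have near (p q : M) : norm0 p = r -> de p q < expR (- (eps * (r + 1))) ->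
    norm0 q <= r + K.
  move=> pr pq; have := uniformized_ge (disk0 : M) eps_gt0 geo p q.
  rewrite mdist0 mdist_hyperbolic pr => h.
  have d1 : hdist (p : D) q < 1.
    rewrite ltNge; apply/negP => d1; move: h; rewrite min_l// mulr1 => ?; lra.
  have := hdist_triangle p disk0 (q : D); lra.
have gh t : a <= t <= b -> norm0 (g t) <= r + K.
  move=> tab; have [at_ tb] := andP tab.
  have f1 := curve_length_fin rg (lexx a) at_ tb.
  have f2 := curve_length_fin rg at_ tb (lexx b).
  have l1' := dist_le_length g at_; have l2' := dist_le_length g tb.
  have := le_trans (bd t tab) (boundary_dist_Ye (g t)).
  rewrite -(fineK f1) in l1' *; rewrite -(fineK f2) in l2' *.
  rewrite lee_fin gx in l1'; rewrite lee_fin gy in l2'.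
  set u := fine _ in l1' *; set v := fine _ in l2' *.
  rewrite -EFin_min -EFinM lee_fin => bd'.
  (* If one subcurve is short, the point is within hyperbolic distance 1 of that end. Otherwise both
     are long, and the boundary estimate bounds [h] from above. *)
  have [ur|ur] := ltP u (expR (- (eps * (r + 1)))).
    by apply: (near x) => //; exact: le_lt_trans ur.
  have [vr|vr] := ltP v (expR (- (eps * (r + 1)))).
    by apply: (near y) => //; rewrite Ye_sym; exact: le_lt_trans vr.
  set h := norm0 (g t) in bd' *.
  have : lambda^-1 * expR (- (eps * (r + 1))) <= expR (- (eps * h)) / eps.
    apply: le_trans bd'; rewrite ler_pM2l ?invr_gt0//.
    by rewrite le_min ur vr.
  rewrite ler_pdivlMr// -mulrA mulrC ler_pdivrMr// => h1.
  have h2 : expR (- (eps * (r + 1))) <= expR (- (eps * h)) * lambda.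
    apply: le_trans h1; apply: ler_peMr; first exact: expR_ge0.
    by apply/ltW; apply: lt_trans eps_gt2; rewrite ltr1n.
  have h3 : - (eps * (r + 1)) <= - (eps * h) + ln lambda.
    by rewrite -ler_expR expRD lnK// posrE.
  have ll0 : 0 <= ln lambda by exact: ln_ge0.
  have ll1 : ln lambda <= eps * ln lambda.
    by rewrite ler_peMl//; apply/ltW; apply: lt_trans eps_gt2; rewrite ltr1n.
  rewrite -(ler_pM2l eps_gt0) /K; lra.
have := le_trans (length_ge_chordB rg gh) Ll.
rewrite gx gy lee_fin => h.
have {}h := le_trans h (ler_wpM2l (ltW l0) xy).
(* The Euclidean distance of the antipodal points is [2 * th r], which is at least 1 because
   [r >= 2] forces [expR r >= 3]. *)
have BE : 1 <= chordB (x : D) y.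
  have -> : chordB (x : D) y = 2 * th r.
    rewrite /chordB -[val (x : D)]/((real_complex R (th r)) * cis 0).
    rewrite -[val (y : D)]/((real_complex R (th r)) * cis pi).
    rewrite -mulrBr cis0 cispi opprK Normc.normcM normc_real.
    rewrite (ger0_norm (th_ge0 r0)) mulrC; congr (_ * _).
    have -> : (1 + 1 : R[i]) = real_complex R 2.
      by apply/eqP; rewrite eq_complex /= addr0 !eqxx.
    by rewrite normc_real ger0_norm.
  have c0 := ch_gt0 r; rewrite /th mulrA ler_pdivlMr// mul1r /ch.
  have : expR (- r) <= 1 by rewrite expR_le1 oppr_le0.
  have : 1 + 2 <= expR r.
    apply: le_trans (expR_ge1Dx r); rewrite lerD2l /r /C.
    have e1 : 1 <= expR (eps + 3).
      by rewrite -[leLHS]expR0 ler_expR; lra.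
    have e2 : 1 <= expR ((eps - 2) * K).
      by rewrite -[leLHS]expR0 ler_expR mulr_ge0 ?subr_ge0//; lra.
    set E := expR (eps + 3) in e1 *; set F := expR _ in e2 *.
    have h1 : 1 <= lambda * E by rewrite -[leLHS]mulr1 ler_pM.
    have : 1 <= lambda * E * F by rewrite -[leLHS]mulr1 ler_pM.
    lra.
  lra.
have {}h : expR (- (eps + 3)) / 4 * expR (- ((eps - 2) * (r + K))) <=
    lambda * (2 * (expR (- (eps * r)) / eps)).
  by apply: le_trans h; rewrite ler_peMr// mulr_ge0 ?divr_ge0 ?expR_ge0.
have : expR (2 * r) <= C.
  have E1 : expR (- (eps + 3)) * expR (- ((eps - 2) * (r + K))) <=
      4 * lambda * expR (- (eps * r)).
    have : 2 * (expR (- (eps * r)) / eps) <= expR (- (eps * r)).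
      by rewrite mulrA ler_pdivrMr// mulrC ler_wpM2l ?expR_ge0// ltW.
    move=> /(ler_wpM2l (ltW l0)); lra.
  (* Multiplying by this exponential removes every negative exponent: the left side becomes
     [expR (2 * r)] and the right side [C]. *)
  have := ler_wpM2l (expR_ge0 (eps * r + (eps + 3) + (eps - 2) * K)) E1.
  rewrite [leRHS](_ : _ = C * (expR (eps * r) * expR (- (eps * r)))).
    rewrite expRxMexpNx_1 mulr1 -!expRD; congr (expR _ <= _); ring.
  by rewrite /C !expRD; ring.
have := expR_ge1Dx (2 * r); rewrite /r; lra.
Qed.

(** The first two parts show that the standing conditions of a uniform domain hold, so that what
    fails is the existence of uniform curves. *)
Lemma Ye_not_uniform :
  [/\ locally_complete Ye, ~ complete_space Ye & ~ uniform_domain Ye].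
Proof.
split; last exact: not_uniform_domain_Ye.
  exact: (locally_complete_uniformized eps_gt0 geo completeM).
apply: (uniformized_not_complete eps_gt0 geo (ray := scaled_ray 1 hY)).
- by move=> t t0; rewrite (scaled_ray0 _ ltr01 distE).
- by move=> s t s0 st; rewrite (scaled_rayP _ ltr01 distE).
Qed.

End not_uniform.

(** * Uniformity after scaling *)

Lemma is_metric_scale (R : realType) (T : Type) (d : T -> T -> R) (k : R) :
  0 < k -> is_metric d -> is_metric (fun x y => k * d x y).
Proof.
move=> k0 [d0 dpos dsym dtri]; split.
- by move=> x; rewrite d0 mulr0.
- by move=> x y /eqP; rewrite mulf_eq0 (gt_eqF k0) => /eqP/dpos.
- by move=> x y; rewrite dsym.
- by move=> y x z; rewrite -mulrDr ler_pM2l.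
Qed.

Section to_disk.
Context {R : realType}.
Local Notation normc := Normc.normc.

(* Junk value [disk0] outside the unit disk. *)
Definition to_disk (z : R[i]) : disk R :=
  if pselect (normc z < 1) is left z1 then exist _ z z1 else disk0.

Lemma to_diskK z : normc z < 1 -> val (to_disk z) = z.
Proof. by rewrite /to_disk; case: pselect. Qed.

Lemma normc_segment (x y : disk R) (t : R) : 0 <= t <= 1 ->
  normc (val x + real_complex R t * (val y - val x)) < 1.
Proof.
move=> /andP[t0 t1].
have -> : val x + real_complex R t * (val y - val x) =
    real_complex R (1 - t) * val x + real_complex R t * val y.
  by rewrite rmorphB rmorph1; ring.
apply: le_lt_trans (le_normcD _ _) _; rewrite !Normc.normcM !normc_real.
rewrite !ger0_norm ?subr_ge0//.
have := disk_normc_lt1 x; have := disk_normc_lt1 y.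
set a := normc _ => a1; set b := normc _ => b1.
have [->|t0'] := eqVneq t 0; first by rewrite subr0 mul1r mul0r addr0.
have : t * a < t * 1 by rewrite ltr_pM2l// lt_neqAle eq_sym t0'.
have : (1 - t) * b <= (1 - t) * 1 by rewrite ler_wpM2l ?subr_ge0// ltW.
lra.
Qed.

End to_disk.

Section uniform.
Context {R : realType}.
Local Notation normc := Normc.normc.
Local Notation D := (disk R).
Variable eps : R.
Hypothesis eps_gt0 : 0 < eps.
Let k : R := 2 / eps.
Variable hZ : is_metric (fun z w : D => 2 / eps * hyperbolic_dist z w).
Let Z : metricType R := metrized hZ.
Variable hZe : is_metric (uniformized_dist eps (disk0 : Z)).
Let Ze : metricType R := metrized hZe.
Local Notation dz := (uniformized_dist eps (disk0 : Z)).
Local Notation norm0 z := (hdist disk0 (z : D)).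
Local Notation B := chordB.

Let k_gt0 : 0 < k. Proof. by rewrite divr_gt0. Qed.

Let distE (z w : D) : 2 / eps * hyperbolic_dist z w = k * hdist z w.
Proof. by rewrite hyperbolic_distE. Qed.

Let geo := scaled_geodesic (hM := hZ) k_gt0 distE.
Let completeZ := scaled_complete (hM := hZ) k_gt0 distE.

Let mdistZ (z w : Z) : mdist z w = k * hdist z w.
Proof. exact: distE. Qed.

Let expoE (z : Z) : expo eps (disk0 : Z) z = expR (- (2 * norm0 z)).
Proof.
rewrite /expo mdistZ hdistC; congr (expR (- _)).
by rewrite mulrA (_ : eps * k = 2)// mulrC divfK ?lt0r_neq0.
Qed.

(** [ch] lies between [expR] and [2 * expR] at nonnegative arguments. With [exp_le_defect], the
    weight divided by the defect lies between 1/4 and 1, which yields the constants [k / 4] and [k]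
    of [dz_ge] and [dz_le]. *)
Lemma defect_le_exp (z : D) : defect z <= 4 * expR (- (2 * norm0 z)).
Proof.
rewrite defect_hdist ler_pM2l// expRN lef_pV2 ?posrE ?exprn_gt0 ?expR_gt0 ?ch_gt0//.
have -> : 2 * norm0 z = norm0 z + norm0 z by ring.
rewrite expRD -expr2 ler_pXn2r ?nnegrE ?expR_ge0 ?(ltW (ch_gt0 _))//.
by rewrite lerDl expR_ge0.
Qed.

Lemma exp_le_defect (z : D) : expR (- (2 * norm0 z)) <= defect z.
Proof.
rewrite defect_hdist expRN -[leRHS]invrK lef_pV2 ?posrE ?expR_gt0 ?invr_gt0
  ?divr_gt0 ?exprn_gt0 ?ch_gt0//.
rewrite invf_div ler_pdivrMr//.
have -> : 2 * norm0 z = norm0 z + norm0 z by ring.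
rewrite expRD -expr2 (_ : 4 = 2 ^+ 2 :> R); last by ring.
rewrite -exprMn ler_pXn2r ?nnegrE ?mulr_ge0 ?expR_ge0 ?(ltW (ch_gt0 _))//.
have : expR (- norm0 z) <= expR (norm0 z).
  by rewrite ler_expR; have := hdist_ge0 disk0 z; lra.
rewrite /ch; lra.
Qed.

(** The function [k / 4 * B x] is locally Lipschitz with constant the weight, because the scaled
    distance is about [k / defect] times the Euclidean one. *)
Lemma dz_ge (x y : Z) : k / 4 * B (x : D) y <= dz x y.
Proof.
have := uniformized_ge_fun eps_gt0 geo
  (phi := fun z : Z => k / 4 * B (x : D) z) (x : Z) y.
have Bxx : B (x : D) x = 0 by rewrite /B subrr Normc.normc0.
rewrite Bxx mulr0 subr0; apply => z e e0.
have e0' : 0 < 4 * e by rewrite mulr_gt0.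
have [r r0 rP] := chordB_density (z : D) e0'.
have [d d0 dP] := @chordB_near R r r0.
exists (k * d); first by rewrite mulr_gt0.
move=> w; rewrite mdistZ ltr_pM2l// => zw.
have zz : B (z : D) z < r by rewrite /B subrr Normc.normc0.
have h1 := rP z w zz (dP _ _ zw).
rewrite expoE -mulrBr normrM ger0_norm; last by rewrite divr_ge0// ltW.
have h2 : `|B (x : D) z - B (x : D) w| <= B (z : D) w.
  have := @metric_triangle R D x z w; have := @metric_triangle R D x w z.
  rewrite !mdist_disk (chordBC w z) ler_norml => ? ?; apply/andP; split; lra.
have h3 := defect_le_exp z.
have d0' := hdist_ge0 (z : D) w.
have h4 : B (z : D) w <= 4 * ((expR (- (2 * norm0 z)) + e) * hdist (z : D) w).
  apply: le_trans h1 _; rewrite mulrA ler_wpM2r//; lra.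
rewrite mulrCA -mulrA ler_pM2l//; lra.
Qed.

(** The Euclidean segment is a cost path with linear [Phi]; clamping its parameter keeps it inside
    the disk for every real [t]. *)
Lemma dz_le (x y : Z) : dz x y <= k * B (x : D) y.
Proof.
pose cl (t : R) := Num.max 0 (Num.min t 1).
have cl01 t : 0 <= cl t <= 1.
  by rewrite /cl le_max lexx/= ge_max ler01 ge_min lexx orbT.
have clE t : 0 <= t -> t <= 1 -> cl t = t.
  by move=> t0 t1; rewrite /cl min_l// max_r.
pose g t : Z := to_disk (val (x : D) + real_complex R (cl t) * (val (y : D) - val (x : D))).
have gE t : val (g t : D) = val (x : D) + real_complex R (cl t) * (val (y : D) - val (x : D)).
  by rewrite to_diskK// normc_segment.
have gB s t : 0 <= s -> s <= t -> t <= 1 -> B (g s : D) (g t) = B (x : D) y * (t - s).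
  move=> s0 st t1; rewrite /B !gE !clE// ?(le_trans s0 st) ?(le_trans st t1)//.
  rewrite opprD addrACA subrr add0r -mulrBl -rmorphB Normc.normcM normc_real.
  by rewrite distrC ger0_norm ?subr_ge0// mulrC normcB.
set b := B (x : D) y in gB *; have b0 : 0 <= b := chordB_ge0 _ _.
have cp : cost_path (expo eps (disk0 : Z)) 1 g (fun t => k * b * t).
  split => //; first by exists (k * b) => s t _ _ _; rewrite mulrBr.
  move=> z /andP[zz0 z1] e e0; have q0 := defect_gt0 (g z : D).
  pose e' := e / (k * (b + 1)).
  have kb0 : 0 < k * (b + 1) by rewrite mulr_gt0// ltr_wpDl.
  have e'0 : 0 < e' by rewrite divr_gt0.
  have [r r0 rP] := hdist_density (g z : D) e'0.
  exists (r / (b + 1)); first by rewrite divr_gt0// ltr_wpDl.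
  move=> s t s0 st t1 zs tz.
  have near u : 0 <= u -> u <= 1 -> `|z - u| < r / (b + 1) -> B (g z : D) (g u) < r.
    move=> u0 u1; rewrite ltr_pdivlMr ?ltr_wpDl// => zu.
    have zub : b * `|z - u| <= `|z - u| * (b + 1) by rewrite mulrC ler_wpM2l// lerDl.
    apply: le_lt_trans zu; apply: le_trans zub.
    have [zu|/ltW uz] := leP z u.
      by rewrite gB// distrC ger0_norm ?subr_ge0.
    by rewrite chordBC gB// ger0_norm ?subr_ge0.
  have hs : B (g z : D) (g s) < r.
    apply: near => //; first exact: le_trans t1.
    by rewrite ltr_norml; apply/andP; split; lra.
  have ht : B (g z : D) (g t) < r.
    apply: near => //; first exact: le_trans st.
    by rewrite ltr_norml; apply/andP; split; lra.
  have := rP _ _ hs ht; rewrite gB// => h.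
  rewrite expoE mdistZ; have h1 := exp_le_defect (g z).
  have h0 := expR_ge0 (- (2 * norm0 (g z))).
  set E := expR _ in h0 h1 *; set q := defect _ in q0 h h1.
  have E1 : E <= 1 by apply: le_trans h1 (defect_le1 _).
  apply: (@le_trans _ _ (k * (E * ((q^-1 + e') * (b * (t - s)))))).
    by rewrite mulrCA ler_pM2l// ler_wpM2l.
  have bt0 : 0 <= b * (t - s) by rewrite mulr_ge0 ?subr_ge0.
  (* The weight [E] is at most the defect [q], so it cancels the blow-up of the hyperbolic
     density. *)
  have Eq : E * (q^-1 + e') <= 1 + e'.
    rewrite mulrDr lerD//; first by rewrite ler_pdivrMr// mul1r.
    by rewrite ler_piMl// ltW.
  apply: (@le_trans _ _ (k * ((1 + e') * (b * (t - s))))).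
    by rewrite ler_pM2l// [E * _]mulrA; apply: ler_wpM2r.
  have e'E : e' * (k * (b + 1)) = e by rewrite /e' divfK// lt0r_neq0.
  have : k * e' * b * (t - s) <= e * (t - s).
    rewrite ler_wpM2r ?subr_ge0// -e'E.
    by have := mulr_gt0 e'0 k_gt0; lra.
  lra.
have := uniformized_cost eps_gt0 cp.
rewrite mulr0 subr0 mulr1.
have -> : g 0 = x.
  by apply: val_inj; rewrite gE clE// mul0r addr0.
have -> // : g 1 = y.
by apply: val_inj; rewrite gE clE// mul1r addrC subrK.
Qed.

Lemma boundary_dist_Ze (z : Z) :
  ((k / 4 * (1 - normc (val (z : D))))%:E <=
   edist_inf (@boundary R Ze) (to_completion (z : Ze)))%E.
Proof.
apply: (boundary_dist_ge eps_gt0 geo hZe completeZ) => e e0.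
(* Beyond this radius [k < 2 * e * norm0 w], and [t * expR (- t) <= 1] turns this into
   [k * expR (- (2 * norm0 w)) <= e]: the point is within the tolerance of the unit circle. *)
exists (k ^+ 2 / (2 * e)) => w; rewrite mdistZ hdistC => Kw.
apply: le_trans (dz_ge z w).
have h1 := ler_dist_normc (val (z : D)) (val (w : D)).
have h2 := defect_le_exp w.
have h3 : 1 - normc (val (w : D)) <= defect (w : D).
  rewrite /defect lerD2l lerN2 expr2 ler_piMl ?normc_ge0// ltW//.
  exact: disk_normc_lt1.
have h4 : expR (- (2 * norm0 w)) * (2 * norm0 w) <= 1.
  have := expRxMexpNx_1 (2 * norm0 w); have := expR_ge1Dx (2 * norm0 w).
  have := expR_ge0 (- (2 * norm0 w)).
  set E := expR _; set F := expR (2 * _) => E0 F1 FE.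
  have := ler_wpM2l E0 F1; rewrite [E * F]mulrC FE; lra.
move: Kw; rewrite ltr_pdivrMr ?mulr_gt0// => Kw.
have h5 : k < norm0 w * (2 * e) by rewrite -(ltr_pM2l k_gt0) -expr2; lra.
have n0 : 0 < norm0 w.
  rewrite lt_neqAle hdist_ge0 andbT; apply/eqP => nw.
  by move: h5; rewrite -nw mul0r => /(lt_trans k_gt0); rewrite ltxx.
have h6 : k * expR (- (2 * norm0 w)) <= e.
  have h7 : expR (- (2 * norm0 w)) * k <= expR (- (2 * norm0 w)) * (norm0 w * (2 * e)).
    by rewrite ler_wpM2l ?expR_ge0// ltW.
  have : expR (- (2 * norm0 w)) * (2 * norm0 w) * e <= 1 * e by rewrite ler_wpM2r// ltW.
  lra.
have h7 : k / 4 * (1 - normc (val (w : D))) <= e.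
  apply: le_trans h6.
  have : k / 4 * (1 - normc (val (w : D))) <= k / 4 * (4 * expR (- (2 * norm0 w))).
    by rewrite ler_pM2l ?divr_gt0//; lra.
  lra.
have h8 : normc (val (w : D)) - normc (val (z : D)) <= B (z : D) w.
  by move: h1; rewrite ler_norml /B; lra.
have : k / 4 * (normc (val (w : D)) - normc (val (z : D))) <= k / 4 * B (z : D) w.
  by rewrite ler_pM2l ?divr_gt0.
lra.
Qed.

(* The curve from [x] to [y] moves radially inwards by [|x - y| / 2], then along a
   segment, then radially outwards. *)
Section curve.
Variables x y : Z.
Let s : R := B (x : D) y / 2.
(** The profile [m] rises on [[0, 1]], is 1 on [[1, 3]] and falls on [[3, 4]], while [c] moves from
    0 to 1 on [[1, 3]]. Shrinking the chord point by [1 - s * m t] leaves a gap of at least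
    [s * m t] to the unit circle. *)
Let m (t : R) : R := Num.min 1 (Num.min t (4 - t)).
Let c (t : R) : R := Num.max 0 (Num.min 1 ((t - 1) / 2)).
Let pt (t : R) : R[i] := real_complex R (1 - s * m t) *
  (val (x : D) + real_complex R (c t) * (val (y : D) - val (x : D))).

Let s_ge0 : 0 <= s. Proof. by rewrite divr_ge0 ?chordB_ge0. Qed.

Let s_le1 : s <= 1.
Proof.
rewrite ler_pdivrMr// mul1r.
have := le_normcD (val (x : D)) (- val (y : D)); rewrite normcN -/(B (x : D) y).
have := disk_normc_lt1 (x : D); have := disk_normc_lt1 (y : D); lra.
Qed.

Let m_ge0 t : 0 <= t <= 4 -> 0 <= m t <= 1.
Proof.
move=> /andP[t0 t4]; rewrite /m !le_min ler01 t0 subr_ge0 t4 /=.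
by rewrite ge_min lexx.
Qed.

Let m_lip t u : `|m t - m u| <= `|t - u|.
Proof.
apply: norm_minB_le; first by rewrite subrr normr0.
by apply: norm_minB_le => //; rewrite opprB addrC subrKA distrC.
Qed.

Let c01 t : 0 <= c t <= 1.
Proof. by rewrite /c le_max lexx/= ge_max ler01 ge_min lexx. Qed.

Let c_lip t u : `|c t - c u| <= `|t - u| / 2.
Proof.
have h0 : 0 <= `|t - u| / 2 by rewrite divr_ge0.
apply: norm_maxB_le; first by rewrite subrr normr0.
apply: norm_minB_le; first by rewrite subrr normr0.
by rewrite -mulrBl opprB subrKA normrM (ger0_norm (_ : 0 <= 2^-1 :> R)).
Qed.

Let sm01 t : 0 <= t <= 4 -> 0 <= s * m t <= 1.
Proof.
move=> /m_ge0/andP[m0 m1]; rewrite mulr_ge0//=.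
by rewrite -[leRHS]mulr1 ler_pM.
Qed.

Let pt_le t : 0 <= t <= 4 -> normc (pt t) <= 1 - s * m t.
Proof.
move=> t4; have /andP[sm0 sm1] := sm01 t4.
rewrite Normc.normcM normc_real ger0_norm ?subr_ge0//.
by rewrite ler_piMr ?subr_ge0// ltW// normc_segment.
Qed.

Let pt_lt1 t : 0 <= t <= 4 -> normc (pt t) < 1.
Proof.
move=> t4; have /andP[sm0 sm1] := sm01 t4.
rewrite Normc.normcM normc_real ger0_norm ?subr_ge0//.
apply: le_lt_trans (normc_segment (x : D) y (c01 t)).
by rewrite ler_piMl ?normc_ge0// lerBlDr lerDl.
Qed.

Let pt_lip t u : 0 <= t <= 4 -> 0 <= u <= 4 ->
  normc (pt t - pt u) <= 2 * s * `|t - u|.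
Proof.
move=> t4 u4.
(* Product rule: the change of the radial factor and the motion along the chord each contribute at
   most [s * |t - u|]. *)
have -> : pt t - pt u = real_complex R (s * (m u - m t)) *
    (val (x : D) + real_complex R (c t) * (val (y : D) - val (x : D))) +
  real_complex R (1 - s * m u) * (real_complex R (c t - c u) * (val (y : D) - val (x : D))).
  rewrite /pt !rmorphB !rmorphM !rmorphB; set A := real_complex R _; ring.
have /andP[sm0 sm1] := sm01 u4.
apply: le_trans (le_normcD _ _) _; rewrite !Normc.normcM !normc_real.
have h1 : `|s * (m u - m t)| * normc (val (x : D) + real_complex R (c t) *
    (val (y : D) - val (x : D))) <= s * `|t - u|.
  rewrite normrM (ger0_norm s_ge0) -[leRHS]mulr1; apply: ler_pM => //.
  - by rewrite mulr_ge0.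
  - exact: normc_ge0.
  - by rewrite ler_wpM2l// distrC m_lip.
  - by rewrite ltW// normc_segment.
have h2 : `|1 - s * m u| * (`|c t - c u| * normc (val (y : D) - val (x : D))) <=
    s * `|t - u|.
  have -> : s * `|t - u| = 1 * (`|t - u| / 2 * B (y : D) x).
    by rewrite /s chordBC; field.
  apply: ler_pM => //.
  - by rewrite mulr_ge0 ?normc_ge0.
  - by rewrite ger0_norm ?subr_ge0// lerBlDr lerDl.
  - by rewrite ler_wpM2r ?normc_ge0.
lra.
Qed.

Let g (t : R) : Ze := to_disk (pt t).

Let gE t : 0 <= t <= 4 -> val (g t : D) = pt t.
Proof. by move=> t4; rewrite to_diskK// pt_lt1. Qed.

Let g_lip t u : 0 <= t <= 4 -> 0 <= u <= 4 ->
  mdist (g t) (g u) <= 2 * k * s * `|t - u|.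
Proof.
move=> t4 u4; apply: le_trans (dz_le _ _) _.
rewrite /B !gE//; have := pt_lip t4 u4 => /(ler_wpM2l (ltW k_gt0)); lra.
Qed.

Let g_length t u : 0 <= t -> t <= u -> u <= 4 ->
  (curve_length t u g <= (2 * k * s * (u - t))%:E)%E.
Proof.
move=> t0 tu u4.
have := @curve_length_le R Ze t u g (fun v => 2 * k * s * v) tu.
rewrite -mulrBr; apply => v w tv vw wu; rewrite -mulrBr.
apply: le_trans (g_lip _ _) _.
- by rewrite (le_trans t0 tv) (le_trans (le_trans vw wu) u4).
- by rewrite (le_trans (le_trans t0 tv) vw) (le_trans wu u4).
- by rewrite distrC ger0_norm ?subr_ge0.
Qed.

(** The constant 16 serves both conditions. The length is at most [8 * k * s = 4 * k * B x y], while
    [dz_ge] gives [k / 4 * B x y]. The shorter subcurve is at most [4 * k * s * m t], while the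
    boundary is at least [k / 4 * (s * m t)] away. *)
Lemma uniform_curve : exists a b gamma,
  [/\ rectifiable a b gamma, gamma a = (x : Ze), gamma b = (y : Ze),
      (curve_length a b gamma <= (16 * mdist (x : Ze) y)%:E)%E &
      forall t, a <= t <= b -> (16^-1%:E *
        mine (curve_length a t gamma) (curve_length t b gamma)
          <= edist_inf (@boundary R Ze) (to_completion (gamma t)))%E].
Proof.
have ks0 : 0 <= k * s by rewrite mulr_ge0// ltW.
have rg : rectifiable 0 4 g.
  split; last first.
    by apply: le_lt_trans (g_length _ _ _) _ => //; rewrite ltry.
  split => //; apply/within_continuousP => t t4 e e0.
  exists (e / (2 * k * s + 1)); first by rewrite divr_gt0// ltr_wpDl//; lra.
  move=> u u4; rewrite ltr_pdivlMr; last by rewrite ltr_wpDl//; lra.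
  move=> tu; apply: le_lt_trans tu; apply: le_trans (g_lip t4 u4) _.
  by rewrite mulrC ler_wpM2l// lerDl.
exists 0, 4, g; split => //.
- apply: val_inj; rewrite gE ?lexx ?ler0n// /pt.
  have -> : m 0 = 0 by rewrite /m subr0 [Num.min 0 4]min_l// min_r.
  have -> : c 0 = 0 by rewrite /c sub0r min_r ?max_l//; lra.
  by rewrite mulr0 subr0 rmorph0 mul0r addr0 rmorph1 mul1r.
- apply: val_inj; rewrite gE ?lexx ?ler0n// /pt.
  have -> : m 4 = 0 by rewrite /m subrr [Num.min 4 0]min_r// min_r.
  have h : 1 <= (4 - 1) / 2 :> R by lra.
  have -> : c 4 = 1 by rewrite /c (min_l h) max_r.
  by rewrite mulr0 subr0 rmorph1 !mul1r addrC subrK.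
- apply: le_trans (g_length _ _ _) _ => //; rewrite lee_fin subr0.
  have h : k / 4 * B (x : D) y <= mdist (x : Ze) y := dz_ge x y.
  by rewrite /s; lra.
move=> t t4; have [t0 t4'] := andP t4.
apply: le_trans (boundary_dist_Ze (g t : Z)).
have f1 := curve_length_fin rg (lexx _) t0 t4'.
have f2 := curve_length_fin rg t0 t4' (lexx _).
have l1 := g_length (lexx _) t0 t4'; have l2 := g_length t0 t4' (lexx _).
rewrite gE//; have := pt_le t4.
rewrite -(fineK f1) in l1 *; rewrite -(fineK f2) in l2 *.
rewrite !lee_fin in l1 l2; rewrite -EFin_min -EFinM lee_fin.
set u := fine _ in l1 *; set v := fine _ in l2 *; set n := normc _ => nm.
(* Take the subcurve on the nearer half of [[0, 4]]: its parameter length is at most [2 * m t]. *)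
have uv : Num.min u v <= 4 * k * s * m t.
  have ks2 : 0 <= 2 * (k * s) by rewrite mulr_ge0.
  rewrite ge_min; apply/orP.
  have [t2|t2] := leP t 2.
    left; apply: le_trans l1 _; rewrite subr0.
    have mt : t <= 2 * m t.
      by rewrite /m; case: (leP t (4 - t)) => ?;
        [case: (leP 1 t) => ?|case: (leP 1 (4 - t)) => ?]; lra.
    by have := ler_wpM2l ks2 mt; lra.
  right; apply: le_trans l2 _.
  have mt : 4 - t <= 2 * m t.
    by rewrite /m; case: (leP t (4 - t)) => ?;
      [case: (leP 1 t) => ?|case: (leP 1 (4 - t)) => ?]; lra.
  by have := ler_wpM2l ks2 mt; lra.
have : k / 4 * (s * m t) <= k / 4 * (1 - n) by rewrite ler_pM2l ?divr_gt0//; lra.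
lra.
Qed.

End curve.

Lemma Ze_uniform : uniform_domain Ze.
Proof.
split.
- exact: (locally_complete_uniformized eps_gt0 geo completeZ).
- apply: (uniformized_not_complete eps_gt0 geo (ray := scaled_ray k hZ)).
  + by move=> t t0; rewrite (scaled_ray0 _ k_gt0 distE).
  + by move=> t u t0 tu; rewrite (scaled_rayP _ k_gt0 distE).
- by exists 16; [rewrite ler1n|exact: uniform_curve].
Qed.

End uniform.

Lemma rough_similarity_id (R : realType) (T : Type) (d d' : T -> T -> R)
    (hd : is_metric d) (hd' : is_metric d') (k : R) : 0 < k ->
  (forall x y, d' x y = k * d x y) ->
  rough_similarity k 0 (id : metrized hd -> metrized hd').
Proof.
move=> k0 dE; split => //.
  move=> x y; rewrite subr0 addr0.
  by change (k * d x y <= d' x y <= k * d x y); rewrite dE lexx.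
rewrite /hausdorff_dist ge_max; apply/andP; split.
  by apply: ge_ereal_sup => _ [x _ <-]; rewrite edist_inf0.
by apply: ge_ereal_sup => _ [x _ <-]; rewrite edist_inf0//; exists x.
Qed.

(** * Hyperbolic circles and the main theorem *)

Section hyperbolic_circle.
Context {R : realType}.
Local Notation D := (disk R).
Local Notation normc := Normc.normc.
Variable hY : is_metric (@hyperbolic_dist R).
Let M : metricType R := metrized hY.
Variable r : R.
Hypothesis r_gt0 : 0 < r.

Let gamma (t : R) : M := radial (normc_cis (2 * pi * t)) r.
Let len : R := pi / 2 * (expR (2 * r) - expR (- (2 * r))).
Let pi0 : 0 < pi :> R. Proof. exact: pi_gt0. Qed.

Let len_ge0 : 0 <= len.
Proof.
rewrite mulr_ge0 ?divr_ge0 ?(ltW pi0)// subr_ge0 ler_expR.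
by have h : 0 < r := r_gt0; lra.
Qed.

Let th_gt0 : 0 <= th r. Proof. exact/th_ge0/ltW. Qed.

Let lenE : len = ch r ^+ 2 / 4 * th r * (2 * pi).
Proof. by rewrite /len -ch_th; move: (pi : R) => p; field. Qed.

Lemma circle_dist_le s t : s <= t -> mdist (gamma s) (gamma t) <= len * (t - s).
Proof.
move=> st; rewrite mdist_hyperbolic; apply: le_trans (hdist_arc _ _ _) _.
rewrite (ger0_norm th_gt0) mulrA lenE -[leRHS]mulrA ler_wpM2l//.
  by rewrite mulr_ge0// divr_ge0// sqr_ge0.
apply: le_trans (normc_cisB_le _ _) _.
rewrite -mulrBr normrM (ger0_norm (_ : 0 <= 2 * pi)); last by rewrite mulr_ge0// ltW.
by rewrite distrC ger0_norm ?subr_ge0.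
Qed.

(** One factor [1 - e] comes from [sin x >= (1 - e) * x] for small [x], the other from
    [expR dst <= 1 / (1 - e)] in [chordB_le]; the two radii in the minimum serve these two
    estimates. *)
Lemma circle_dist_ge (e : R) : 0 < e -> e < 1 -> exists2 d : R, 0 < d &
  forall s t, s <= t -> t - s < d ->
    len * (1 - e) ^+ 2 * (t - s) <= mdist (gamma s) (gamma t).
Proof.
move=> e0 e1; have [d d0 dP] := @sin_ge_near R e e0.
exists (Num.min (d / pi) (e / (len + 1))).
  by rewrite lt_min !divr_gt0// ltr_wpDl.
move=> s t st; rewrite lt_min => /andP[]; set h := t - s.
have h0 : 0 <= h by rewrite subr_ge0.
rewrite ltr_pdivlMr// => hd; rewrite ltr_pdivlMr ?ltr_wpDl// => he.
have up := circle_dist_le st; rewrite -/h in up.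
rewrite mdist_hyperbolic in up *; set dst := hdist _ _ in up *.
have dst0 : 0 <= dst := hdist_ge0 _ _.
have sn : (1 - e) * (pi * h) <= sin (pi * h).
  by apply: dP; rewrite ?mulr_ge0 ?(ltW pi0)// mulrC.
have lh : len * h < e by lra.
have de : expR dst <= (1 - e)^-1.
  apply: le_trans (expR_le_inv _) _; first lra.
  by rewrite lef_pV2 ?posrE; lra.
have := chordB_le (radial (normc_cis (2 * pi * s)) r) (radial (normc_cis (2 * pi * t)) r).
rewrite -/dst gmean_radial ?defect_radial//.
have -> : chordB (radial (normc_cis (2 * pi * s)) r) (radial (normc_cis (2 * pi * t)) r) =
    th r * normc (cis (2 * pi * s) - cis (2 * pi * t)).
  by rewrite -[th r in RHS](ger0_norm th_gt0) -normc_real -Normc.normcM mulrBr.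
rewrite normc_cisB -mulrBr.
have -> : 2 * pi * (s - t) / 2 = - (pi * h).
  by rewrite /h; move: (pi : R) => p; field.
rewrite sinN normrN => hB.
have {}hB : ch r ^+ 2 / 4 * th r * 2 * sin (pi * h) <= dst * expR dst.
  have c0 : 0 < ch r ^+ 2 / 4 by rewrite divr_gt0 ?exprn_gt0 ?ch_gt0.
  have := ler_wpM2l (ltW c0) hB.
  rewrite [leRHS](_ : _ = dst * expR dst); last first.
    by field; rewrite lt0r_neq0 ?ch_gt0.
  apply: le_trans.
  have C0 : 0 <= ch r ^+ 2 / 4 * th r * 2.
    exact: mulr_ge0 (mulr_ge0 (divr_ge0 (sqr_ge0 _) (ler0n R 4)) th_gt0) (ler0n R 2).
  by apply: le_trans (ler_wpM2l C0 (ler_norm _)) _; rewrite -!mulrA.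
have hd2 : dst * expR dst <= dst * (1 - e)^-1 by rewrite ler_wpM2l.
have : ch r ^+ 2 / 4 * th r * 2 * ((1 - e) * (pi * h)) <= dst * (1 - e)^-1.
  apply: le_trans hd2; apply: le_trans hB; rewrite ler_wpM2l//.
  exact: mulr_ge0 (mulr_ge0 (divr_ge0 (sqr_ge0 _) (ler0n R 4)) th_gt0) (ler0n R 2).
rewrite ler_pdivlMr ?subr_gt0// lenE; lra.
Qed.

(** Upper bound: the parametrization is Lipschitz with constant [len]. Lower bound: [cousin] adds up
    the local estimate with factor [(1 - e) ^+ 2 >= 1 - 2 * e]. *)
Lemma circle_length : curve_length 0 1 gamma = len%:E.
Proof.
apply/le_anti/andP; split.
  have := @curve_length_le R M 0 1 gamma (fun t => len * t) ler01.
  rewrite mulr1 mulr0 subr0; apply => s t _ st _.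
  by rewrite -mulrBr circle_dist_le.
apply/lee_addgt0Pr => e' e'0.
pose e := Num.min (1 / 2) (e' / (2 * (len + 1))).
have l1 : 0 < 2 * (len + 1) by rewrite mulr_gt0// ltr_wpDl.
have e0 : 0 < e by rewrite lt_min !divr_gt0.
have e1 : e < 1.
  apply: (@le_lt_trans _ _ (1 / 2)); first by rewrite ge_min lexx.
  by lra.
have ee : e * (2 * (len + 1)) <= e' by rewrite -ler_pdivlMr// ge_min lexx orbT.
have [d d0 dP] := circle_dist_ge e0 e1.
have : ((len * (1 - e) ^+ 2 * (1 - 0))%:E <= curve_length 0 1 gamma)%E.
  apply: (@cousin R 0 1 (fun s t => ((len * (1 - e) ^+ 2 * (t - s))%:E <=
    curve_length s t gamma)%E)) => //.
    move=> s t u _ st tu _ h1 h2; rewrite (curve_lengthD gamma st tu).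
    apply: le_trans (leeD h1 h2); rewrite -EFinD lee_fin; lra.
  move=> x _; exists (d / 2); first by rewrite divr_gt0.
  move=> s t _ sx xt _ xs tx; have st := le_trans sx xt.
  apply: le_trans (dist_le_length gamma st); rewrite lee_fin dP//; lra.
move=> h; rewrite -leeBlDr//; apply: le_trans h.
rewrite -EFinB lee_fin subr0 mulr1.
have := mulr_ge0 len_ge0 (sqr_ge0 e); nra.
Qed.

Lemma circle_image : gamma @` `[0, 1] = [set z | mdist (disk0 : M) z = r].
Proof.
apply/seteqP; split=> [_ [t _ <-]|z /= zr].
  by rewrite /= mdist_hyperbolic hdist0_radial gtr0_norm.
rewrite mdist_hyperbolic in zr.
have [u [u1 zE]] := polarP (z : D); have [t t01 uE] := cisP u1.
exists t; first by rewrite /= in_itv.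
by rewrite [RHS]zE; apply: val_inj; rewrite /= zr uE.
Qed.

(** Injectivity: the Euclidean chord is proportional to [sin (pi * (t - s))], which is positive for
    [0 < t - s < 1]. *)
Lemma circle_simple : closed_simple_curve 0 1 gamma.
Proof.
split => //.
- split => //; apply/within_continuousP => x _ e e0.
  exists (e / (len + 1)); first by rewrite divr_gt0// ltr_wpDl.
  move=> y _; rewrite ltr_pdivlMr ?ltr_wpDl// => xy.
  have h : len * `|x - y| <= `|x - y| * (len + 1) by rewrite mulrC ler_wpM2l// lerDl.
  apply: le_lt_trans xy; apply: le_trans h.
  have [xy|/ltW yx] := leP x y.
    by rewrite distrC ger0_norm ?subr_ge0// circle_dist_le.
  by rewrite metric_sym ger0_norm ?subr_ge0// circle_dist_le.
- by apply: val_inj; rewrite /= mulr0 mulr1 cis2pi cis0.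
move=> s t; rewrite !in_itv/= => s01 t01 st.
wlog le_st : s t s01 t01 st / s <= t.
  by move=> H; have [/H|/ltW/H] := leP s t; [exact|move=> h; apply/esym/h].
have [s0 s1] := andP s01; have [t0 t1] := andP t01.
apply/le_anti; rewrite le_st /= leNgt; apply/negP => lt_st.
have th0 : th r != 0.
  have : normc (val (gamma 0 : D)) = th r by rewrite normc_radialE ger0_norm.
  have hr : 0 < r := r_gt0.
  have c0 := ch_gt0 r; rewrite /th mulf_neq0// ?invr_eq0 ?lt0r_neq0//.
  by rewrite subr_gt0 ltr_expR; lra.
have : chordB (gamma s : D) (gamma t) = 0 by rewrite st /chordB subrr Normc.normc0.
have -> : chordB (gamma s : D) (gamma t) =
    th r * normc (cis (2 * pi * s) - cis (2 * pi * t)).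
  by rewrite -[th r in RHS](ger0_norm th_gt0) -normc_real -Normc.normcM mulrBr.
move=> /eqP; rewrite mulf_eq0 (negbTE th0) orFb normc_cisB -mulrBr.
have -> : 2 * pi * (s - t) / 2 = - (pi * (t - s)).
  by move: (pi : R) => p; field.
rewrite sinN normrN mulf_eq0 pnatr_eq0 /= normr_eq0.
suff /lt0r_neq0/negbTE -> : 0 < sin (pi * (t - s)) by [].
apply: sin_gt0_pi; rewrite mulr_gt0 ?subr_gt0//=.
by rewrite gtr_pMr//; lra.
Qed.

End hyperbolic_circle.

Theorem mainTheorem2 (R : realType) :
  (exists hY : is_metric (@hyperbolic_dist R),
    let Y : metricType R := metrized hY in
    let y0 : Y := disk0 in
    (* length of hyperbolic circles centered at 0 *)
    (forall r : R, 0 < r ->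
      exists gamma : R -> Y,
        [/\ closed_simple_curve 0 1 gamma,
            gamma @` `[0, 1] = [set z | mdist y0 z = r] &
            curve_length 0 1 gamma
              = (pi / 2 * (expR (2 * r) - expR (- (2 * r))))%:E]) /\
    (forall eps : R, 2 < eps ->
      (* (a) *)
      (exists hYe : is_metric (uniformized_dist eps y0),
        let Ye : metricType R := metrized hYe in
        [/\ locally_complete Ye, ~ complete_space Ye & ~ uniform_domain Ye]) /\
      (* (b) *)
      (exists2 eps1 : R, 0 < eps1 &
        exists hZ : is_metric (fun z w : disk R => eps1 / eps * hyperbolic_dist z w),
          let Z : metricType R := metrized hZ in
          let z0 : Z := disk0 in
          rough_similarity (eps1 / eps) 0 (id : Y -> Z) /\
          exists hZe : is_metric (uniformized_dist eps z0),
            uniform_domain (metrized hZe : metricType R)))) /\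
  (exists (X Y : metricType R) (eps L C : R) (x0 : X) (y0 : Y) (Phi : Y -> X),
    [/\ gromov_hyperbolic X, gromov_hyperbolic Y, 0 < eps &
     [/\ rough_similarity L C Phi, Phi y0 = x0,
         exists hX : is_metric (uniformized_dist eps x0),
           uniform_domain (metrized hX : metricType R) &
         exists hYe : is_metric (uniformized_dist eps y0),
           let Ye : metricType R := metrized hYe in
           [/\ locally_complete Ye, ~ complete_space Ye & ~ uniform_domain Ye]]]).
Proof.
have hY : is_metric (@hyperbolic_dist R).
  by rewrite hyperbolic_distE; exact: hdist_metric.
have hZ (eps : R) : 0 < eps ->
    is_metric (fun z w : disk R => 2 / eps * hyperbolic_dist z w).
  by move=> e0; apply: is_metric_scale => //; rewrite divr_gt0.
have distY (z w : disk R) : hyperbolic_dist z w = 1 * hdist z w.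
  by rewrite mul1r hyperbolic_distE.
have distZ (eps : R) (z w : disk R) :
    2 / eps * hyperbolic_dist z w = 2 / eps * hdist z w.
  by rewrite hyperbolic_distE.
have hYe (eps : R) (e0 : 0 < eps) :=
  scaled_uniformized_metric hY ltr01 distY e0.
have hZe (eps : R) (e0 : 0 < eps) :=
  scaled_uniformized_metric (hZ eps e0) (divr_gt0 (ltr0n R 2) e0) (distZ eps) e0.
have rough (eps : R) (e0 : 0 < eps) :=
  @rough_similarity_id R (disk R) _ _ hY (hZ eps e0) (2 / eps)
    (divr_gt0 (ltr0n R 2) e0) (fun x y => erefl).
split.
  exists hY; split.
    move=> r r0; exists (fun t => radial (normc_cis (2 * pi * t)) r).
    by split; [exact: circle_simple|exact: circle_image|exact: circle_length].
  move=> eps eps2; have e0 : 0 < eps := lt_trans (ltr0n R 2) eps2.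
  split; first by exists (hYe eps e0); exact: Ye_not_uniform.
  (* The choice [eps1 = 2] serves every [eps], since the weight of the scaled disk is always
     [expR (- (2 * hdist))]. *)
  exists 2 => //; exists (hZ eps e0); split; first exact: rough.
  by exists (hZe eps e0); exact: Ze_uniform.
have e2 : 2 < 3 :> R by rewrite ltr_nat.
have e0 : 0 < 3 :> R by rewrite ltr0n.
(* The instance [eps = 3] of (a) and (b): [X] is the disk scaled by [2 / 3], and [Phi] is the
   identity. *)
exists (metrized (hZ 3 e0)), (metrized hY), 3, (2 / 3), 0, disk0, disk0, id; split => //.
- exact: (scaled_gromov_hyperbolic (hZ 3 e0) (divr_gt0 (ltr0n R 2) e0) (distZ 3)).
- exact: (scaled_gromov_hyperbolic hY ltr01 distY).
split => //; first exact: rough.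
  by exists (hZe 3 e0); exact: Ze_uniform.
by exists (hYe 3 e0); exact: Ye_not_uniform.
Qed.
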